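(* Let $\{\varepsilon_k\}_{k\in\mathbb{Z}}$ be a sequence of real numbers and let $L=\sup_k|\varepsilon_k|$. Suppose that $L<1/2$ and $$1-\frac{\sin(\pi L)}{\pi L}+\frac{\pi}{3}\,\frac{L\sin(\pi L)}{1-L}+\sin(\pi L)<1 .$$ Then any function $f\in PW_\pi$ is completely determined by its values $\{f(n+\varepsilon_n)\}_{n\in\mathbb{Z}}$, and there is $C=C(L)>0$ such that $$\frac1C\sum_{n\in\mathbb{Z}}|f(n+\varepsilon_n)|^2\le \|f\|_2^2\le C\sum_{n\in\mathbb{Z}}|f(n+\varepsilon_n)|^2$$ for all $f\in PW_\pi$. Moreover, there are functions $g_n\in PW_\pi$ $(n\in\mathbb{Z})$ such that for every $f\in PW_\pi$ and every $x\in\mathbb{R}$ the identity $$f(x)=\sum_{n\in\mathbb{Z}}f(n+\varepsilon_n)g_n(x)$$ holds, where the right-hand side converges absolutely.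
   Context: The Fourier transform is $\widehat f(\xi)=\int_{\mathbb{R}}f(x)e^{-2\pi i x\xi}\,dx$. $PW_\pi$ denotes the Paley--Wiener space of functions $f\in L^2(\mathbb{R})$ of exponential type at most $\pi$, i.e. those with $\widehat f$ supported in $[-1/2,1/2]$; each such $f$ is identified with its (restriction to $\mathbb{R}$ of its) entire extension, so pointwise values make sense. $\|\cdot\|_2$ is the $L^2(\mathbb{R})$ norm. For $L=0$ the quotient $\sin(\pi L)/(\pi L)$ is interpreted as $1$. *)

(* Defs.v *)
From HB Require Import structures.
From mathcomp Require Import all_boot all_order all_algebra.
From mathcomp Require Import finmap complex.
From mathcomp Require Import all_classical all_reals all_analysis.
From mathcomp.analysis Require Import showcase.summability.

Set Implicit Arguments.
Unset Strict Implicit.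
Unset Printing Implicit Defensive.

Import Order.TTheory GRing.Theory Num.Theory.
Import numFieldNormedType.Exports.

Local Open Scope classical_set_scope.
Local Open Scope complex_scope.
Local Open Scope ring_scope.

Notation cabs := ComplexField.Normc.normc.

Definition expi {R : realType} (t : R) : R[i] := cos t +i* sin t.

Definition cintegral {R : realType} (D : set R) (f : R -> R[i]) : R[i] :=
  (\int[lebesgue_measure]_(x in D) complex.Re (f x)) +i*
  (\int[lebesgue_measure]_(x in D) complex.Im (f x)).

Definition L2norm {R : realType} (f : R -> R[i]) : \bar R :=
  'N[lebesgue_measure]_2%:E[EFin \o (fun x => cabs (f x))]%E.

Definition inL2 {R : realType} (f : R -> R[i]) : Prop :=
  [/\ measurable_fun [set: R] (fun x => complex.Re (f x)),
      measurable_fun [set: R] (fun x => complex.Im (f x)) &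
      (L2norm f < +oo)%E].

Definition fourier_trunc {R : realType} (f : R -> R[i]) (A xi : R) : R[i] :=
  cintegral `[- A, A] (fun x => f x * expi (- (2 * pi * x * xi))).

(* An L2 function need not be integrable, so its Fourier integral is taken in
   the sense of Plancherel: phi is the L2 limit of the truncated integrals. *)
Definition is_fourier_transform {R : realType} (f phi : R -> R[i]) : Prop :=
  inL2 phi /\
  L2norm (fun xi => phi xi - fourier_trunc f A xi) @[A --> +oo] --> 0%E.

(* R[i]^o is R[i] seen as a normed space over itself, so that derivability
   along the direction 1 is complex differentiability. *)
Definition entire {R : realType} (F : R[i] -> R[i]) : Prop :=
  forall z : R[i], derivable (F : R[i]^o -> R[i]^o) z 1.

Definition exponential_type_le {R : realType} (F : R[i] -> R[i]) (t : R) : Prop :=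
  forall d : R, 0 < d ->
    exists A : R, forall z : R[i], cabs (F z) <= A * expR ((t + d) * cabs z).

(* An element of PW_pi is a genuine function, not a class modulo null sets: it
   is the restriction to the real line of its entire extension. *)
Definition PWpi {R : realType} (f : R -> R[i]) : Prop :=
  [/\ inL2 f,
      exists phi : R -> R[i], is_fourier_transform f phi /\
        {ae (@lebesgue_measure R),
          forall xi : R, xi \notin `[- 2^-1, 2^-1] -> phi xi = 0} &
      exists F : R[i] -> R[i],
        [/\ entire F, exponential_type_le F pi & forall x : R, f x = F x%:C]].

Definition sinc_pi {R : realType} (L : R) : R :=
  if L == 0 then 1 else sin (pi * L) / (pi * L).

(* [totally] is the filter of finite subsets of the index set ordered by
   inclusion, so the sum does not depend on an enumeration of the indices. *)
Definition abs_converges_to {R : realType} (u : int -> R[i]) (s : R[i]) : Prop :=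
  (\esum_(n in [set: int]) (cabs (u n))%:E < +oo)%E /\
  partial_sum u @ totally --> (s : R[i]^o).

(* Main.v *)
Require Import Defs.
From HB Require Import structures.
From mathcomp Require Import all_boot all_order all_algebra.
From mathcomp Require Import finmap complex.
From mathcomp Require Import all_classical all_reals all_analysis.
From mathcomp.analysis Require Import showcase.summability.
From mathcomp Require Import measurable_realfun ring lra zify.

Set Implicit Arguments.
Unset Strict Implicit.
Unset Printing Implicit Defensive.

Import Order.TTheory GRing.Theory Num.Theory.
Import numFieldNormedType.Exports.

Local Open Scope classical_set_scope.
Local Open Scope complex_scope.
Local Open Scope ring_scope.

(** A function f of PW_pi is the Fourier transform of a square integrable phi on
    the frequency interval I = [-1/2, 1/2] (PWpi_ft, ft_PWpi), so that f(x) is the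
    inner product of phi with a wave of frequency x. At the integers these waves
    form an orthonormal basis of L2(I): the f(n) are the coefficients of phi, and
    their square sum is the squared norm of f.

    The samples f(n + eps_n) are a small perturbation of the f(n). As f is the
    cardinal series with coefficients f(m), the differences f(n) - f(n + eps_n)
    are obtained from the f(m) by a matrix with entries delta_(k,0) - sinc(k + x),
    where k = n - m and x = eps_n. For k != 0 one has
      sinc(k + x) = (-1)^k sin(pi x) / (pi (k + x)),
      1 / (k + x) = 1 / k - x / (k (k + x)),
    which splits the matrix into three parts. The diagonal has norm at most
    1 - sinc(L). The term in 1 / k is sin(pi x) times the matrix (-1)^k / (pi k),
    of norm at most one: up to unimodular factors it is the multiplication by 2t on L2(I),
    and |t| <= 1/2 there. The last term is at most
    sin(pi L) / pi * L / (1 - L) / k^2 and the sum of 1 / k^2 over the nonzero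
    integers is pi^2 / 3, hence Schur's test bounds it by
    pi / 3 * L sin(pi L) / (1 - L). The hypothesis says that the sum delta of the
    three bounds is less than one (perturbation_finite, perturbation).

    Hence f |-> (f(n + eps_n)) differs from the isometry f |-> (f(n)) by a
    contraction. The triangle inequality in l2 gives
      (1 - delta) |f| <= |(f(n + eps_n))| <= (1 + delta) |f|
    (sample_lower, sample_upper), which contains the frame bounds and the fact
    that the samples determine f. A Neumann series inverts the sampling operator
    on the vectors of the canonical basis of l2 and provides the g_n, which have
    the value 1 at one sampling point and 0 at the others (dual_function). If a
    finite part of the expansion is subtracted from f, the samples of the rest are
    those of f outside that part, so sample_lower makes the rest small in norm and
    therefore pointwise (reconstruction_lim); with suitable phases on the
    coefficients the same inequality gives absolute convergence
    (reconstruction_abs).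

    These facts rest on the completeness of the trigonometric system. Bessel's
    inequality for a sawtooth is an equality, by the Basel sum, so a function
    orthogonal to all waves is orthogonal to all sawtooths, hence to the
    indicators of intervals (trigonometric_complete). Averaging Parseval's
    identity over translated systems of frequencies gives the Plancherel identity
    for transforms of functions supported on an interval (plancherel). Together
    with the multiplication formula (ft_exchange) it yields Fourier inversion for
    the elements of PW_pi (fourier_inversion). *)

(** * Complex-valued Lebesgue integrals *)

Section complex_parts.
Context {R : realType}.
Implicit Types a b z : R[i].

Lemma eqC a b : complex.Re a = complex.Re b -> complex.Im a = complex.Im b ->
  a = b.
Proof. by case: a b => [a1 a2] [b1 b2] /= -> ->. Qed.

Lemma ReD a b : complex.Re (a + b) = complex.Re a + complex.Re b.
Proof. by case: a b => [a1 a2] [b1 b2]. Qed.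

Lemma ImD a b : complex.Im (a + b) = complex.Im a + complex.Im b.
Proof. by case: a b => [a1 a2] [b1 b2]. Qed.

Lemma ReN a : complex.Re (- a) = - complex.Re a.
Proof. by case: a. Qed.

Lemma ImN a : complex.Im (- a) = - complex.Im a.
Proof. by case: a. Qed.

Lemma ReM a b : complex.Re (a * b) =
  complex.Re a * complex.Re b - complex.Im a * complex.Im b.
Proof. by case: a b => [a1 a2] [b1 b2]. Qed.

Lemma ImM a b : complex.Im (a * b) =
  complex.Re a * complex.Im b + complex.Im a * complex.Re b.
Proof. by case: a b => [a1 a2] [b1 b2]. Qed.

Lemma ReJ a : complex.Re (conjc a) = complex.Re a.
Proof. by case: a. Qed.

Lemma ImJ a : complex.Im (conjc a) = - complex.Im a.
Proof. by case: a. Qed.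

Definition ReImE := (ReD, ImD, ReN, ImN, ReM, ImM, ReJ, ImJ).

Lemma cabs_sq z : cabs z ^+ 2 = complex.Re z ^+ 2 + complex.Im z ^+ 2.
Proof. by case: z => a b /=; rewrite sqr_sqrtr// addr_ge0 ?sqr_ge0. Qed.

Lemma cabs_ge0 z : 0 <= cabs z.
Proof. by case: z => a b /=; exact: sqrtr_ge0. Qed.

Lemma cabsC (r : R) : cabs r%:C = `|r|.
Proof. by rewrite /= expr0n addr0 sqrtr_sqr. Qed.

Lemma cabsJ z : cabs (conjc z) = cabs z.
Proof. by case: z => a b /=; rewrite sqrrN. Qed.

Lemma cabsM a b : cabs (a * b) = cabs a * cabs b.
Proof. exact: ComplexField.Normc.normcM. Qed.

Lemma cabsD a b : cabs (a + b) <= cabs a + cabs b.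
Proof. exact: (@le_normcD R). Qed.

Lemma cabsN a : cabs (- a) = cabs a.
Proof. by case: a => x y /=; rewrite !sqrrN. Qed.

Lemma cabsB a b : cabs (a - b) = cabs (b - a).
Proof. by rewrite -cabsN opprB. Qed.

Lemma cabs0 : cabs (0 : R[i]) = 0.
Proof. exact: ComplexField.Normc.normc0. Qed.

Lemma cabs_eq0 z : cabs z = 0 -> z = 0.
Proof. exact: ComplexField.Normc.eq0_normc. Qed.

Lemma normCE z : `|z| = (cabs z)%:C.
Proof. by rewrite normc_def; case: z. Qed.

Lemma Re_le_cabs z : `|complex.Re z| <= cabs z.
Proof.
rewrite -(@ler_pXn2r _ 2)// ?nnegrE ?cabs_ge0// cabs_sq real_normK ?num_real//.
by rewrite lerDl sqr_ge0.
Qed.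

Lemma Im_le_cabs z : `|complex.Im z| <= cabs z.
Proof.
rewrite -(@ler_pXn2r _ 2)// ?nnegrE ?cabs_ge0// cabs_sq real_normK ?num_real//.
by rewrite lerDr sqr_ge0.
Qed.

Lemma cabs_le_ReIm z : cabs z <= `|complex.Re z| + `|complex.Im z|.
Proof.
rewrite -(@ler_pXn2r _ 2)// ?nnegrE ?cabs_ge0 ?addr_ge0// cabs_sq sqrrD.
rewrite !real_normK ?num_real// -addrA [X in _ <= _ + X]addrC addrA lerDl.
by rewrite mulrn_wge0// mulr_ge0.
Qed.

Lemma mulcJ z : z * conjc z = (cabs z ^+ 2)%:C.
Proof. by rewrite cabs_sq; case: z => a b; simpc; congr (_ +i* _); ring. Qed.

(** The polarisation identity behind every expansion of a squared L2 norm. *)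
Lemma cabs_sqB a b :
  cabs (a - b) ^+ 2 =
    cabs a ^+ 2 - 2 * complex.Re (a * conjc b) + cabs b ^+ 2.
Proof. by rewrite !cabs_sq !ReImE; ring. Qed.

Lemma cabs_sqD_le a b : cabs (a + b) ^+ 2 <= 2 * cabs a ^+ 2 + 2 * cabs b ^+ 2.
Proof.
rewrite -subr_ge0 (_ : _ - _ = cabs (a - b) ^+ 2) ?sqr_ge0//.
by rewrite !cabs_sq !ReImE; ring.
Qed.

Lemma cabs_mulJ_le a b : cabs (a * conjc b) <= cabs a ^+ 2 + cabs b ^+ 2.
Proof.
rewrite cabsM cabsJ; have := cabs_ge0 a; have := cabs_ge0 b.
by have := sqr_ge0 (cabs a - cabs b); nra.
Qed.

Lemma expiD (s t : R) : expi (s + t) = expi s * expi t.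
Proof.
by rewrite /expi cosD sinD; apply: eqC; rewrite ?ReImE//= addrC.
Qed.

Lemma expi0 : expi (0 : R) = 1.
Proof. by rewrite /expi cos0 sin0. Qed.

Lemma expiN (t : R) : expi (- t) = conjc (expi t).
Proof. by rewrite /expi cosN sinN. Qed.

Lemma cabs_expi (t : R) : cabs (expi t) = 1.
Proof. by rewrite /expi /= cos2Dsin2 sqrtr1. Qed.

End complex_parts.

Section cintegral.
Context {R : realType}.
Local Notation mu := (@lebesgue_measure R).
Implicit Types (D : set (measurableTypeR R)) (f g h : R -> R[i]).

Lemma ae_imp (P Q : R -> Prop) : (forall x, P x -> Q x) ->
  {ae mu, forall x, P x} -> {ae mu, forall x, Q x}.
Proof.
have F : Filter (nbhs (almost_everywhere mu)) by apply: ae_filter_ringOfSetsType.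
by move=> PQ h; apply: (@filterS _ _ F _ _ _ h).
Qed.

Lemma ae_and (P Q : R -> Prop) : {ae mu, forall x, P x} ->
  {ae mu, forall x, Q x} -> {ae mu, forall x, P x /\ Q x}.
Proof.
have F : Filter (nbhs (almost_everywhere mu)) by apply: ae_filter_ringOfSetsType.
by move=> h1 h2; apply: (@filterS2 _ _ F _ _ _ _ h1 h2).
Qed.

Lemma Rint_eq D (p q : R -> R) : (forall x, D x -> p x = q x) ->
  \int[mu]_(x in D) p x = \int[mu]_(x in D) q x.
Proof. by move=> pq; apply: eq_Rintegral => x; rewrite inE => /pq. Qed.

Definition cintegrable D f :=
  mu.-integrable D (EFin \o (@complex.Re R \o f)) /\
  mu.-integrable D (EFin \o (@complex.Im R \o f)).

Lemma cintegrableD D f g : measurable D ->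
  cintegrable D f -> cintegrable D g -> cintegrable D (fun x => f x + g x).
Proof.
move=> mD [f1 f2] [g1 g2]; split.
- apply: (eq_integrable mD _ _ _ (integrableD mD f1 g1)) => x _ /=.
  by rewrite ReD EFinD.
- apply: (eq_integrable mD _ _ _ (integrableD mD f2 g2)) => x _ /=.
  by rewrite ImD EFinD.
Qed.

Lemma cintegrableZ D f (c : R[i]) : measurable D ->
  cintegrable D f -> cintegrable D (fun x => c * f x).
Proof.
move=> mD [f1 f2]; split.
- have := integrableB mD (integrableZl mD (complex.Re c) f1)
    (integrableZl mD (complex.Im c) f2).
  by apply: (eq_integrable mD) => x _ /=; rewrite ReM EFinB !EFinM.
- have := integrableD mD (integrableZl mD (complex.Re c) f2)
    (integrableZl mD (complex.Im c) f1).
  by apply: (eq_integrable mD) => x _ /=; rewrite ImM EFinD !EFinM.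
Qed.

Lemma cintegrable_eq D f g : measurable D -> (forall x, D x -> f x = g x) ->
  cintegrable D f -> cintegrable D g.
Proof.
move=> mD fg [f1 f2]; split.
- by apply: (eq_integrable mD _ _ _ f1) => x; rewrite inE /= => /fg ->.
- by apply: (eq_integrable mD _ _ _ f2) => x; rewrite inE /= => /fg ->.
Qed.

Lemma Re_cintegral D f :
  complex.Re (cintegral D f) = \int[mu]_(x in D) complex.Re (f x).
Proof. by []. Qed.

Lemma Im_cintegral D f :
  complex.Im (cintegral D f) = \int[mu]_(x in D) complex.Im (f x).
Proof. by []. Qed.

Lemma cintegral_eq D f g : (forall x, D x -> f x = g x) ->
  cintegral D f = cintegral D g.
Proof.
move=> fg; rewrite /cintegral; congr (_ +i* _);
  by apply: eq_Rintegral => x; rewrite inE => /fg ->.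
Qed.

Lemma cintegralD D f g : measurable D -> cintegrable D f -> cintegrable D g ->
  cintegral D (fun x => f x + g x) = cintegral D f + cintegral D g.
Proof.
move=> mD [f1 f2] [g1 g2]; apply: eqC; rewrite ?ReImE/=.
- by rewrite -RintegralD//; apply: eq_Rintegral => x _; rewrite ReD.
- by rewrite -RintegralD//; apply: eq_Rintegral => x _; rewrite ImD.
Qed.

Lemma cintegralZ D f (c : R[i]) : measurable D -> cintegrable D f ->
  cintegral D (fun x => c * f x) = c * cintegral D f.
Proof.
move=> mD [f1 f2].
have Z k (p : R -> R) : mu.-integrable D (EFin \o p) ->
    mu.-integrable D (EFin \o (fun x => k * p x)).
  by move=> ip; apply: (eq_integrable mD _ _ _ (integrableZl mD k ip)) => x _ /=;
    rewrite EFinM.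
apply: eqC; rewrite ?ReImE/= -!RintegralZl//.
- by rewrite -RintegralB ?Z//; apply: eq_Rintegral => x _; rewrite ReM.
- by rewrite -RintegralD ?Z//; apply: eq_Rintegral => x _; rewrite ImM.
Qed.

Lemma cintegralN D f : measurable D -> cintegrable D f ->
  cintegral D (fun x => - f x) = - cintegral D f.
Proof.
move=> mD f1; rewrite -mulN1r -cintegralZ//.
by apply: cintegral_eq => x _; rewrite mulN1r.
Qed.

Lemma cintegrableN D f : measurable D -> cintegrable D f ->
  cintegrable D (fun x => - f x).
Proof.
move=> mD /(cintegrableZ (-1) mD); apply: cintegrable_eq => // x _.
by rewrite mulN1r.
Qed.

Lemma cintegral_conj D f : measurable D -> cintegrable D f ->
  cintegral D (fun x => conjc (f x)) = conjc (cintegral D f).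
Proof.
move=> mD [f1 f2]; apply: eqC; rewrite ?ReImE/=.
- by apply: eq_Rintegral => x _; rewrite ReJ.
- rewrite -mulN1r -RintegralZl//.
  by apply: eq_Rintegral => x _; rewrite ImJ mulN1r.
Qed.

Lemma cintegrable_le D f (g : R -> R) : measurable D ->
  measurable_fun D (@complex.Re R \o f) -> measurable_fun D (@complex.Im R \o f) ->
  mu.-integrable D (EFin \o g) -> (forall x, D x -> cabs (f x) <= g x) ->
  cintegrable D f.
Proof.
move=> mD mf1 mf2 ig fg; split; apply: (le_integrable mD _ _ ig).
- exact/measurable_EFinP.
- move=> x Dx; rewrite /= lee_fin; apply: (le_trans (Re_le_cabs _)).
  exact: le_trans (fg x Dx) (ler_norm _).
- exact/measurable_EFinP.
- move=> x Dx; rewrite /= lee_fin; apply: (le_trans (Im_le_cabs _)).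
  exact: le_trans (fg x Dx) (ler_norm _).
Qed.

Lemma measurable_cabs_sq D f :
  measurable_fun D (@complex.Re R \o f) -> measurable_fun D (@complex.Im R \o f) ->
  measurable_fun D (fun x => cabs (f x) ^+ 2).
Proof.
move=> mf1 mf2; rewrite (_ : (fun _ => _) =
    fun x => (@complex.Re R \o f) x ^+ 2 + (@complex.Im R \o f) x ^+ 2).
  by apply: measurable_funD; exact: measurable_funX.
by apply/funext => x; rewrite cabs_sq.
Qed.

Lemma measurable_cabs D f :
  measurable_fun D (@complex.Re R \o f) -> measurable_fun D (@complex.Im R \o f) ->
  measurable_fun D (fun x => cabs (f x)).
Proof.
move=> mf1 mf2; rewrite (_ : (fun _ => _) =
    Num.sqrt \o (fun x => cabs (f x) ^+ 2)); last first.
  by apply/funext => x /=; rewrite sqrtr_sqr ger0_norm// cabs_ge0.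
by apply: measurableT_comp; [exact: (continuous_measurable_fun (@sqrt_continuous R))|exact: measurable_cabs_sq].
Qed.

Lemma cintegrable_meas D f : cintegrable D f ->
  measurable_fun D (@complex.Re R \o f) /\ measurable_fun D (@complex.Im R \o f).
Proof.
by case=> /measurable_int/measurable_EFinP ? /measurable_int/measurable_EFinP.
Qed.

Lemma cintegrable_cabs D f : measurable D -> cintegrable D f ->
  mu.-integrable D (EFin \o (fun x => cabs (f x))).
Proof.
move=> mD If; have [m1 m2] := cintegrable_meas If; case: If => i1 i2.
have i := integrableD mD (integrable_norm i1) (integrable_norm i2).
apply: (le_integrable mD _ _ i).
  by apply/measurable_EFinP; exact: measurable_cabs.
move=> x _ /=; rewrite lee_fin [leRHS]ger0_norm ?addr_ge0//.
by rewrite ger0_norm ?cabs_ge0// cabs_le_ReIm.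
Qed.

(** Multiplying the integral by its conjugate makes it a nonnegative
    real number, which is then the integral of a real part. *)
Lemma cabs_cintegral_le D f : measurable D -> cintegrable D f ->
  cabs (cintegral D f) <= \int[mu]_(x in D) cabs (f x).
Proof.
move=> mD If; set z := cintegral D f.
have [/eqP z0|z0] := boolP (cabs z == 0).
  by rewrite z0; apply: Rintegral_ge0 => x _; exact: cabs_ge0.
have zp : 0 < cabs z by rewrite lt_def z0 cabs_ge0.
have If2 : cintegrable D (fun x => conjc z * f x) by exact: cintegrableZ.
have e : cabs z ^+ 2 = \int[mu]_(x in D) complex.Re (conjc z * f x).
  transitivity (complex.Re (cintegral D (fun x => conjc z * f x))) => //.
  by rewrite cintegralZ// mulrC mulcJ.
rewrite -(@ler_pM2l _ (cabs z))// -expr2 e -RintegralZl//; last first.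
  exact: cintegrable_cabs.
apply: le_Rintegral => //.
- by case: If2.
- have := integrableZl mD (cabs z) (cintegrable_cabs mD If).
  by apply: (eq_integrable mD) => x _ /=; rewrite EFinM.
- move=> x _; apply: (le_trans (ler_norm _)).
  by apply: (le_trans (Re_le_cabs _)); rewrite cabsM cabsJ.
Qed.

(** * Square integrable functions *)

Definition L2on D f :=
  [/\ measurable_fun D (@complex.Re R \o f), measurable_fun D (@complex.Im R \o f) &
      mu.-integrable D (EFin \o (fun x => cabs (f x) ^+ 2))].

Definition sq2 D f : R := \int[mu]_(x in D) (cabs (f x) ^+ 2).

Definition ip D f g : R[i] := cintegral D (fun x => f x * conjc (g x)).

Lemma sq2_ge0 D f : 0 <= sq2 D f.
Proof. by apply: Rintegral_ge0 => x _; exact: sqr_ge0. Qed.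

Lemma measurable_mulJ D f g :
  measurable_fun D (@complex.Re R \o f) -> measurable_fun D (@complex.Im R \o f) ->
  measurable_fun D (@complex.Re R \o g) -> measurable_fun D (@complex.Im R \o g) ->
  measurable_fun D (@complex.Re R \o (fun x => f x * conjc (g x))) /\
  measurable_fun D (@complex.Im R \o (fun x => f x * conjc (g x))).
Proof.
move=> f1 f2 g1 g2; split.
- rewrite (_ : _ \o _ = fun x => (@complex.Re R \o f) x * (@complex.Re R \o g) x +
      (@complex.Im R \o f) x * (@complex.Im R \o g) x).
    by apply: measurable_funD; exact: measurable_funM.
  by apply/funext => x /=; rewrite !ReImE; ring.
- rewrite (_ : _ \o _ = fun x => (@complex.Im R \o f) x * (@complex.Re R \o g) x -
      (@complex.Re R \o f) x * (@complex.Im R \o g) x).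
    by apply: measurable_funB; exact: measurable_funM.
  by apply/funext => x /=; rewrite !ReImE; ring.
Qed.

Lemma L2on_mulJ D f g : measurable D -> L2on D f -> L2on D g ->
  cintegrable D (fun x => f x * conjc (g x)).
Proof.
move=> mD [f1 f2 f3] [g1 g2 g3].
have [m1 m2] := measurable_mulJ f1 f2 g1 g2.
apply: (cintegrable_le mD m1 m2 (integrableD mD f3 g3)) => x _.
exact: cabs_mulJ_le.
Qed.

Lemma L2onD D f g : measurable D -> L2on D f -> L2on D g ->
  L2on D (fun x => f x + g x).
Proof.
move=> mD [f1 f2 f3] [g1 g2 g3].
have m1 : measurable_fun D (@complex.Re R \o (fun x => f x + g x)).
  rewrite (_ : _ \o _ = (@complex.Re R \o f) \+ (@complex.Re R \o g)).
    exact: measurable_funD.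
  by apply/funext => x /=; rewrite ReD.
have m2 : measurable_fun D (@complex.Im R \o (fun x => f x + g x)).
  rewrite (_ : _ \o _ = (@complex.Im R \o f) \+ (@complex.Im R \o g)).
    exact: measurable_funD.
  by apply/funext => x /=; rewrite ImD.
split => //.
have i := integrableD mD (integrableZl mD 2 f3) (integrableZl mD 2 g3).
apply: (le_integrable mD _ _ i).
  by apply/measurable_EFinP; exact: measurable_cabs_sq.
move=> x _ /=; rewrite lee_fin !ger0_norm ?addr_ge0 ?mulr_ge0 ?sqr_ge0 ?cabs_ge0//.
exact: cabs_sqD_le.
Qed.

Lemma L2onZ D f (c : R[i]) : measurable D -> L2on D f ->
  L2on D (fun x => c * f x).
Proof.
move=> mD [f1 f2 f3]; split.
- rewrite (_ : _ \o _ = fun x => complex.Re c * (@complex.Re R \o f) x -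
      complex.Im c * (@complex.Im R \o f) x).
    by apply: measurable_funB; exact: measurable_funM.
  by apply/funext => x /=; rewrite !ReImE; ring.
- rewrite (_ : _ \o _ = fun x => complex.Re c * (@complex.Im R \o f) x +
      complex.Im c * (@complex.Re R \o f) x).
    by apply: measurable_funD; exact: measurable_funM.
  by apply/funext => x /=; rewrite !ReImE; ring.
- apply: (eq_integrable mD _ _ _ (integrableZl mD (cabs c ^+ 2) f3)) => x _ /=.
  by rewrite cabsM exprMn EFinM.
Qed.

Lemma L2on_eq D f g : measurable D -> (forall x, D x -> f x = g x) ->
  L2on D f -> L2on D g.
Proof.
move=> mD fg [f1 f2 f3]; split.
- by apply: eq_measurable_fun f1 => x; rewrite inE /= => /fg ->.
- by apply: eq_measurable_fun f2 => x; rewrite inE /= => /fg ->.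
- by apply: (eq_integrable mD _ _ _ f3) => x; rewrite inE /= => /fg ->.
Qed.

Lemma L2onB D f g : measurable D -> L2on D f -> L2on D g ->
  L2on D (fun x => f x - g x).
Proof.
move=> mD lf lg; apply: (L2on_eq mD _ (L2onD mD lf (L2onZ (-1) mD lg))) => x _.
by rewrite mulN1r.
Qed.

Lemma L2on0 D : measurable D -> L2on D (fun=> 0).
Proof.
move=> mD; split; try exact: measurable_cst.
apply: (eq_integrable mD _ _ _ (integrable0 _ D)) => x _ /=.
by rewrite expr0n addr0 sqrtr0 expr0n.
Qed.

Lemma L2on_sum D (I : eqType) (s : seq I) (F : I -> R -> R[i]) : measurable D ->
  (forall i, i \in s -> L2on D (F i)) ->
  L2on D (fun x => \sum_(i <- s) F i x).
Proof.
move=> mD; elim: s => [|i s IH] H.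
  by apply: (L2on_eq mD _ (L2on0 mD)) => x _; rewrite big_nil.
have a : L2on D (F i) by apply: H; rewrite mem_head.
have b : L2on D (fun x => \sum_(i <- s) F i x).
  by apply: IH => j js; apply: H; rewrite in_cons js orbT.
by apply: (L2on_eq mD _ (L2onD mD a b)) => x _; rewrite big_cons.
Qed.

Lemma L2onJ D f : measurable D -> L2on D f -> L2on D (fun x => conjc (f x)).
Proof.
move=> mD [f1 f2 f3]; split.
- by rewrite (_ : _ \o _ = @complex.Re R \o f)//; apply/funext => x /=; rewrite ReJ.
- rewrite (_ : _ \o _ = \- (@complex.Im R \o f)).
    exact: measurableT_comp.
  by apply/funext => x /=; rewrite ImJ.
- by apply: (eq_integrable mD _ _ _ f3) => x _ /=; rewrite cabsJ.
Qed.

Lemma sq2_eq D f g : (forall x, D x -> f x = g x) -> sq2 D f = sq2 D g.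
Proof. by move=> fg; apply: eq_Rintegral => x; rewrite inE => /fg ->. Qed.

Lemma ip_eq D f g f' g' : (forall x, D x -> f x = f' x) ->
  (forall x, D x -> g x = g' x) -> ip D f g = ip D f' g'.
Proof. by move=> ff gg; apply: cintegral_eq => x Dx; rewrite ff ?gg. Qed.

Lemma sq2Z D f (c : R[i]) : measurable D -> L2on D f ->
  sq2 D (fun x => c * f x) = cabs c ^+ 2 * sq2 D f.
Proof.
move=> mD [_ _ f3]; rewrite /sq2 -RintegralZl//.
by apply: eq_Rintegral => x _; rewrite cabsM exprMn.
Qed.

Lemma sq2E D f : ip D f f = (sq2 D f)%:C.
Proof.
rewrite /ip /cintegral /sq2; apply: eqC => /=.
- by apply: eq_Rintegral => x _; rewrite mulcJ.
- rewrite (@eq_Rintegral _ _ _ _ _ (fun=> 0)).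
    by rewrite /Rintegral integral0.
  by move=> x _; rewrite mulcJ.
Qed.

Lemma ipDl D f g h : measurable D -> L2on D f -> L2on D g -> L2on D h ->
  ip D (fun x => f x + g x) h = ip D f h + ip D g h.
Proof.
move=> mD lf lg lh; rewrite /ip -cintegralD//; try exact: L2on_mulJ.
by apply: cintegral_eq => x _; rewrite mulrDl.
Qed.

Lemma ipZl D f g (c : R[i]) : measurable D -> L2on D f -> L2on D g ->
  ip D (fun x => c * f x) g = c * ip D f g.
Proof.
move=> mD lf lg; rewrite /ip -cintegralZ//; last exact: L2on_mulJ.
by apply: cintegral_eq => x _; rewrite mulrA.
Qed.

Lemma ipBl D f g h : measurable D -> L2on D f -> L2on D g -> L2on D h ->
  ip D (fun x => f x - g x) h = ip D f h - ip D g h.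
Proof.
move=> mD lf lg lh; rewrite -mulN1r -ipZl// -ipDl//; last exact: L2onZ.
by apply: ip_eq => // x _; rewrite mulN1r.
Qed.

Lemma ip_sumul D (I : eqType) (s : seq I) (F : I -> R -> R[i]) g :
  measurable D -> (forall i, i \in s -> L2on D (F i)) -> L2on D g ->
  ip D (fun x => \sum_(i <- s) F i x) g = \sum_(i <- s) ip D (F i) g.
Proof.
move=> mD + lg; elim: s => [|i s IH] H.
  rewrite big_nil /ip (@cintegral_eq _ _ (fun=> 0)); last first.
    by move=> x _; rewrite big_nil mul0r.
  by rewrite /cintegral /Rintegral integral0.
have a : L2on D (F i) by apply: H; rewrite mem_head.
have H' j : j \in s -> L2on D (F j).
  by move=> js; apply: H; rewrite in_cons js orbT.
have b : L2on D (fun x => \sum_(i <- s) F i x) by apply: L2on_sum.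
rewrite big_cons -IH// -ipDl//.
by apply: ip_eq => // x _; rewrite big_cons.
Qed.

Lemma ipC D f g : measurable D -> L2on D f -> L2on D g ->
  ip D g f = conjc (ip D f g).
Proof.
move=> mD lf lg; rewrite /ip -cintegral_conj//; last exact: L2on_mulJ.
by apply: cintegral_eq => x _; apply: eqC; rewrite !ReImE; ring.
Qed.

Lemma sq2B D f g : measurable D -> L2on D f -> L2on D g ->
  sq2 D (fun x => f x - g x) = sq2 D f - 2 * complex.Re (ip D f g) + sq2 D g.
Proof.
move=> mD lf lg; have [fg1 _] := L2on_mulJ mD lf lg.
case: lf lg => [f1 f2 f3] [g1 g2 g3].
have Z : mu.-integrable D (EFin \o (fun x => 2 * complex.Re (f x * conjc (g x)))).
  by apply: (eq_integrable mD _ _ _ (integrableZl mD 2 fg1)) => x _ /=;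
    rewrite EFinM.
have Y : mu.-integrable D (EFin \o (fun x => cabs (f x) ^+ 2 -
    2 * complex.Re (f x * conjc (g x)))).
  by apply: (eq_integrable mD _ _ _ (integrableB mD f3 Z)) => x _ /=.
rewrite /sq2 /= -RintegralZl// -RintegralB// -RintegralD//.
by apply: eq_Rintegral => x _; rewrite cabs_sqB.
Qed.

(** Minimising sq2 (f - t <f,g> g) over the real number t. *)
Lemma ip_CauchySchwarz D f g : measurable D -> L2on D f -> L2on D g ->
  cabs (ip D f g) ^+ 2 <= sq2 D f * sq2 D g.
Proof.
move=> mD lf lg; set z := ip D f g.
have H (t : R) : 0 <= sq2 D f - 2 * t * cabs z ^+ 2
    + t ^+ 2 * cabs z ^+ 2 * sq2 D g.
  have lg' : L2on D (fun x => t%:C * z * g x) by exact: L2onZ.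
  have := sq2_ge0 D (fun x => f x - t%:C * z * g x).
  rewrite sq2B// sq2Z// ipC// ipZl// (ipC mD lf lg) -/z ReJ -mulrA mulcJ.
  rewrite cabsM exprMn cabsC real_normK ?num_real//.
  by rewrite ReM /= mul0r subr0 mulrA.
have f0 := sq2_ge0 D f; have g0 := sq2_ge0 D g.
have [g1|g1] := eqVneq (sq2 D g) 0.
  rewrite g1 mulr0 leNgt; apply/negP => zp.
  have := H ((sq2 D f + 1) / (2 * cabs z ^+ 2)); rewrite g1.
  have -> : 2 * ((sq2 D f + 1) / (2 * cabs z ^+ 2)) * cabs z ^+ 2 = sq2 D f + 1.
    by field; move: zp; rewrite lt_def => /andP[]; rewrite expf_eq0.
  by lra.
have gp : 0 < sq2 D g by rewrite lt_def g1.
have := H (sq2 D g)^-1.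
have -> : sq2 D f - 2 * (sq2 D g)^-1 * cabs z ^+ 2 +
    (sq2 D g)^-1 ^+ 2 * cabs z ^+ 2 * sq2 D g =
    (sq2 D f * sq2 D g - cabs z ^+ 2) / sq2 D g by field.
by rewrite pmulr_lge0 ?invr_gt0// subr_ge0.
Qed.

End cintegral.

#[global] Arguments cintegral : simpl never.
#[global] Arguments ip : simpl never.
#[global] Arguments sq2 : simpl never.

(** * Completeness of L2 *)

Section L2norm.
Context {R : realType}.
Local Notation mu := (@lebesgue_measure R).
Implicit Types (D : set (measurableTypeR R)) (f g h : R -> R[i]).

Definition nrm2 D f : R := Num.sqrt (sq2 D f).

Lemma nrm2_ge0 D f : 0 <= nrm2 D f.
Proof. exact: sqrtr_ge0. Qed.

Lemma nrm2K D f : nrm2 D f ^+ 2 = sq2 D f.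
Proof. by rewrite sqr_sqrtr// sq2_ge0. Qed.

Lemma nrm2_le D f (c : R) : 0 <= c -> sq2 D f <= c ^+ 2 -> nrm2 D f <= c.
Proof.
by move=> c0 fc; rewrite -(@ler_pXn2r _ 2)// ?nnegrE ?nrm2_ge0// nrm2K.
Qed.

Lemma CauchySchwarz_nrm2 D f g : measurable D -> L2on D f -> L2on D g ->
  cabs (ip D f g) <= nrm2 D f * nrm2 D g.
Proof.
move=> mD lf lg; rewrite -(@ler_pXn2r _ 2)//.
- by rewrite exprMn !nrm2K; exact: ip_CauchySchwarz.
- by rewrite nnegrE cabs_ge0.
- by rewrite nnegrE mulr_ge0 ?nrm2_ge0.
Qed.

Lemma nrm2Z D f (c : R[i]) : measurable D -> L2on D f ->
  nrm2 D (fun x => c * f x) = cabs c * nrm2 D f.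
Proof.
move=> mD lf; rewrite /nrm2 sq2Z// sqrtrM ?sqr_ge0//.
by rewrite sqrtr_sqr ger0_norm ?cabs_ge0.
Qed.

Lemma nrm2B D f g : measurable D -> L2on D f -> L2on D g ->
  nrm2 D (fun x => f x - g x) <= nrm2 D f + nrm2 D g.
Proof.
move=> mD lf lg; apply: nrm2_le; first by rewrite addr_ge0 ?nrm2_ge0.
rewrite sq2B// sqrrD !nrm2K lerD2r lerD2l.
have := CauchySchwarz_nrm2 mD lf lg.
have := le_trans (ler_norm _) (Re_le_cabs (- ip D f g)).
by rewrite ReN cabsN mulr2n; lra.
Qed.

Lemma nrm2D D f g : measurable D -> L2on D f -> L2on D g ->
  nrm2 D (fun x => f x + g x) <= nrm2 D f + nrm2 D g.
Proof.
move=> mD lf lg; have lg' := L2onZ (-1) mD lg.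
have -> : nrm2 D (fun x => f x + g x) = nrm2 D (fun x => f x - (-1) * g x).
  by congr Num.sqrt; apply: sq2_eq => x _; rewrite mulN1r opprK.
by apply: (le_trans (nrm2B mD lf lg')); rewrite nrm2Z// cabsN cabsC normr1 mul1r.
Qed.

Lemma sq2_ereal D f : measurable D -> L2on D f ->
  (\int[mu]_(x in D) (cabs (f x) ^+ 2)%:E = (sq2 D f)%:E)%E.
Proof.
move=> mD [_ _ f3]; rewrite /sq2 /Rintegral fineK//.
exact: integrable_fin_num.
Qed.

Lemma L2on_of_finite D f : measurable D ->
  measurable_fun D (@complex.Re R \o f) ->
  measurable_fun D (@complex.Im R \o f) ->
  (\int[mu]_(x in D) (cabs (f x) ^+ 2)%:E < +oo)%E -> L2on D f.
Proof.
move=> mD m1 m2 foo; split=> //; apply/integrableP; split.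
  by apply/measurable_EFinP; exact: measurable_cabs_sq.
by under eq_integral do rewrite /= (ger0_norm (sqr_ge0 _)).
Qed.

Lemma L2on_cintegrable D f : measurable D -> (mu D < +oo)%E -> L2on D f ->
  cintegrable D f.
Proof.
move=> mD Doo lf.
have l1 : L2on D (fun=> 1).
  apply: L2on_of_finite => //; try exact: measurable_cst.
  under eq_integral do rewrite (cabsC 1) normr1 expr1n.
  by rewrite integral_cst// mul1e.
apply: (cintegrable_eq mD _ (L2on_mulJ mD lf l1)) => x _.
by rewrite conjc1 mulr1.
Qed.

Lemma L1_le_sq2 D f (s : R) : measurable D -> (mu D < +oo)%E -> L2on D f ->
  0 < s ->
  (\int[mu]_(x in D) (cabs (f x))%:E <=
    (s * fine (mu D) + s^-1 * sq2 D f)%:E)%E.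
Proof.
move=> mD Doo lf s0; have [f1 f2 f3] := lf.
have Dfin : mu D \is a fin_num by rewrite ge0_fin_numE.
rewrite EFinD !EFinM fineK// -(sq2_ereal mD lf) -integral_cst//.
rewrite -ge0_integralZl//; last 3 first.
- by apply/measurable_EFinP; exact: measurable_cabs_sq.
- by move=> x _; rewrite lee_fin sqr_ge0.
- by rewrite lee_fin invr_ge0 ltW.
rewrite -ge0_integralD//; last 3 first.
- by move=> x _; rewrite lee_fin ltW.
- by move=> x _; rewrite -EFinM lee_fin mulr_ge0 ?sqr_ge0 ?invr_ge0 ?ltW.
- apply: measurable_funeM; apply/measurable_EFinP; exact: measurable_cabs_sq.
apply: ge0_le_integral => //.
- by move=> x _; rewrite lee_fin cabs_ge0.
- by apply/measurable_EFinP; exact: measurable_cabs.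
- apply: emeasurable_funD => //.
  apply: measurable_funeM; apply/measurable_EFinP; exact: measurable_cabs_sq.
- move=> x _; rewrite -EFinM -EFinD lee_fin -subr_ge0.
  rewrite (_ : _ - _ =
    s^-1 * ((cabs (f x) - s / 2) ^+ 2 + 3 / 4 * s ^+ 2)); last first.
    by field; rewrite gt_eqF.
  rewrite mulr_ge0 ?invr_ge0 ?(ltW s0)// addr_ge0 ?sqr_ge0//.
  by rewrite mulr_ge0 ?sqr_ge0// divr_ge0.
Qed.

Lemma sq2_le_integral D f (c : R) :
  (\int[mu]_(x in D) (cabs (f x) ^+ 2)%:E <= c%:E)%E -> sq2 D f <= c.
Proof.
move=> h; rewrite /sq2 /Rintegral -lee_fin fineK// ge0_fin_numE ?integral_ge0//.
  by rewrite (le_lt_trans h)// ltry.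
by move=> x _; rewrite lee_fin sqr_ge0.
Qed.

Lemma measurable_ReImB D f g :
  measurable_fun D (@complex.Re R \o f) -> measurable_fun D (@complex.Im R \o f) ->
  measurable_fun D (@complex.Re R \o g) -> measurable_fun D (@complex.Im R \o g) ->
  measurable_fun D (@complex.Re R \o (fun x => f x - g x)) /\
  measurable_fun D (@complex.Im R \o (fun x => f x - g x)).
Proof.
move=> f1 f2 g1 g2; split.
- rewrite (_ : _ \o _ = (@complex.Re R \o f) \- (@complex.Re R \o g)).
    exact: measurable_funB.
  by apply/funext => x /=; rewrite !ReImE.
- rewrite (_ : _ \o _ = (@complex.Im R \o f) \- (@complex.Im R \o g)).
    exact: measurable_funB.
  by apply/funext => x /=; rewrite !ReImE.
Qed.

Lemma measurable_cabs_sqB D f g :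
  measurable_fun D (@complex.Re R \o f) -> measurable_fun D (@complex.Im R \o f) ->
  measurable_fun D (@complex.Re R \o g) -> measurable_fun D (@complex.Im R \o g) ->
  measurable_fun D (fun x => (cabs (f x - g x) ^+ 2)%:E).
Proof.
move=> f1 f2 g1 g2; have [m1 m2] := measurable_ReImB f1 f2 g1 g2.
by apply/measurable_EFinP; exact: measurable_cabs_sq.
Qed.

Lemma limn_einf_le (u : nat -> \bar R) (c : \bar R) :
  (forall n, (u n <= c)%E) -> (limn_einf u <= c)%E.
Proof.
move=> uc; rewrite limn_einf_lim; apply: lime_le; first exact: is_cvg_einfs.
apply: nearW => n; apply: le_trans (uc n); apply: ereal_inf_lbound.
by exists n => //=.
Qed.

(** On a set of finite measure the increments of the sequence have summable L1
    norms, so the sequence converges almost everywhere, and Fatou's lemma turns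
    the pointwise limit into a limit in L2. *)
Lemma L2_complete D (phi : nat -> R -> R[i]) (C r : R) :
  measurable D -> (mu D < +oo)%E -> 0 <= C -> 0 < r < 1 ->
  (forall k, L2on D (phi k)) ->
  (forall k, nrm2 D (fun x => phi k.+1 x - phi k x) <= C * r ^+ k) ->
  exists psi, L2on D psi /\
    forall k, nrm2 D (fun x => psi x - phi k x) <= C / (1 - r) * r ^+ k.
Proof.
move=> mD Doo C0 /andP[r0 r1] lphi hphi.
have rgt : 0 < 1 - r by rewrite subr_gt0.
have [r0' rgt'] := (ltW r0, ltW rgt).
have tail k j : nrm2 D (fun x => phi (k + j)%N x - phi k x) <= C / (1 - r) * r ^+ k.
  have H : nrm2 D (fun x => phi (k + j)%N x - phi k x) <=
      C / (1 - r) * r ^+ k * (1 - r ^+ j).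
    elim: j => [|j IH].
      rewrite addn0 expr0 subrr mulr0 /nrm2 (_ : sq2 _ _ = 0) ?sqrtr0//.
      rewrite (@sq2_eq _ _ _ (fun=> 0)); last by move=> x _; rewrite subrr.
      rewrite /sq2 (@eq_Rintegral _ _ _ _ _ (fun=> 0)) ?Rintegral_cst ?mul0r//.
      by move=> x _; rewrite cabs0 expr0n.
    have -> : nrm2 D (fun x => phi (k + j.+1)%N x - phi k x) =
       nrm2 D (fun x => (phi (k + j).+1 x - phi (k + j)%N x) +
                        (phi (k + j)%N x - phi k x)).
      congr Num.sqrt; apply: sq2_eq => x _.
      by rewrite addrA subrK addnS.
    apply: (le_trans (nrm2D mD _ _)); try exact: L2onB.
    apply: (le_trans (lerD (hphi _) IH)); rewrite le_eqVlt; apply/orP; left.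
    by rewrite exprD exprSr; apply/eqP; field; rewrite gt_eqF.
  apply: (le_trans H); rewrite ler_piMr//.
    by rewrite !mulr_ge0 ?exprn_ge0 ?invr_ge0 ?r0' ?rgt'.
  by rewrite gerBl exprn_ge0 ?r0' ?rgt'.
pose w k x := cabs (phi k.+1 x - phi k x).
pose W x := (\sum_(0 <= k <oo) (w k x)%:E)%E.
have ldif k : L2on D (fun x => phi k.+1 x - phi k x) by exact: L2onB.
have mw k : measurable_fun D (fun x => (w k x)%:E).
  by apply/measurable_EFinP; have [? ? ?] := ldif k; exact: measurable_cabs.
have w0 k x : (0 <= (w k x)%:E)%E by rewrite lee_fin cabs_ge0.
have mW : measurable_fun D W by exact: ge0_emeasurable_sum.
have W0 x : (0 <= W x)%E by exact: nneseries_ge0.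
have iW : mu.-integrable D W.
  apply/integrableP; split => //.
  under eq_integral do rewrite (gee0_abs (W0 _)).
  rewrite /W integral_nneseries//.
  pose M := fine (mu D) + C ^+ 2.
  apply: (@le_lt_trans _ _ (\sum_(0 <= k <oo) (M * r ^+ k)%:E)%E).
    apply: lee_nneseries => k _ /=; first by move=> _; exact: integral_ge0.
    apply: (le_trans (L1_le_sq2 mD Doo (ldif k) (exprn_gt0 k r0))).
    rewrite lee_fin mulrDl [fine _ * _]mulrC lerD2l.
    rewrite mulrC ler_pdivrMr ?exprn_gt0//.
    rewrite -nrm2K (_ : C ^+ 2 * r ^+ k * r ^+ k = (C * r ^+ k) ^+ 2); last first.
      by rewrite exprMn expr2 [(r ^+ k) ^+ 2]expr2 !mulrA.
    by rewrite lerXn2r ?nnegrE ?nrm2_ge0 ?mulr_ge0 ?exprn_ge0 ?r0' ?rgt'.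
  apply: (@le_lt_trans _ _ (M / (1 - r))%:E); last exact: ltry.
  apply: lime_le.
    apply: is_cvg_nneseries => k _ _; rewrite lee_fin mulr_ge0 ?exprn_ge0 ?r0' ?rgt'//.
    by rewrite addr_ge0 ?sqr_ge0// fine_ge0.
  apply: nearW => n; rewrite sumEFin lee_fin.
  have r1' : `|r| < 1 by rewrite gtr0_norm.
  have M0 : 0 <= M by rewrite addr_ge0 ?sqr_ge0// fine_ge0.
  exact: (geometric_le_lim n M0 r0 r1').
have aeW := integrable_ae mD iW.
pose G := D `&` [set x | W x \is a fin_num].
have mG : measurable G by exact: emeasurable_fin_num.
(* the sequence is cut to zero where it might diverge *)
pose chi k x := (\1_G x)%:C * phi k x.
have mchi1 k : measurable_fun D (@complex.Re R \o chi k).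
  rewrite (_ : _ \o _ = fun x => \1_G x * (@complex.Re R \o phi k) x).
    apply: measurable_funM; last by case: (lphi k).
    by apply: measurable_funTS; exact: measurable_indic.
  by apply/funext => x /=; rewrite ReM /= mul0r subr0.
have mchi2 k : measurable_fun D (@complex.Im R \o chi k).
  rewrite (_ : _ \o _ = fun x => \1_G x * (@complex.Im R \o phi k) x).
    apply: measurable_funM; last by case: (lphi k).
    by apply: measurable_funTS; exact: measurable_indic.
  by apply/funext => x /=; rewrite ImM /= mul0r addr0.
have cvg_real (p : R[i] -> R) x : {morph p : a b / a - b} ->
    (forall z, `|p z| <= cabs z) -> (p 0 = 0) -> D x ->
    cvgn (fun k => p (chi k x)).
  move=> pB ple p0 Dx; have [Gx|Gx] := pselect (G x); last first.
    rewrite (_ : (fun k => _) = cst 0); first exact: is_cvg_cst.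
    apply/funext => k; rewrite /chi indicE memNset// mul0r.
    exact: p0.
  have -> : (fun k => p (chi k x)) = (fun k => p (phi k x)).
    by apply/funext => k; rewrite /chi indicE mem_set// mul1r.
  have [_ Wx] := Gx.
  rewrite (_ : (fun k => _) = (fun n => p (phi 0%N x) +
      series (telescope (fun k => p (phi k x))) n)); last first.
    by apply/funext => n; rewrite -eq_sum_telescope.
  apply: is_cvgD; first exact: is_cvg_cst.
  apply: normed_cvg.
  apply: nondecreasing_is_cvgn.
    by apply/nondecreasing_seqP => n; rewrite /= !seriesEnat /= big_nat_recr//= lerDl.
  exists (fine (W x)) => _ [n _ <-] /=.
  rewrite -lee_fin fineK// seriesEnat/= -sumEFin.
  apply: (@le_trans _ _ (\sum_(0 <= i < n) (w i x)%:E)%E); last first.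
    by apply: nneseries_lim_ge => k _ _.
  by apply: lee_sum => k _; rewrite lee_fin /= /telescope /= -pB; exact: ple.
have cvgRe x : D x -> cvgn (fun k => complex.Re (chi k x)).
  apply: (@cvg_real (@complex.Re R)) => //; first by move=> a b; rewrite !ReImE.
  exact: Re_le_cabs.
have cvgIm x : D x -> cvgn (fun k => complex.Im (chi k x)).
  apply: (@cvg_real (@complex.Im R)) => //; first by move=> a b; rewrite !ReImE.
  exact: Im_le_cabs.
pose psi x := limn (fun k => complex.Re (chi k x)) +i*
              limn (fun k => complex.Im (chi k x)).
have mpsi1 : measurable_fun D (@complex.Re R \o psi).
  by apply: (measurable_fun_cvg mchi1) => x Dx; exact: cvgRe.
have mpsi2 : measurable_fun D (@complex.Im R \o psi).
  by apply: (measurable_fun_cvg mchi2) => x Dx; exact: cvgIm.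
pose bd k := C / (1 - r) * r ^+ k.
have bd0 k : 0 <= bd k by rewrite !mulr_ge0 ?exprn_ge0 ?invr_ge0 ?r0' ?rgt'.
have mphi k : measurable_fun D (@complex.Re R \o phi k) /\
    measurable_fun D (@complex.Im R \o phi k) by case: (lphi k).
have mdif k : measurable_fun D (fun x => (cabs (psi x - phi k x) ^+ 2)%:E).
  by have [? ?] := mphi k; exact: measurable_cabs_sqB.
have mdchi k : measurable_fun D (fun x => (cabs (psi x - chi k x) ^+ 2)%:E).
  exact: measurable_cabs_sqB.
have mjk j k : measurable_fun D (fun x => (cabs (chi j x - chi k x) ^+ 2)%:E).
  exact: measurable_cabs_sqB.
have main k : (\int[mu]_(x in D) (cabs (psi x - phi k x) ^+ 2)%:E <= (bd k ^+ 2)%:E)%E.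
  rewrite (@ge0_ae_eq_integral _ _ _ mu D _
      (fun x => (cabs (psi x - chi k x) ^+ 2)%:E))//; last 3 first.
  - by move=> x _; rewrite lee_fin sqr_ge0.
  - by move=> x _; rewrite lee_fin sqr_ge0.
  - apply: filterS aeW => x Wx Dx; rewrite /chi indicE mem_set ?mul1r//.
    by split=> //; exact: Wx.
  rewrite (eq_integral (fun x => limn_einf
      (fun j => (cabs (chi (k + j)%N x - chi k x) ^+ 2)%:E))); last first.
    move=> x; rewrite inE => Dx; symmetry.
    apply: (cvg_limn_einf_sup _).1.
    apply/cvg_EFin; first exact: nearW.
    rewrite cabs_sq; have -> : fine \o (fun j : nat =>
        (cabs (chi (k + j)%N x - chi k x) ^+ 2)%:E) =
        (fun j => (complex.Re (chi (k + j)%N x) - complex.Re (chi k x)) ^+ 2 +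
                  (complex.Im (chi (k + j)%N x) - complex.Im (chi k x)) ^+ 2).
      by apply/funext => j /=; rewrite cabs_sq !ReImE.
    rewrite !ReImE; apply: cvgD.
      apply: (@cvg_comp _ _ _ _ (fun y : R => y ^+ 2)); last exact: exprn_continuous.
      apply: cvgB; last exact: cvg_cst.
      by apply: (cvg_comp (addn k) (fun j => complex.Re (chi j x)));
        [exact: cvg_addnl|exact: cvgRe].
    apply: (@cvg_comp _ _ _ _ (fun y : R => y ^+ 2)); last exact: exprn_continuous.
    apply: cvgB; last exact: cvg_cst.
    by apply: (cvg_comp (addn k) (fun j => complex.Im (chi j x)));
      [exact: cvg_addnl|exact: cvgIm].
  apply: (le_trans (fatou mu mD _ _)).
  - by move=> j; exact: mjk.
  - by move=> j x _; rewrite lee_fin sqr_ge0.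
  apply: limn_einf_le => j.
  apply: (@le_trans _ _ (\int[mu]_(x in D) (cabs (phi (k + j)%N x - phi k x) ^+ 2)%:E)%E).
    apply: ge0_le_integral => //.
    - by move=> x _; rewrite lee_fin sqr_ge0.
    - have [m1 m2 _] := L2onB mD (lphi (k + j)%N) (lphi k).
      by apply/measurable_EFinP; exact: measurable_cabs_sq.
    - move=> x _; rewrite lee_fin /chi -mulrBr cabsM cabsC exprMn.
      by rewrite indicE; case: (_ \in _); rewrite ?normr1 ?expr1n ?mul1r// normr0 expr0n mul0r sqr_ge0.
  rewrite sq2_ereal//; last exact: L2onB.
  by rewrite lee_fin -nrm2K lerXn2r ?nnegrE ?nrm2_ge0//; exact: tail.
exists psi; split; last first.
  by move=> k; apply: nrm2_le; [exact: bd0|exact: sq2_le_integral].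
have lp0 : L2on D (fun x => psi x - phi 0%N x).
  have [m1 m2] := mphi 0%N; have [d1 d2] := measurable_ReImB mpsi1 mpsi2 m1 m2.
  by apply: L2on_of_finite => //; rewrite (le_lt_trans (main 0%N))// ltry.
by apply: (L2on_eq mD _ (L2onD mD lp0 (lphi 0%N))) => x _; rewrite subrK.
Qed.

End L2norm.

#[global] Arguments nrm2 : simpl never.

(** * The Basel sum *)

Section elementary_trigo.
Context {R : realType}.
Implicit Types (t x y : R).

Lemma is_derive_ndecr (f f' : R -> R) (a b : R) :
  (forall x, is_derive x 1 f (f' x)) ->
  (forall x, a < x < b -> 0 <= f' x) ->
  forall x y, a <= x -> x <= y -> y <= b -> f x <= f y.
Proof.
move=> df f'0; apply: ger0_derive1_ndecr.
- by move=> x _; have [] := df x.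
- move=> x; rewrite in_itv /= => xab; rewrite derive1E.
  by rewrite (@derive_val _ _ _ _ _ _ _ (df x)) f'0.
- apply: continuous_subspaceT => x; apply: differentiable_continuous.
  by apply/derivable1_diffP; have [] := df x.
Qed.

Lemma sin_le_id t : 0 <= t -> sin t <= t.
Proof.
move=> t0; pose f (x : R) := x - sin x.
have df x : is_derive x 1 f (1 - cos x) by rewrite /f; apply: is_deriveB.
have := is_derive_ndecr df _ (lexx 0) t0 (lexx t).
rewrite /f sin0 subrr subr_ge0; apply => x _.
by rewrite subr_ge0 cos_le1.
Qed.

Lemma mul_cos_le_sin t : 0 <= t <= pi -> t * cos t <= sin t.
Proof.
move=> /andP[t0 tpi]; pose f (x : R) := sin x - x * cos x.
have df x : is_derive x 1 f (x * sin x).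
  rewrite /f; apply: is_derive_eq; rewrite /GRing.scale /=.
  by ring.
have := is_derive_ndecr df _ (lexx 0) t0 (lexx t).
rewrite /f sin0 mul0r subr0 subr_ge0; apply => x /andP[x0 xt].
by rewrite mulr_ge0 ?(ltW x0)// sin_ge0_pi// (ltW x0) (le_trans (ltW xt)).
Qed.

Lemma abs_sin_le t : `|sin t| <= `|t|.
Proof.
wlog t0 : t / 0 <= t.
  move=> H; have [/H//|/ltW t0] := leP 0 t.
  by rewrite -normrN -sinN -(normrN t) H// oppr_ge0.
rewrite (ger0_norm t0); have [t1|t1] := leP t 1.
  rewrite ger0_norm ?sin_le_id// sin_ge0_pi// t0 (le_trans t1)//.
  by rewrite (le_trans _ (pi_ge2 _))// ler1n.
by rewrite ltW// (le_lt_trans _ t1)// ler_norml sin_geN1 sin_le1.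
Qed.

Lemma cabs_expiB (s t : R) : cabs (expi s - expi t) <= `|s - t|.
Proof.
have -> : expi s - expi t = expi t * (expi (s - t) - 1).
  by rewrite mulrBr mulr1 -expiD [t + _]addrC subrK.
rewrite cabsM cabs_expi mul1r; move: (s - t) => {s t} a.
rewrite -(@ler_pXn2r _ 2)// ?nnegrE ?cabs_ge0// cabs_sq /expi /=.
rewrite oppr0 addr0 real_normK ?num_real//.
have -> : (cos a - 1) ^+ 2 + sin a ^+ 2 = 4 * sin (a / 2) ^+ 2.
  have e : a = a / 2 *+ 2 by rewrite mulr2n -splitr.
  rewrite {1 2}e cos_mulr2n sin_mulr2n.
  have := cos2Dsin2 (a / 2); set c := cos _; set s := sin _ => h.
  have c2 : c ^+ 2 = 1 - s ^+ 2 by lra.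
  rewrite c2 !mulr2n (_ : (c * s + c * s) ^+ 2 = 4 * c ^+ 2 * s ^+ 2); last by ring.
  by rewrite c2; ring.
have : `|sin (a / 2)| ^+ 2 <= `|a / 2| ^+ 2.
  by rewrite ler_pXn2r ?nnegrE// abs_sin_le.
by rewrite !real_normK ?num_real//; nra.
Qed.

End elementary_trigo.

Section basel.
Context {R : realType}.

Definition basel_sum (n : nat) : R := \sum_(0 <= k < n) (k.+1%:R ^+ 2)^-1.

Let odd_sum (n : nat) : R := \sum_(0 <= k < n) ((k.*2.+1)%:R ^+ 2)^-1.

Let angle (n k : nat) : R := (k.*2.+1)%:R * pi / 2 ^+ n.+2.

Let angle_bounds n k : (k < 2 ^ n)%N -> 0 < angle n k < pi / 2.
Proof.
move=> kn; rewrite /angle; apply/andP; split.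
  by rewrite divr_gt0 ?exprn_gt0// mulr_gt0 ?pi_gt0 ?ltr0n.
rewrite ltr_pdivrMr ?exprn_gt0//.
have -> : pi / 2 * 2 ^+ n.+2 = (2 ^ n.+1)%:R * pi :> R.
  by rewrite natrX !exprS; field.
rewrite ltr_pM2r ?pi_gt0// ltr_nat expnS; lia.
Qed.

(** Halving an angle: 1/sin^2 x = (1/sin^2 (x/2) + 1/cos^2 (x/2)) / 4, where
    the cosine is the sine of another angle of the next generation. *)
Let csc_sum n : \sum_(0 <= k < 2 ^ n) (sin (angle n k) ^+ 2)^-1 = 2 * 4 ^+ n.
Proof.
elim: n => [|n IH].
  rewrite expn0 big_nat1 /angle expr0 mulr1 mul1r.
  have -> : pi / 2 ^+ 2 = pi / 4 :> R by rewrite expr2; congr (_ / _); ring.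
  have e := cos2Dsin2 (pi / 4 : R).
  have -> : sin (pi / 4) ^+ 2 = 2^-1 :> R; last by rewrite invrK.
  have : sin (pi / 4 : R) = cos (pi / 4).
    rewrite -sinDpihalf -[in LHS](opprK (pi / 4)) sinN -sinDpi.
    by congr sin; field.
  by move=> se; move: e; rewrite -se; lra.
rewrite (@big_cat_nat _ _ _ (2 ^ n))//=; last by rewrite leq_exp2l.
rewrite [X in _ + X](_ : _ =
    \sum_(0 <= k < 2 ^ n) (sin (pi / 2 - angle n.+1 k) ^+ 2)^-1).
  rewrite -big_split /= exprS mulrCA -IH mulr_sumr.
  apply: eq_big_nat => k /andP[_ kn].
  have -> : angle n k = angle n.+1 k *+ 2.
    by rewrite /angle [in RHS]exprS mulr2n; field.
  set x := angle n.+1 k.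
  have kn1 : (k < 2 ^ n.+1)%N by rewrite (leq_trans kn)// leq_exp2l.
  have x0 := angle_bounds kn1.
  rewrite sin_mulr2n [pi / 2 - _]addrC.
  have s0 : sin x != 0 by rewrite gt_eqF// sin_gt0_pihalf.
  have c0 : cos x != 0.
    rewrite gt_eqF// cos_gt0_pihalf//; case/andP: x0 => a b; rewrite b andbT.
    by rewrite (lt_trans _ a)// oppr_lt0 divr_gt0 ?pi_gt0.
  have e := cos2Dsin2 x.
  have -> : (cos x * sin x *+ 2) ^+ 2 = 4 * cos x ^+ 2 * sin x ^+ 2.
    by rewrite mulr2n; ring.
  rewrite sinDpihalf cosN -[RHS]mulr1 -[X in _ = _ * X]e; field.
  by rewrite s0 c0.
rewrite -[X in \sum_(X <= _ < _) _]add0n big_addn.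
have -> : (2 ^ n.+1 - 2 ^ n)%N = (2 ^ n)%N by rewrite expnS; lia.
rewrite [RHS]big_nat_rev /=; apply: eq_big_nat => k /andP[_ kn].
congr ((sin _ ^+ 2)^-1); rewrite /angle.
have -> : ((k + 2 ^ n).*2.+1)%:R = (2 ^ n.+2)%:R - ((0 + 2 ^ n - k.+1).*2.+1)%:R :> R.
  by apply/eqP; rewrite eq_sym subr_eq -natrD eqr_nat; apply/eqP; rewrite !expnS; lia.
by rewrite natrX !exprS; field; rewrite expf_neq0.
Qed.

Let pi_sq_csc_sum n : pi ^+ 2 / 8 = \sum_(0 <= k < 2 ^ n)
  pi ^+ 2 / 2 ^+ n.+2 ^+ 2 * (sin (angle n k) ^+ 2)^-1.
Proof.
rewrite -mulr_sumr csc_sum (_ : 4 = 2 ^+ 2 :> R); last by ring.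
by rewrite -exprM mulnC exprM !(exprS _ n.+1) !exprS; field; rewrite expf_neq0.
Qed.

Let inv_odd_sq n k : ((k.*2.+1)%:R ^+ 2)^-1 =
  pi ^+ 2 / 2 ^+ n.+2 ^+ 2 * (angle n k ^+ 2)^-1 :> R.
Proof.
have p0 := pi_gt0 R; rewrite /angle; move: (pi : R) p0 => p p0.
have k0 : (k.*2.+1)%:R != 0 :> R by rewrite pnatr_eq0.
move: ((k.*2.+1)%:R : R) k0 => m m0.
by field; rewrite expf_neq0// m0 (gt_eqF p0).
Qed.

(** Both bounds compare x with the sine: csc^2 x - 1 <= 1 / x^2 <= csc^2 x for
    0 < x < pi/2. *)
Lemma odd_sum_le n : odd_sum (2 ^ n) <= pi ^+ 2 / 8.
Proof.
have p0 := pi_gt0 R.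
rewrite (pi_sq_csc_sum n).
rewrite /odd_sum big_nat [leRHS]big_nat; apply: ler_sum => k /andP[_ kn].
have /andP[a0 a1] := angle_bounds kn.
have s0 : 0 < sin (angle n k) by rewrite sin_gt0_pihalf ?a0.
rewrite (inv_odd_sq n).
rewrite ler_pM2l ?divr_gt0 ?exprn_gt0//.
rewrite lef_pV2 ?posrE ?exprn_gt0// lerXn2r ?nnegrE ?(ltW s0) ?(ltW a0)//.
by rewrite sin_le_id ?(ltW a0).
Qed.

Lemma odd_sum_ge n : pi ^+ 2 / 8 - pi ^+ 2 / 2 ^+ n <= odd_sum (2 ^ n).
Proof.
have p0 := pi_gt0 R.
rewrite (pi_sq_csc_sum n).
apply: (@le_trans _ _ (\sum_(0 <= k < 2 ^ n)
    (pi ^+ 2 / 2 ^+ n.+2 ^+ 2 * (sin (angle n k) ^+ 2)^-1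
     - pi ^+ 2 / 2 ^+ n.+2 ^+ 2))).
  rewrite sumrB lerB// big_const_nat subn0 iter_addr_0 -[_ *+ (2 ^ n)%N]mulr_natr natrX.
  have -> : pi ^+ 2 / 2 ^+ n.+2 ^+ 2 * 2 ^+ n = pi ^+ 2 / 2 ^+ n / 16 :> R.
    move: (pi : R) => p; rewrite !(exprS _ n.+1) !(exprS _ n).
    by field; rewrite expf_neq0.
  by rewrite ler_pdivrMr// ler_peMr ?divr_ge0 ?sqr_ge0 ?exprn_ge0// ler1n.
rewrite /odd_sum big_nat [leRHS]big_nat; apply: ler_sum => k /andP[_ kn].
have /andP[a0 a1] := angle_bounds kn.
have s0 : 0 < sin (angle n k) by rewrite sin_gt0_pihalf ?a0.
rewrite (inv_odd_sq n).
rewrite -[X in _ - X]mulr1 -mulrBr ler_pM2l ?divr_gt0 ?exprn_gt0//.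
set x := angle n k in a0 a1 s0 *.
have c0 : 0 <= cos x.
  by rewrite cos_ge0_pihalf// (ltW a1) andbT (le_trans _ (ltW a0))// oppr_le0 divr_ge0 ?pi_ge0.
have h : x * cos x <= sin x.
  by apply: mul_cos_le_sin; rewrite (ltW a0) (le_trans (ltW a1))// ler_pdivrMr// ler_peMr ?ler1n// ltW.
have e := cos2Dsin2 x.
rewrite -[X in _ - X](@divff _ (sin x ^+ 2)) ?gt_eqF ?exprn_gt0//.
rewrite -[X in X - _]mul1r -mulrBl -[X in X - _]e addrK.
have s2 : 0 < sin x ^+ 2 by rewrite exprn_gt0.
have x2 : 0 < x ^+ 2 by rewrite exprn_gt0.
rewrite (ler_pdivrMr _ _ s2) [_ * sin x ^+ 2]mulrC (ler_pdivlMr _ _ x2).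
rewrite -exprMn; apply: lerXn2r; rewrite ?nnegrE ?(ltW s0)//.
  by rewrite mulr_ge0// (ltW a0).
by rewrite mulrC.
Qed.

(** The terms with an even denominator are a quarter of the whole sum. *)
Lemma basel_split n : basel_sum n.*2 = odd_sum n + basel_sum n / 4.
Proof.
rewrite /basel_sum /odd_sum; elim: n => [|n IH].
  by rewrite !big_geq// mul0r addr0.
rewrite doubleS !big_nat_recr//= IH !mulrDl -!addrA; congr (_ + _).
rewrite addrCA; congr (_ + (_ + _)).
rewrite (_ : (n.*2.+2)%:R = n.+1%:R * 2 :> R); last by rewrite -natrM muln2 doubleS.
by rewrite exprMn invfM; congr (_ * _); rewrite expr2; congr (_^-1); ring.
Qed.

Lemma basel_sum_ndecr : nondecreasing_seq basel_sum.
Proof.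
apply/nondecreasing_seqP => n; rewrite /basel_sum big_nat_recr//= lerDl.
by rewrite invr_ge0 sqr_ge0.
Qed.

Lemma odd_sum_ndecr : nondecreasing_seq odd_sum.
Proof.
apply/nondecreasing_seqP => n; rewrite /odd_sum big_nat_recr//= lerDl.
by rewrite invr_ge0 sqr_ge0.
Qed.

Lemma basel_sum_le n : basel_sum n <= pi ^+ 2 / 6.
Proof.
have h1 : odd_sum n <= pi ^+ 2 / 8.
  by apply: le_trans (odd_sum_le n); apply: odd_sum_ndecr; rewrite ltnW// ltn_expl.
have h2 : basel_sum n <= basel_sum n.*2 by apply: basel_sum_ndecr; rewrite -addnn leq_addr.
by rewrite basel_split in h2; lra.
Qed.

Lemma basel_cvg : basel_sum n @[n --> \oo] --> pi ^+ 2 / 6.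
Proof.
have cb : cvgn basel_sum.
  apply: nondecreasing_is_cvgn; first exact: basel_sum_ndecr.
  by exists (pi ^+ 2 / 6) => _ [n _ <-]; exact: basel_sum_le.
set l := limn basel_sum.
have c2 : basel_sum (2 ^ n.+1)%N @[n --> \oo] --> l.
  apply: (cvg_comp (fun n => 2 ^ n.+1)%N basel_sum); last exact: cb.
  move=> P [N _ NP]; exists N => // n /= Nn; apply: NP => /=.
  by rewrite (leq_trans Nn)// ltnW// (leq_trans _ (ltn_expl _ _))// ltnW.
have c1 : basel_sum (2 ^ n)%N @[n --> \oo] --> l.
  by rewrite -(@cvg_shiftS _ (fun n => basel_sum (2 ^ n)%N)).
have co : odd_sum (2 ^ n)%N @[n --> \oo] --> l - l / 4.
  have -> : (fun n => odd_sum (2 ^ n)%N) =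
      (fun n => basel_sum (2 ^ n.+1)%N - basel_sum (2 ^ n)%N / 4).
    by apply/funext => n; rewrite expnS mul2n basel_split addrK.
  by apply: cvgB => //; apply: cvgMl.
have co' : odd_sum (2 ^ n)%N @[n --> \oo] --> (pi ^+ 2 / 8 : R).
  apply: (@squeeze_cvgr _ _ _ _ (fun n => pi ^+ 2 / 8 - pi ^+ 2 / 2 ^+ n)
     (fun=> pi ^+ 2 / 8)).
  - by apply: nearW => n; rewrite odd_sum_ge odd_sum_le.
  - rewrite -[X in _ --> X]subr0; apply: cvgB; first exact: cvg_cst.
    rewrite -[X in _ --> X](mulr0 (pi ^+ 2)); apply: cvgMr.
    under eq_fun do rewrite -exprVn.
    by apply: cvg_expr; rewrite ger0_norm ?invr_ge0// invf_lt1// ltr1n.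
  - exact: cvg_cst.
have := cvg_unique (@norm_hausdorff _ R^o) co co'.
move=> e; rewrite (_ : pi ^+ 2 / 6 = l); first exact: cb.
move: e; move: (l : R) (pi : R) => x p e.
have {}e : x - x / 4 = p ^+ 2 / 8 by exact: e.
by lra.
Qed.

End basel.

(** * Orthogonal systems in L2 *)

Section orthogonal_system.
Context {R : realType}.
Local Notation mu := (@lebesgue_measure R).
Variables (D : set (measurableTypeR R)) (e : int -> R -> R[i]) (T : R).
Hypotheses (mD : measurable D) (Doo : (mu D < +oo)%E) (T0 : 0 < T).
Hypothesis le2 : forall k, L2on D (e k).
Hypothesis e_orth : forall k l, ip D (e k) (e l) = (if k == l then T else 0)%:C.
Implicit Types (f : R -> R[i]) (b : int -> R[i]) (s : seq int).

Definition span s b : R -> R[i] := fun t => \sum_(k <- s) b k * e k t.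

Definition sumsq s b : R := \sum_(k <- s) cabs (b k) ^+ 2.

Lemma sumsq_ge0 s b : 0 <= sumsq s b.
Proof. by apply: sumr_ge0 => k _; rewrite sqr_ge0. Qed.

Lemma L2on_span s b : L2on D (span s b).
Proof. by apply: L2on_sum => // k _; apply: L2onZ. Qed.

Lemma ip_span s b f : L2on D f ->
  ip D f (span s b) = \sum_(k <- s) conjc (b k) * ip D f (e k).
Proof.
move=> lf; rewrite (ipC mD (L2on_span s b) lf) ip_sumul//; last first.
  by move=> k _; exact: L2onZ.
rewrite rmorph_sum; apply: eq_bigr => k _.
by rewrite ipZl// rmorphM (ipC mD (le2 k) lf).
Qed.

Lemma ip_span_e s b l : uniq s ->
  ip D (span s b) (e l) = if l \in s then T%:C * b l else 0.
Proof.
move=> us; rewrite ip_sumul//; last by move=> k _; exact: L2onZ.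
under eq_bigr => k _ do rewrite ipZl// e_orth.
case: ifPn => ls.
  rewrite (bigD1_seq l)//= eqxx big1 ?addr0 1?mulrC// => k /negbTE ->.
  by rewrite mulr0.
rewrite big_seq big1// => k ks; case: eqP => [kl|]; last by rewrite mulr0.
by rewrite -kl ks in ls.
Qed.

Lemma sq2_span s b : uniq s -> sq2 D (span s b) = T * sumsq s b.
Proof.
move=> us; apply: (@complexI R); rewrite -sq2E ip_span; last exact: L2on_span.
rewrite big_seq; under eq_bigr => k ks.
  rewrite ip_span_e// ks mulrCA [conjc _ * _]mulrC mulcJ; over.
rewrite -big_seq -mulr_sumr rmorphM /=; congr (_ * _).
by rewrite /sumsq -[RHS]/(real_complex R _) rmorph_sum.
Qed.

Definition coef f (k : int) : R[i] := T^-1%:C * ip D f (e k).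

Lemma sumsq_coef s f :
  sumsq s (coef f) = T ^- 2 * \sum_(k <- s) cabs (ip D f (e k)) ^+ 2.
Proof.
rewrite /sumsq mulr_sumr; apply: eq_bigr => k _.
by rewrite /coef cabsM cabsC exprMn ger0_norm ?invr_ge0 ?(ltW T0)// exprVn.
Qed.

Lemma sq2_sub_span s f : uniq s -> L2on D f ->
  sq2 D (fun t => f t - span s (coef f) t) =
    sq2 D f - T^-1 * \sum_(k <- s) cabs (ip D f (e k)) ^+ 2.
Proof.
move=> us lf; rewrite sq2B//; last exact: L2on_span.
rewrite sq2_span// ip_span//.
have -> : complex.Re (\sum_(k <- s) conjc (coef f k) * ip D f (e k)) =
    T^-1 * \sum_(k <- s) cabs (ip D f (e k)) ^+ 2.
  have E k : conjc (coef f k) * ip D f (e k) =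
      (T^-1 * cabs (ip D f (e k)) ^+ 2)%:C.
    rewrite /coef; move: (ip D f (e k)) => z.
    by apply: eqC; rewrite cabs_sq !ReImE /=; ring.
  under eq_bigr do rewrite E.
  by rewrite -(rmorph_sum (real_complex R)) -mulr_sumr.
by rewrite sumsq_coef; field; rewrite gt_eqF.
Qed.

(** Bessel's inequality: the distance to the span is nonnegative. *)
Lemma bessel s f : uniq s -> L2on D f ->
  \sum_(k <- s) cabs (ip D f (e k)) ^+ 2 <= T * sq2 D f.
Proof.
move=> us lf; have := sq2_ge0 D (fun t => f t - span s (coef f) t).
by rewrite sq2_sub_span// subr_ge0 mulrC ler_pdivrMr// mulrC.
Qed.

Lemma spanB s1 s2 b t : uniq s1 -> uniq s2 ->
  span s1 b t - span s2 b t =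
  span [seq k <- s1 | k \notin s2] b t - span [seq k <- s2 | k \notin s1] b t.
Proof.
move=> u1 u2; rewrite /span !big_filter.
rewrite [in LHS](bigID (mem s2)) [X in _ - X = _](bigID (mem s1)) /=.
have -> : \sum_(i <- s1 | i \in s2) b i * e i t =
    \sum_(i <- s2 | i \in s1) b i * e i t.
  rewrite -big_filter -[RHS]big_filter; apply: perm_big; apply: uniq_perm; rewrite ?filter_uniq//.
  by move=> k; rewrite !mem_filter andbC.
by rewrite opprD addrACA subrr add0r.
Qed.

(** The partial sums over finite sets that almost exhaust the square sum form a
    Cauchy sequence, because they differ by sums over sets disjoint from an
    almost exhausting one. *)
Lemma riesz_fischer b (M : R) : (forall s, uniq s -> sumsq s b <= M) ->
  exists psi, exists s_ : nat -> seq int,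
    [/\ L2on D psi, forall j, uniq (s_ j),
        forall k, ip D psi (e k) = T%:C * b k &
        forall j, nrm2 D (fun t => psi t - span (s_ j) b t) <=
          4 * Num.sqrt T * 2^-1 ^+ j].
Proof.
move=> bM; pose E := [set sumsq s b | s in [set s | uniq s]].
have supE : has_sup E.
  split; first by exists (sumsq [::] b), [::].
  by exists M => _ [s us <-]; exact: bM.
pose S := sup E.
have ex j : exists s, uniq s /\ S - (4^-1) ^+ j < sumsq s b.
  have j0 : 0 < (4^-1) ^+ j :> R by rewrite exprn_gt0.
  by have [_ [s us <-] h] := sup_adherent j0 supE; exists s.
pose s_ j := sval (cid (ex j)).
have us j : uniq (s_ j) by rewrite /s_; case: cid => x [].
have Ss j : S - (4^-1) ^+ j < sumsq (s_ j) b by rewrite /s_; case: cid => x [].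
have tail j s : uniq s -> (forall k, k \in s -> k \notin s_ j) ->
    sumsq s b <= (2^-1 ^+ j) ^+ 2.
  move=> u dis; have : sumsq (s_ j ++ s) b <= S.
    apply: ub_le_sup; first by case: supE.
    exists (s_ j ++ s) => //=; rewrite cat_uniq us u andbT/=.
    by apply/hasPn => k /dis.
  rewrite /sumsq big_cat /= -!/(sumsq _ b) => h; have := Ss j.
  have -> : (2^-1 ^+ j) ^+ 2 = (4^-1) ^+ j :> R.
    by rewrite -exprM mulnC exprM; congr (_ ^+ _); field.
  by lra.
have nspan j s : uniq s -> (forall k, k \in s -> k \notin s_ j) ->
    nrm2 D (span s b) <= Num.sqrt T * 2^-1 ^+ j.
  move=> u dis; apply: nrm2_le; first by rewrite mulr_ge0 ?sqrtr_ge0 ?exprn_ge0.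
  by rewrite exprMn sqr_sqrtr ?(ltW T0)// sq2_span// ler_pM2l// tail.
have [||||psi [lpsi hpsi]] := @L2_complete _ D (fun j => span (s_ j) b)
    (2 * Num.sqrt T) 2^-1 mD Doo.
- by rewrite mulr_ge0 ?sqrtr_ge0.
- by rewrite invr_gt0 ltr0n invf_lt1// ltr1n.
- by move=> k; exact: L2on_span.
- move=> j.
  have -> : nrm2 D (fun t => span (s_ j.+1) b t - span (s_ j) b t) =
      nrm2 D (fun t => span [seq k <- s_ j.+1 | k \notin s_ j] b t -
                       span [seq k <- s_ j | k \notin s_ j.+1] b t).
    by congr Num.sqrt; apply: sq2_eq => t _; rewrite spanB.
  apply: (le_trans (nrm2B mD (L2on_span _ _) (L2on_span _ _))).
  have h1 : nrm2 D (span [seq k <- s_ j.+1 | k \notin s_ j] b) <=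
      Num.sqrt T * 2^-1 ^+ j.
    by apply: nspan; rewrite ?filter_uniq// => k; rewrite mem_filter => /andP[].
  have h2 : nrm2 D (span [seq k <- s_ j | k \notin s_ j.+1] b) <=
      Num.sqrt T * 2^-1 ^+ j.+1.
    by apply: nspan; rewrite ?filter_uniq// => k; rewrite mem_filter => /andP[].
  apply: (le_trans (lerD h1 h2)); rewrite exprS.
  have : 0 <= Num.sqrt T * 2^-1 ^+ j by rewrite mulr_ge0 ?sqrtr_ge0 ?exprn_ge0.
  by rewrite mulrCA -!mulrA; lra.
have hC j : nrm2 D (fun t => psi t - span (s_ j) b t) <=
    4 * Num.sqrt T * 2^-1 ^+ j.
  apply: (le_trans (hpsi j)).
  by rewrite (_ : 2 * Num.sqrt T / (1 - 2^-1) = 4 * Num.sqrt T)//; field.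
exists psi, s_; split => // k.
have sT := sqr_sqrtr (ltW T0).
have nek : nrm2 D (e k) = Num.sqrt T.
  by rewrite /nrm2; congr Num.sqrt; apply: (@complexI R); rewrite -sq2E e_orth eqxx.
have H j : cabs (ip D psi (e k) - T%:C * b k) <= 5 * T * 2^-1 ^+ j.
  rewrite (_ : _ - _ = ip D (fun t => psi t - span (s_ j) b t) (e k) +
     (ip D (span (s_ j) b) (e k) - T%:C * b k)); last first.
    by rewrite ipBl//; [rewrite addrA subrK|exact: L2on_span].
  apply: (le_trans (cabsD _ _)).
  have h1 := CauchySchwarz_nrm2 mD (L2onB mD lpsi (L2on_span (s_ j) b)) (le2 k).
  have h2 : cabs (ip D (span (s_ j) b) (e k) - T%:C * b k) <= T * 2^-1 ^+ j.
    rewrite ip_span_e//; case: ifPn => ks.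
      by rewrite subrr cabs0 mulr_ge0 ?exprn_ge0 ?(ltW T0).
    rewrite sub0r cabsN cabsM cabsC (ger0_norm (ltW T0)) ler_pM2l//.
    rewrite -(@ler_pXn2r _ 2)// ?nnegrE ?cabs_ge0 ?exprn_ge0//.
    have := tail j [:: k] isT; rewrite /sumsq big_seq1; apply => l.
    by rewrite inE => /eqP ->.
  rewrite nek in h1; have h3 := ler_wpM2r (sqrtr_ge0 T) (hC j).
  rewrite (_ : 4 * Num.sqrt T * 2^-1 ^+ j * Num.sqrt T = 4 * T * 2^-1 ^+ j) in h3.
    by apply: (le_trans (lerD (le_trans h1 h3) h2)); rewrite -!mulrA; lra.
  by rewrite -[in RHS]sT; ring.
apply/eqP; rewrite -subr_eq0; apply/eqP/cabs_eq0/eqP.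
rewrite eq_le cabs_ge0 andbT leNgt; apply/negP => p.
have c : 5 * T * 2^-1 ^+ j @[j --> \oo] --> 0.
  rewrite -[X in _ --> X](mulr0 (5 * T)); apply: cvgMr.
  by apply: cvg_expr; rewrite ger0_norm ?invr_ge0// invf_lt1// ltr1n.
have /cvgrPdist_lt/(_ _ p)[N _ /(_ N (leqnn N))] := c.
rewrite sub0r normrN ger0_norm; last by rewrite !mulr_ge0 ?exprn_ge0 ?(ltW T0).
by rewrite ltNge H.
Qed.

(** The Riesz-Fischer sum of the coefficients of f has the same coefficients as f,
    so completeness identifies it with f. *)
Lemma parseval_span :
  (forall f, L2on D f -> (forall k, ip D f (e k) = 0) -> sq2 D f = 0) ->
  forall f, L2on D f -> exists s_ : nat -> seq int,
    (forall j, uniq (s_ j)) /\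
    forall j, nrm2 D (fun t => f t - span (s_ j) (coef f) t) <=
      4 * Num.sqrt T * 2^-1 ^+ j.
Proof.
move=> complete f lf.
have [s us|psi [s_ [lpsi us ippsi hpsi]]] := @riesz_fischer (coef f)
    (T^-1 * sq2 D f).
  rewrite sumsq_coef -exprVn expr2 -mulrA ler_pM2l ?invr_gt0//.
  by rewrite mulrC ler_pdivrMr// mulrC bessel.
exists s_; split => // j.
have d0 : nrm2 D (fun t => f t - psi t) = 0.
  rewrite /nrm2 complete ?sqrtr0//; first exact: L2onB.
  move=> k; rewrite ipBl// ippsi /coef mulrA -rmorphM /= divff ?gt_eqF//.
  by rewrite mul1r subrr.
have -> : nrm2 D (fun t => f t - span (s_ j) (coef f) t) =
    nrm2 D (fun t => (f t - psi t) + (psi t - span (s_ j) (coef f) t)).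
  by congr Num.sqrt; apply: sq2_eq => t _; rewrite addrA subrK.
have lsp := L2on_span (s_ j) (coef f).
apply: (le_trans (nrm2D mD (L2onB mD lf lpsi) (L2onB mD lpsi lsp))).
by rewrite d0 add0r.
Qed.

End orthogonal_system.

(** * Fourier series on a symmetric interval *)

Section fundamental_theorem.
Context {R : realType}.
Local Notation mu := (@lebesgue_measure R).

Lemma is_derive_continuous (f f' : R -> R) :
  (forall x : R, is_derive x 1 f (f' x)) -> continuous f.
Proof.
move=> df x; apply: differentiable_continuous.
by apply/derivable1_diffP; have [] := df x.
Qed.

Lemma Rintegral_FTC (G g : R -> R) (a b : R) : a <= b ->
  (forall x : R, is_derive x 1 G (g x)) -> continuous g ->
  \int[mu]_(x in `[a, b]) g x = G b - G a.
Proof.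
rewrite le_eqVlt => /predU1P[->|ab] dG cg.
  by rewrite set_itv1 Rintegral_set1 subrr.
have cG := is_derive_continuous dG.
rewrite /Rintegral (@continuous_FTC2 _ g G)//.
- exact: continuous_subspaceT.
- split.
  + by move=> x _; have [] := dG x.
  + by apply: cvg_at_right_filter; exact: cG.
  + by apply: cvg_at_left_filter; exact: cG.
- move=> x _; rewrite derive1E.
  by rewrite (@derive_val _ _ _ _ _ _ _ (dG x)).
Qed.

Lemma mu_itv_lty (a b : R) : (mu `[a, b]%classic < +oo)%E.
Proof. by rewrite lebesgue_measure_itv/=; case: ifPn => _; rewrite ltry. Qed.

Lemma L2on_bounded (D : set (measurableTypeR R)) (f : R -> R[i]) (M : R) :
  measurable D -> (mu D < +oo)%E ->
  measurable_fun D (@complex.Re R \o f) ->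
  measurable_fun D (@complex.Im R \o f) ->
  (forall x, D x -> cabs (f x) <= M) -> L2on D f.
Proof.
move=> mD Doo m1 m2 fM; apply: L2on_of_finite => //.
apply: (@le_lt_trans _ _ (\int[mu]_(x in D) (M ^+ 2)%:E)%E); last first.
  by rewrite integral_cst// -ge0_fin_numE ?mule_ge0 ?lee_fin ?sqr_ge0// fin_numM// ge0_fin_numE.
apply: ge0_le_integral => //.
- by move=> x _; rewrite lee_fin sqr_ge0.
- by apply/measurable_EFinP; exact: measurable_cabs_sq.
- move=> x Dx; rewrite lee_fin lerXn2r ?nnegrE ?cabs_ge0 ?fM//.
  exact: le_trans (cabs_ge0 _) (fM _ Dx).
Qed.

Lemma L2on_mul_bounded (D : set (measurableTypeR R)) (f g : R -> R[i]) (M : R) :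
  measurable D -> L2on D f ->
  measurable_fun D (@complex.Re R \o g) ->
  measurable_fun D (@complex.Im R \o g) ->
  (forall x, D x -> cabs (g x) <= M) -> L2on D (fun x => f x * g x).
Proof.
move=> mD [f1 f2 f3] g1 g2 gM; split.
- rewrite (_ : _ \o _ = fun x => (@complex.Re R \o f) x * (@complex.Re R \o g) x -
      (@complex.Im R \o f) x * (@complex.Im R \o g) x).
    by apply: measurable_funB; exact: measurable_funM.
  by apply/funext => x /=; rewrite ReM.
- rewrite (_ : _ \o _ = fun x => (@complex.Re R \o f) x * (@complex.Im R \o g) x +
      (@complex.Im R \o f) x * (@complex.Re R \o g) x).
    by apply: measurable_funD; exact: measurable_funM.
  by apply/funext => x /=; rewrite ImM.
- have i := integrableZl mD (M ^+ 2) f3.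
  apply: (le_integrable mD _ _ i).
    apply/measurable_EFinP; rewrite (_ : (fun _ => _) =
        fun x => cabs (f x) ^+ 2 * cabs (g x) ^+ 2).
      by apply: measurable_funM; exact: measurable_cabs_sq.
    by apply/funext => x; rewrite cabsM exprMn.
  move=> x Dx; rewrite [leLHS]/= -EFinM [leRHS]/= lee_fin.
  rewrite (ger0_norm (sqr_ge0 _)) (ger0_norm (mulr_ge0 (sqr_ge0 _) (sqr_ge0 _))).
  rewrite cabsM exprMn mulrC; apply: (ler_wpM2r (sqr_ge0 _)).
  have M0 := le_trans (cabs_ge0 _) (gM _ Dx).
  by rewrite lerXn2r ?nnegrE ?cabs_ge0 ?gM.
Qed.

End fundamental_theorem.

Section wave.
Context {R : realType}.
Local Notation mu := (@lebesgue_measure R).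

Definition wave (y t : R) : R[i] := expi (2 * pi * t * y).

Definition symitv (A : R) : set (measurableTypeR R) := `[- A, A]%classic.

Lemma measurable_symitv A : measurable (symitv A).
Proof. exact: measurable_itv. Qed.

#[local] Hint Resolve measurable_symitv : core.

Lemma symitv_lty A : (mu (symitv A) < +oo)%E.
Proof. exact: mu_itv_lty. Qed.

Lemma mu_symitv A : 0 <= A -> fine (mu (symitv A)) = 2 * A.
Proof.
move=> A0; rewrite /symitv lebesgue_measure_itv/= lte_fin.
have [_|h] := ltP (- A) A; first by rewrite -EFinB/= opprK mulr_natl mulr2n.
by rewrite (_ : A = 0) ?mulr0//; apply/eqP; rewrite eq_le A0 andbT; lra.
Qed.

Lemma waveD (x y t : R) : wave (x + y) t = wave x t * wave y t.
Proof. by rewrite /wave mulrDr expiD. Qed.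

Lemma waveN (y t : R) : wave (- y) t = conjc (wave y t).
Proof. by rewrite /wave mulrN expiN. Qed.

Lemma cabs_wave (y t : R) : cabs (wave y t) = 1.
Proof. exact: cabs_expi. Qed.

Lemma is_derive_cosM (w x : R) :
  is_derive x 1 (fun t => cos (w * t)) (- (w * sin (w * x))).
Proof.
apply: is_derive_eq; rewrite /GRing.scale /=; ring.
Qed.

Lemma is_derive_sinM (w x : R) :
  is_derive x 1 (fun t => sin (w * t)) (w * cos (w * x)).
Proof.
apply: is_derive_eq; rewrite /GRing.scale /=; ring.
Qed.

Lemma continuous_cosM (w : R) : continuous (fun t : R => cos (w * t)).
Proof. exact: is_derive_continuous (is_derive_cosM w). Qed.

Lemma continuous_sinM (w : R) : continuous (fun t => sin (w * t)).
Proof. exact: is_derive_continuous (is_derive_sinM w). Qed.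

Lemma measurable_wave (D : set (measurableTypeR R)) y :
  measurable_fun D (@complex.Re R \o wave y) /\
  measurable_fun D (@complex.Im R \o wave y).
Proof.
split; apply: measurable_funTS.
- rewrite (_ : _ \o _ = fun t => cos (2 * pi * y * t)).
    by apply: continuous_measurable_fun; exact: continuous_cosM.
  by apply/funext => t /=; rewrite mulrAC.
- rewrite (_ : _ \o _ = fun t => sin (2 * pi * y * t)).
    by apply: continuous_measurable_fun; exact: continuous_sinM.
  by apply/funext => t /=; rewrite mulrAC.
Qed.

Lemma L2on_wave A y : L2on (symitv A) (wave y).
Proof.
have [m1 m2] := measurable_wave (symitv A) y.
apply: (@L2on_bounded _ _ _ 1 (measurable_symitv A) (symitv_lty A) m1 m2).
by move=> x _; rewrite cabs_wave.
Qed.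

Lemma L2on_mul_wave A f y : L2on (symitv A) f ->
  L2on (symitv A) (fun t => f t * wave y t).
Proof.
move=> lf; have [m1 m2] := measurable_wave (symitv A) y.
apply: (L2on_mul_bounded (measurable_symitv A) lf m1 m2).
by move=> x _; rewrite cabs_wave.
Qed.

Lemma cintegral_wave A y : 0 <= A ->
  cintegral (symitv A) (wave y) =
  (if y == 0 then 2 * A else sin (2 * pi * A * y) / (pi * y))%:C.
Proof.
move=> A0; have NA : - A <= A by rewrite lerNl (le_trans _ A0)// oppr_le0.
have [->|y0] := eqVneq y 0.
  rewrite (@cintegral_eq _ _ _ (fun=> 1)); last first.
    by move=> t _; rewrite /wave mulr0 expi0.
  rewrite /cintegral; apply: eqC => /=.
    by rewrite Rintegral_cst// mul1r; exact: mu_symitv.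
  by rewrite Rintegral_cst// mul0r.
set w := 2 * pi * y.
have w0 : w != 0 by rewrite mulf_neq0// mulf_neq0// gt_eqF ?pi_gt0.
rewrite /cintegral; apply: eqC => /=.
- rewrite (@Rint_eq _ _ _ (fun t => cos (w * t))); last first.
    by move=> t _; congr cos; rewrite /w; ring.
  have dG (x : R) : is_derive x 1 (fun t => w^-1 * sin (w * t)) (cos (w * x)).
    have h := is_derive_sinM w x; apply: is_derive_eq.
    by rewrite /GRing.scale /=; field.
  rewrite (Rintegral_FTC NA dG (continuous_cosM (w := w))).
  rewrite mulrN sinN mulrN opprK /w.
  rewrite (_ : 2 * pi * y * A = 2 * pi * A * y); last by ring.
  have p0 := pi_gt0 R; move: (sin _) => s; move: {w w0 dG} (pi : R) p0 => p p0.
  by field; rewrite y0 gt_eqF.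
- rewrite (@Rint_eq _ _ _ (fun t => sin (w * t))); last first.
    by move=> t _; congr sin; rewrite /w; ring.
  have dG (x : R) : is_derive x 1 (fun t => - (w^-1 * cos (w * t))) (sin (w * x)).
    have h := is_derive_cosM w x; apply: is_derive_eq.
    by rewrite /GRing.scale /=; field.
  rewrite (Rintegral_FTC NA dG (continuous_sinM (w := w))).
  by rewrite mulrN cosN subrr.
Qed.

Lemma ip_wave A x y : ip (symitv A) (wave x) (wave y) =
  cintegral (symitv A) (wave (x - y)).
Proof. by apply: cintegral_eq => t _; rewrite waveD waveN. Qed.

Lemma sin_pi_int (k : int) : sin (pi * k%:~R) = 0 :> R.
Proof.
have H n : sin (pi * n%:R) = 0 :> R.
  elim: n => [|n IH]; first by rewrite mulr0 sin0.
  by rewrite -natr1 mulrDr mulr1 sinDpi IH oppr0.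
by case: k => n; rewrite ?NegzE ?mulrNz ?mulrN ?sinN H ?oppr0.
Qed.

Lemma cos_pi_int_sq (k : int) : cos (pi * k%:~R) ^+ 2 = 1 :> R.
Proof. by have := cos2Dsin2 (pi * k%:~R : R); rewrite sin_pi_int expr0n addr0. Qed.

Lemma wave_orth A x : 0 < A -> forall k l : int,
  ip (symitv A) (wave (x + k%:~R / (2 * A))) (wave (x + l%:~R / (2 * A))) =
  (if k == l then 2 * A else 0)%:C.
Proof.
move=> A0 k l; rewrite ip_wave cintegral_wave ?(ltW A0)//.
have A2 : 2 * A != 0 by rewrite mulf_neq0// gt_eqF.
rewrite opprD addrACA subrr add0r -mulrBl mulf_eq0 invr_eq0 (negbTE A2) orbF.
rewrite -rmorphB /= intr_eq0 subr_eq0; case: ifPn => // kl.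
rewrite (_ : 2 * pi * A * _ = pi * (k - l)%:~R) ?sin_pi_int ?mul0r//.
by move: (pi : R) => p; field; rewrite gt_eqF.
Qed.

End wave.

#[global] Hint Resolve measurable_symitv : core.

Section sawtooth.
Context {R : realType}.
Local Notation mu := (@lebesgue_measure R).
Variables (A a : R).
Hypotheses (A0 : 0 < A) (aA : - A <= a <= A).
Local Notation I := (symitv A).

(** The function t - a, renormalised to mean zero and continued 2A-periodically
    with its jump at a. *)
Definition sawtooth (t : R) : R := t + (- a - A) + 2 * A * \1_`]-oo, a[ t.

Let NA : - A <= A. Proof. by rewrite lerNl (le_trans _ (ltW A0))// oppr_le0 ltW. Qed.

Lemma measurable_sawtooth : measurable_fun I sawtooth.
Proof.
apply: measurable_funTS; apply: measurable_funD.
  by apply: continuous_measurable_fun => x; apply: cvgD; [exact: cvg_id|exact: cvg_cst].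
by apply: measurable_funM => //; exact: measurable_indic.
Qed.

Lemma abs_sawtooth_le t : I t -> `|sawtooth t| <= 5 * A.
Proof.
rewrite /symitv /= in_itv /= /sawtooth indicE => /andP[t1 t2].
case/andP: aA => a1 a2.
by case: (_ \in _) => /=; rewrite ler_norml; apply/andP; split; lra.
Qed.

Lemma measurable_csawtooth :
  measurable_fun I (@complex.Re R \o (fun t => (sawtooth t)%:C)) /\
  measurable_fun I (@complex.Im R \o (fun t => (sawtooth t)%:C)).
Proof.
by split; [exact: measurable_sawtooth|exact: measurable_cst].
Qed.

Lemma L2on_sawtooth : L2on I (fun t => (sawtooth t)%:C).
Proof.
have [m1 m2] := measurable_csawtooth.
apply: (@L2on_bounded _ _ _ (5 * A) (measurable_symitv A) (symitv_lty A) m1 m2).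
by move=> t It; rewrite cabsC abs_sawtooth_le.
Qed.

Let integrable_cont (g : R -> R) : continuous g -> mu.-integrable I (EFin \o g).
Proof.
move=> cg; apply: continuous_compact_integrable; first exact: segment_compact.
exact: continuous_subspaceT.
Qed.

(** The primitive G carries the affine part of the sawtooth, and F the indicator
    of the part of the interval on the left of the jump. *)
Lemma Rintegral_sawtooth (g G F : R -> R) :
  (forall x : R, is_derive x 1 G (g x * (x + (- a - A)))) ->
  (forall x : R, is_derive x 1 F (g x)) -> continuous g ->
  \int[mu]_(t in I) (g t * sawtooth t) =
    G A - G (- A) + 2 * A * (F a - F (- A)).
Proof.
case/andP: aA => a1 a2 dG dF cg.
have cgt : continuous (fun t => g t * (t + (- a - A))).
  move=> x; apply: cvgM; first exact: cg.
  by apply: cvgD; [exact: cvg_id|exact: cvg_cst].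
have ig := integrable_cont cg.
have mI := measurable_symitv A.
have IE : I `&` `]-oo, a[%classic = `[- A, a[%classic.
  apply/seteqP; split => t; rewrite /symitv /= !in_itv /=.
    by move=> [/andP[-> _] ->].
  by move=> /andP[-> ta]; split => //; rewrite ltW// (lt_le_trans ta).
have ig0 : mu.-integrable `[- A, a[%classic (EFin \o g).
  apply: (integrableS mI) => //.
  by rewrite -IE => t [].
have ig1 : mu.-integrable I (EFin \o (g \_ `]-oo, a[)).
  rewrite -restrict_EFin; apply/integrable_restrict => //.
  by rewrite IE.
have ig2 : mu.-integrable I (EFin \o (fun t => 2 * A * (g \_ `]-oo, a[) t)).
  by apply: (eq_integrable mI _ _ _ (integrableZl mI (2 * A) ig1)) => x _ /=; rewrite EFinM.
rewrite (@Rint_eq _ _ _ (fun t => g t * (t + (- a - A)) +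
    2 * A * (g \_ `]-oo, a[) t)); last first.
  move=> t _; rewrite /sawtooth mulrDr patchE indicE; case: (_ \in _).
    by rewrite mulr1 [g t * (2 * A)]mulrC.
  by rewrite !mulr0.
rewrite RintegralD//; last exact: integrable_cont.
rewrite (Rintegral_FTC NA dG)//; congr (_ + _).
rewrite RintegralZl//; congr (_ * _).
rewrite -Rintegral_mkcondr IE Rintegral_itv_bndo_bndc//.
exact: Rintegral_FTC.
Qed.

Lemma ip_sawtooth (k : int) : k != 0 ->
  ip I (fun t => (sawtooth t)%:C) (wave (k%:~R / (2 * A))) =
  let w := pi * k%:~R / A in
  (2 * A * (sin (w * a) / w)) +i* (2 * A * (cos (w * a) / w)).
Proof.
move=> k0 /=; set w := pi * k%:~R / A.
have kR : k%:~R != 0 :> R by rewrite intr_eq0.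
have A1 : A != 0 by rewrite gt_eqF.
have w0 : w != 0 by rewrite mulf_neq0 ?invr_eq0// mulf_neq0// gt_eqF ?pi_gt0.
have wA : w * A = pi * k%:~R by rewrite /w divfK.
have we t : 2 * pi * t * (k%:~R / (2 * A)) = w * t.
  by rewrite /w; move: (pi : R) => p; field.
have sA : sin (w * A) = 0 by rewrite wA sin_pi_int.
rewrite /ip; apply: eqC; rewrite ?Re_cintegral ?Im_cintegral.
- rewrite (@Rint_eq _ _ _ (fun t => cos (w * t) * sawtooth t)); last first.
    by move=> t _; rewrite ReM /wave we /= mul0r subr0 mulrC.
  have dG (x : R) : is_derive x 1 (fun t => (t + (- a - A)) * (sin (w * t) / w)
      + cos (w * t) / w ^+ 2) (cos (w * x) * (x + (- a - A))).
    have h1 := is_derive_cosM w x; have h2 := is_derive_sinM w x.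
    by apply: is_derive_eq; rewrite /GRing.scale /=; field.
  have dF (x : R) : is_derive x 1 (fun t => sin (w * t) / w) (cos (w * x)).
    have h2 := is_derive_sinM w x.
    by apply: is_derive_eq; rewrite /GRing.scale /=; field.
  rewrite (Rintegral_sawtooth dG dF (continuous_cosM (w := w))).
  by rewrite !mulrN cosN sinN sA oppr0 mul0r !mulr0 !add0r subrr add0r subr0.
- rewrite (@Rint_eq _ _ _ (fun t => (- sin (w * t)) * sawtooth t)); last first.
    by move=> t _; rewrite ImM /wave we /= mul0r addr0 mulrC.
  have dG (x : R) : is_derive x 1 (fun t => (t + (- a - A)) * (cos (w * t) / w)
      - sin (w * t) / w ^+ 2) (- sin (w * x) * (x + (- a - A))).
    have h1 := is_derive_cosM w x; have h2 := is_derive_sinM w x.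
    by apply: is_derive_eq; rewrite /GRing.scale /=; field.
  have dF (x : R) : is_derive x 1 (fun t => cos (w * t) / w) (- sin (w * x)).
    have h2 := is_derive_cosM w x.
    by apply: is_derive_eq; rewrite /GRing.scale /=; field.
  have cN : continuous (fun t => - sin (w * t)).
    by move=> x; apply: continuousN; exact: continuous_sinM.
  rewrite (Rintegral_sawtooth dG dF cN).
  by rewrite !mulrN cosN sinN sA oppr0 mul0r !subr0 /=; ring.
Qed.

Lemma sq2_sawtooth : sq2 I (fun t => (sawtooth t)%:C) = 2 * A ^+ 3 / 3.
Proof.
have idc : continuous (fun t : R => t + (- a - A)).
  by move=> x; apply: cvgD; [exact: cvg_id|exact: cvg_cst].
case/andP: (aA) => a1 a2.
have mI := measurable_symitv A.
(* sawtooth t - q t is 0 or 2A, hence the square of the sawtooth is affine in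
   the sawtooth itself *)
pose q (t : R) := t + (- a - A).
pose g (t : R) := 2 * q t + 2 * A.
have dq (x : R) : is_derive x 1 q 1.
  by apply: is_derive_eq; rewrite addr0.
have dg (x : R) : is_derive x 1 g 2.
  by have h := dq x; apply: is_derive_eq; rewrite /GRing.scale /= mulr1 addr0.
have cq := is_derive_continuous dq.
have cg := is_derive_continuous dg.
have cr : continuous (fun t : R => q t * (q t + 2 * A)).
  move=> x; apply: cvgM; first exact: cq.
  by apply: cvgD; [exact: cq|exact: cvg_cst].
have ig : mu.-integrable I (EFin \o (fun t => g t * sawtooth t)).
  apply: measurable_bounded_integrable => //.
  - exact: symitv_lty.
  - apply: measurable_funM; last exact: measurable_sawtooth.
    by apply: measurable_funTS; exact: continuous_measurable_fun.
  - exists (10 * A * (5 * A)); split; first exact: num_real.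
    move=> M hM t It; apply: (le_trans _ (ltW hM)).
    rewrite normrM ler_pM ?abs_sawtooth_le//.
    move: It; rewrite /symitv /= in_itv /= /g /q => /andP[t1 t2].
    by rewrite ler_norml; apply/andP; split; lra.
rewrite /sq2 (@Rint_eq _ _ _
    (fun t => g t * sawtooth t - q t * (q t + 2 * A))); last first.
  move=> t _; rewrite cabsC real_normK ?num_real// /sawtooth -/(q t) /g.
  by rewrite indicE; case: (_ \in _) => /=; ring.
rewrite RintegralB//; last exact: integrable_cont.
have dG (x : R) : is_derive x 1 (fun t => 2 / 3 * q t ^+ 3 + A * q t ^+ 2)
    (g x * q x).
  have h := dq x; apply: is_derive_eq.
  by rewrite /GRing.scale /= /g; field.
have dF (x : R) : is_derive x 1 (fun t => q t ^+ 2 + 2 * A * q t) (g x).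
  have h := dq x; apply: is_derive_eq.
  by rewrite /GRing.scale /= /g; field.
have dH (x : R) : is_derive x 1 (fun t => 3^-1 * q t ^+ 3 + A * q t ^+ 2)
    (q x * (q x + 2 * A)).
  have h := dq x; apply: is_derive_eq.
  by rewrite /GRing.scale /=; field.
rewrite (Rintegral_sawtooth dG dF cg) (Rintegral_FTC NA dH cr).
by rewrite /q; field.
Qed.

End sawtooth.

(** * Completeness of the trigonometric system *)

Section trigonometric_completeness.
Context {R : realType}.
Local Notation mu := (@lebesgue_measure R).
Variable A : R.
Hypothesis A0 : 0 < A.
Local Notation I := (symitv A).
Local Notation e := (fun k : int => wave (k%:~R / (2 * A))).

Let A2 : 0 < 2 * A. Proof. by rewrite mulr_gt0. Qed.

Let le2 k : L2on I (e k). Proof. exact: L2on_wave. Qed.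

Let e_orth k l : ip I (e k) (e l) = (if k == l then 2 * A else 0)%:C.
Proof. by have := wave_orth 0 A0 k l; rewrite !add0r. Qed.

Definition nonzero_ints (n : nat) : seq int :=
  [seq Posz k.+1 | k <- iota 0 n] ++ [seq Negz k | k <- iota 0 n].

Lemma uniq_nonzero_ints n : uniq (nonzero_ints n).
Proof.
rewrite cat_uniq !map_inj_uniq ?iota_uniq ?andbT /=.
- by apply/hasPn => _ /mapP[k _ ->]; apply/negP => /mapP[l _].
- by move=> i j [].
- by move=> i j [].
Qed.

Lemma nonzero_ints_neq0 n k : k \in nonzero_ints n -> k != 0.
Proof. by rewrite mem_cat => /orP[] /mapP[l _ ->]. Qed.

Lemma sum_inv_sq_nonzero_ints n :
  \sum_(k <- nonzero_ints n) (k%:~R ^+ 2)^-1 = 2 * basel_sum n :> R.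
Proof.
rewrite /nonzero_ints big_cat /= !big_map /basel_sum /index_iota subn0.
rewrite mulr_natl mulr2n; congr (_ + _); apply: eq_bigr => k _.
by rewrite NegzE mulrNz sqrrN.
Qed.

Lemma cabs_ip_sawtooth a (k : int) : - A <= a <= A -> k != 0 ->
  cabs (ip I (fun t => (sawtooth A a t)%:C) (e k)) ^+ 2 =
  4 * A ^+ 4 / pi ^+ 2 * (k%:~R ^+ 2)^-1.
Proof.
move=> aA k0; rewrite ip_sawtooth// cabs_sq /=.
have k1 : k%:~R != 0 :> R by rewrite intr_eq0.
have e1 := cos2Dsin2 (pi * k%:~R / A * a); move: e1.
move: (cos _) (sin _) => c s cs; have p0 := pi_gt0 R.
rewrite !exprMn -mulrDr -mulrDl [s ^+ 2 + _]addrC cs.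
move: (k%:~R : R) (pi : R) k1 p0 => m p m0 p0.
by field; rewrite m0 !gt_eqF.
Qed.

(** Bessel's inequality for the sawtooth is an equality, by the Basel sum; so
    the sawtooth is a limit of trigonometric polynomials. *)
Lemma ip_sawtooth_eq0 f a : - A <= a <= A -> L2on I f ->
  (forall k, ip I f (e k) = 0) -> ip I f (fun t => (sawtooth A a t)%:C) = 0.
Proof.
move=> aA lf f0; set s := fun t => (sawtooth A a t)%:C.
have ls : L2on I s by exact: L2on_sawtooth.
pose p n := span e (nonzero_ints n) (coef I e (2 * A) s).
have lp n : L2on I (p n) by exact: L2on_span.
have H n : cabs (ip I f s) ^+ 2 <=
    sq2 I f * (4 * A ^+ 3 / pi ^+ 2 * (pi ^+ 2 / 6 - basel_sum n)).
  have -> : ip I f s = conjc (ip I (fun t => s t - p n t) f).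
    rewrite -(ipC _ (L2onB _ ls (lp n)) lf)//.
    rewrite (ipC _ (L2onB _ ls (lp n)) lf)// ipBl//.
    rewrite [X in _ - X](ipC _ lf (lp n))//.
    rewrite (ip_span _ le2)// big1; last by move=> k _; rewrite f0 mulr0.
    by rewrite conjc0 subr0 (ipC _ lf ls)// conjcK.
  rewrite cabsJ mulrC.
  apply: (le_trans (ip_CauchySchwarz _ (L2onB _ ls (lp n)) lf)) => //.
  apply: (ler_wpM2r (sq2_ge0 _ _)).
  rewrite (sq2_sub_span _ A2 le2 e_orth)// ?uniq_nonzero_ints//.
  rewrite (eq_big_seq (fun k => 4 * A ^+ 4 / pi ^+ 2 * (k%:~R ^+ 2)^-1)); last first.
    by move=> k /nonzero_ints_neq0 k0; exact: cabs_ip_sawtooth.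
  rewrite -mulr_sumr sum_inv_sq_nonzero_ints sq2_sawtooth//.
  have p0 := pi_gt0 R; move: (basel_sum n) => b.
  move: (pi : R) p0 => q q0.
  rewrite le_eqVlt; apply/orP; left; apply/eqP; field.
  by rewrite !gt_eqF.
apply: cabs_eq0; apply/eqP; rewrite -sqrf_eq0 eq_le sqr_ge0 andbT.
have c : sq2 I f * (4 * A ^+ 3 / pi ^+ 2 * (pi ^+ 2 / 6 - basel_sum n)) @[n --> \oo]
    --> sq2 I f * (4 * A ^+ 3 / pi ^+ 2 * (pi ^+ 2 / 6 - pi ^+ 2 / 6)).
  apply: cvgMr; apply: cvgMr; apply: cvgB; first exact: cvg_cst.
  exact: basel_cvg.
rewrite subrr !mulr0 in c.
exact: (ler_cvg_to (cvg_cst (cabs (ip I f s) ^+ 2)) c (nearW _ H)).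
Qed.

(** Subtracting the sawtooth with its jump at an endpoint from the one with its
    jump at a leaves an indicator function. *)
Lemma Rintegral_eq0_of_sawtooth (h : R -> R) :
  mu.-integrable I (EFin \o h) -> \int[mu]_(t in I) h t = 0 ->
  (forall a, - A <= a <= A -> \int[mu]_(t in I) (h t * sawtooth A a t) = 0) ->
  forall x, \int[mu]_(t in I `&` `]-oo, x[) h t = 0.
Proof.
move=> ih h0 hs.
have iI x : mu.-integrable I (EFin \o (h \_ `]-oo, x[)).
  rewrite -restrict_EFin; apply/integrable_restrict => //.
  apply: (integrableS (measurable_symitv A) _ _ ih); last by move=> t [].
  exact: (measurableI _ _ (measurable_symitv A) (measurable_itv _)).
have iZ x : mu.-integrable I (EFin \o (fun t => 2 * A * (h \_ `]-oo, x[) t)).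
  by apply: (eq_integrable (measurable_symitv A) _ _ _ (integrableZl _ (2 * A) (iI x)))
    => // t _ /=; rewrite EFinM.
have iT : mu.-integrable I (EFin \o (fun t => h t * t)).
  apply: (@le_integrable _ _ _ mu I (measurable_symitv A) _ (EFin \o (fun t => A * h t))).
  - apply/measurable_EFinP; apply: measurable_funM => //.
    by apply/measurable_EFinP; exact: (measurable_int mu ih).
  - move=> t; rewrite /symitv /= in_itv /= => tA.
    by rewrite lee_fin !normrM mulrC ler_wpM2r// (ger0_norm (ltW A0)) ler_norml.
  - by apply: (eq_integrable (measurable_symitv A) _ _ _ (integrableZl _ A ih))
      => // t _ /=; rewrite EFinM.
have iC c : mu.-integrable I (EFin \o (fun t => c * h t)).
  by apply: (eq_integrable (measurable_symitv A) _ _ _ (integrableZl _ c ih))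
    => // t _ /=; rewrite EFinM.
have E a : \int[mu]_(t in I) (h t * sawtooth A a t) =
    \int[mu]_(t in I) (h t * t) + 2 * A * \int[mu]_(t in I `&` `]-oo, a[) h t.
  rewrite Rintegral_mkcondr -RintegralZl//.
  rewrite -[X in X + _]addr0 -[X in _ + X + _](mulr0 (- a - A)) -h0 -RintegralZl//.
  rewrite -!RintegralD//; last first.
    by apply: (eq_integrable (measurable_symitv A) _ _ _ (integrableD _ iT (iC (- a - A)))).
  apply: Rint_eq => t _; rewrite /sawtooth indicE patchE.
  have p0 : point = 0 :> R by [].
  by case: (_ \in _) => /=; rewrite ?p0; ring.
have T0 : \int[mu]_(t in I) (h t * t) = 0.
  have := hs (- A); rewrite E (_ : I `&` _ = set0).
    by rewrite Rintegral_set0 mulr0 addr0; apply; rewrite lexx lerNl (le_trans _ (ltW A0))// oppr_le0 ltW.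
  apply/seteqP; split => // t; rewrite /symitv /= !in_itv /=.
  by move=> [/andP[+ _]]; rewrite leNgt => /negbTE ->.
move=> x; have [xA|xA] := leP x (- A).
  rewrite (_ : I `&` _ = set0) ?Rintegral_set0//.
  apply/seteqP; split => // t; rewrite /symitv /= !in_itv /= => -[/andP[tA _]] tx.
  by have := lt_le_trans tx xA; rewrite ltNge tA.
have [Ax|Ax] := leP x A; last first.
  rewrite (_ : I `&` _ = I)//.
  apply/seteqP; split => [t []//|t]; rewrite /symitv /= !in_itv /= => /andP[-> tA].
  by rewrite tA; split => //; exact: le_lt_trans Ax.
have := hs x; rewrite E T0 add0r (ltW xA) Ax => /(_ isT)/eqP.
by rewrite mulf_eq0 gt_eqF//= => /eqP.
Qed.

(** An integrable function is almost everywhere the derivative of its primitive,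
    which is zero here. *)
Lemma ae_eq0_of_Rintegral (h : R -> R) :
  mu.-integrable I (EFin \o h) ->
  (forall x, \int[mu]_(t in I `&` `]-oo, x[) h t = 0) ->
  {ae mu, forall t, I t -> h t = 0}.
Proof.
move=> ih hx.
have loc := integrable_locally (measurable_symitv A) ih.
have iy (D : set (measurableTypeR R)) : measurable D ->
    mu.-integrable D (EFin \o (h \_ I)).
  move=> mD; rewrite -restrict_EFin; apply/integrable_restrict => //.
  apply: (integrableS (measurable_symitv A) _ _ ih); last by move=> t [].
  exact: (measurableI _ _ mD (measurable_symitv A)).
have ftc := FTC1Ny (fun y => iy _ (measurable_itv _)) loc.
apply: ae_imp ftc => x [_ dF] Ix.
have F0 : (fun x => \int[mu]_(t in `]-oo, x]) (h \_ I) t) = cst 0.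
  apply/funext => y; rewrite -Rintegral_itv_bndo_bndc; last exact: iy.
  by rewrite -Rintegral_mkcondr setIC hx.
move: dF; rewrite F0 derive1_cst patchE mem_set//.
Qed.

Lemma trigonometric_complete f : L2on I f ->
  (forall k : int, ip I f (wave (k%:~R / (2 * A))) = 0) -> sq2 I f = 0.
Proof.
move=> lf f0.
have mI := measurable_symitv A.
have [if1 if2] := L2on_cintegrable mI (symitv_lty A) lf.
have fs a : - A <= a <= A -> ip I f (fun t => (sawtooth A a t)%:C) = 0.
  by move=> aA; exact: ip_sawtooth_eq0.
have i0 : cintegral I f = 0.
  rewrite -[RHS](f0 0); apply: cintegral_eq => t _.
  by rewrite mul0r /wave mulr0 expi0 conjc1 mulr1.
have z1 : {ae mu, forall t, I t -> complex.Re (f t) = 0}.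
  apply: ae_eq0_of_Rintegral => //; apply: Rintegral_eq0_of_sawtooth => //.
    by rewrite -[LHS]Re_cintegral i0.
  move=> a /fs/(congr1 (@complex.Re R)); rewrite Re_cintegral => H.
  have {}H : _ = 0 := H; rewrite -[RHS]H.
  by apply: Rint_eq => t _; rewrite !ReImE /= oppr0 mulr0 subr0.
have z2 : {ae mu, forall t, I t -> complex.Im (f t) = 0}.
  apply: ae_eq0_of_Rintegral => //; apply: Rintegral_eq0_of_sawtooth => //.
    by rewrite -[LHS]Im_cintegral i0.
  move=> a /fs/(congr1 (@complex.Im R)); rewrite Im_cintegral => H.
  have {}H : _ = 0 := H; rewrite -[RHS]H.
  by apply: Rint_eq => t _; rewrite !ReImE /= oppr0 mulr0 add0r.
case: lf => m1 m2 _.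
rewrite /sq2 /Rintegral (@ge0_ae_eq_integral _ _ _ mu I _ (cst 0%E))//.
- by rewrite integral0.
- by apply/measurable_EFinP; exact: measurable_cabs_sq.
- by move=> t _; rewrite lee_fin sqr_ge0.
- apply: ae_imp (ae_and z1 z2) => t [h1 h2] It.
  by rewrite cabs_sq h1// h2// expr0n addr0.
Qed.

End trigonometric_completeness.

(** * The Plancherel identity *)

Section integrals_of_continuous_functions.
Context {R : realType}.
Local Notation mu := (@lebesgue_measure R).
Implicit Types (g : R -> R).

Lemma continuous_integrable g (a b : R) : continuous g ->
  mu.-integrable `[a, b] (EFin \o g).
Proof.
move=> cg; apply: continuous_compact_integrable; first exact: segment_compact.
exact: continuous_subspaceT.
Qed.

Lemma Rintegral_shift g (a b c : R) : a <= b -> continuous g ->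
  \int[mu]_(x in `[a + c, b + c]) g x = \int[mu]_(x in `[a, b]) g (x + c).
Proof.
move=> ab cg; rewrite /Rintegral; congr fine.
have dF (x : R) : is_derive x 1 (fun y : R => y + c) 1.
  by apply: is_derive_eq; rewrite addr0.
have F1 : (fun y : R => y + c)^`()%classic = cst 1.
  apply/funext => x; rewrite derive1E.
  by rewrite (@derive_val _ _ _ _ _ _ _ (dF x)).
have cF := is_derive_continuous dF.
rewrite (@integration_by_substitution_increasing _ (fun x => x + c) g a b ab).
- by rewrite F1; apply: eq_integral => x _ /=; rewrite /= mulr1.
- by move=> x y _ _ xy; rewrite ltrD2r.
- by rewrite F1 => x _; exact: cvg_cst.
- by rewrite F1; exact: is_cvg_cst.
- by rewrite F1; exact: is_cvg_cst.
- split.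
  + by move=> x _; have [] := dF x.
  + by apply: cvg_at_right_filter; exact: cF.
  + by apply: cvg_at_left_filter; exact: cF.
- exact: continuous_subspaceT.
Qed.

Lemma Rintegral_itv_cat g (a b c : R) : a <= b -> b <= c -> continuous g ->
  \int[mu]_(x in `[a, c]) g x =
  \int[mu]_(x in `[a, b]) g x + \int[mu]_(x in `[b, c]) g x.
Proof.
move=> ab bc cg.
have := @Rintegral_itvB _ g (BLeft a) (BRight c) b (continuous_integrable a c cg).
rewrite !bnd_simp => /(_ ab bc) /eqP.
rewrite subr_eq => /eqP ->; rewrite addrC; congr (_ + _).
rewrite Rintegral_itv_obnd_cbnd//.
apply: (integrableS _ _ _ (continuous_integrable b c cg)) => //.
exact: subset_itv_oc_cc.
Qed.

Lemma Rintegral_itv_pieces g (a w : R) (n : nat) : 0 <= w -> continuous g ->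
  \int[mu]_(x in `[a, a + n%:R * w]) g x =
  \sum_(k <- iota 0 n) \int[mu]_(x in `[0, w]) g (x + (a + k%:R * w)).
Proof.
move=> w0 cg; elim: n => [|n IH].
  by rewrite mul0r addr0 set_itv1 Rintegral_set1 big_nil.
rewrite -[in RHS]addn1 iotaD big_cat big_seq1 -IH add0n.
rewrite (@Rintegral_itv_cat _ _ (a + n%:R * w))//; first last.
- by rewrite lerD2l ler_wpM2r// ler_nat.
- by rewrite lerDl mulr_ge0.
congr (_ + _); rewrite -Rintegral_shift// add0r.
by rewrite -natr1 mulrDl mul1r addrCA addrC !addrA [w + _]addrC.
Qed.

Lemma integral_EFin_continuous g (a b : R) : continuous g ->
  (\int[mu]_(x in `[a, b]) (g x)%:E = (\int[mu]_(x in `[a, b]) g x)%:E)%E.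
Proof.
move=> cg; rewrite /Rintegral fineK//.
by apply: integrable_fin_num => //; exact: continuous_integrable.
Qed.

Lemma lipschitz_continuous g (K : R) :
  (forall x y, `|g x - g y| <= K * `|x - y|) -> continuous g.
Proof.
move=> gK x; apply/cvgrPdist_le => e e0.
have K0 : 0 < `|K| + 1 by rewrite ltr_wpDl.
near=> y.
apply: (le_trans (gK x y)); apply: (@le_trans _ _ ((`|K| + 1) * `|x - y|)).
  by rewrite ler_wpM2r// (le_trans (ler_norm K))// lerDl.
rewrite mulrC -ler_pdivlMr//; near: y.
by apply: cvgr_dist_le; [exact: cvg_id|rewrite divr_gt0].
Unshelve. all: by end_near.
Qed.

End integrals_of_continuous_functions.

Section fourier_transform.
Context {R : realType}.
Local Notation mu := (@lebesgue_measure R).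
Implicit Types (h : R -> R[i]) (A x y : R).

Definition ft A h x : R[i] := cintegral (symitv A) (fun t => h t * wave x t).

#[global] Arguments ft : simpl never.

Lemma ft_ip A h x : ft A h x = ip (symitv A) h (wave (- x)).
Proof. by apply: cintegral_eq => t _; rewrite waveN conjcK. Qed.

Lemma cabs_wave_sub x y (t : R) : cabs (wave x t - wave y t) <= 2 * pi * `|t| * `|x - y|.
Proof.
rewrite /wave (le_trans (cabs_expiB _ _))// -mulrBr !normrM.
by rewrite (ger0_norm (pi_ge0 R)) ger0_norm.
Qed.

Lemma cabs_ft_sub A h x y : L2on (symitv A) h ->
  cabs (ft A h x - ft A h y) <=
    2 * pi * A * (\int[mu]_(t in symitv A) cabs (h t)) * `|x - y|.
Proof.
move=> lh; have mI := measurable_symitv A; have Ioo := symitv_lty A.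
have i z := L2on_cintegrable mI Ioo (L2on_mul_wave z lh).
have ih := cintegrable_cabs mI (L2on_cintegrable mI Ioo lh).
have id : cintegrable (symitv A) (fun t => h t * wave x t - h t * wave y t).
  by apply: cintegrableD => //; exact: cintegrableN.
have -> : ft A h x - ft A h y =
    cintegral (symitv A) (fun t => h t * wave x t - h t * wave y t).
  by rewrite /ft -cintegralN// -cintegralD//; exact: cintegrableN.
apply: (le_trans (cabs_cintegral_le mI id)).
rewrite [leRHS](_ : _ = \int[mu]_(t in symitv A)
    (2 * pi * A * `|x - y| * cabs (h t))); last first.
  by rewrite RintegralZl//; ring.
apply: le_Rintegral => //.
- exact: cintegrable_cabs.
- by apply: (eq_integrable mI _ _ _ (integrableZl mI (2 * pi * A * `|x - y|) ih))
    => // t _ /=; rewrite EFinM.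
- move=> t; rewrite /symitv /= in_itv /= -ler_norml => tA.
  rewrite -mulrBr cabsM mulrC ler_wpM2r ?cabs_ge0//.
  apply: (le_trans (cabs_wave_sub _ _ _)).
  by rewrite ler_wpM2r// ler_wpM2l// mulr_ge0// pi_ge0.
Qed.

Lemma continuous_ft A h : L2on (symitv A) h ->
  continuous (@complex.Re R \o ft A h) /\ continuous (@complex.Im R \o ft A h).
Proof.
move=> lh; have L x y := cabs_ft_sub x y lh.
split; apply: lipschitz_continuous => x y; apply: le_trans (L x y) => /=.
- by have := Re_le_cabs (ft A h x - ft A h y); rewrite !ReImE.
- by have := Im_le_cabs (ft A h x - ft A h y); rewrite !ReImE.
Qed.

Lemma continuous_cabs_sq (f : R -> R[i]) :
  continuous (@complex.Re R \o f) -> continuous (@complex.Im R \o f) ->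
  continuous (fun x => cabs (f x) ^+ 2).
Proof.
move=> c1 c2; rewrite (_ : (fun _ => _) =
    fun x => (@complex.Re R \o f) x ^+ 2 + (@complex.Im R \o f) x ^+ 2).
  move=> x; apply: cvgD.
    apply: (@cvg_comp _ _ _ (@complex.Re R \o f) (fun y : R => y ^+ 2));
      [exact: c1|exact: exprn_continuous].
  apply: (@cvg_comp _ _ _ (@complex.Im R \o f) (fun y : R => y ^+ 2));
    [exact: c2|exact: exprn_continuous].
by apply/funext => x; rewrite cabs_sq.
Qed.

Variables (A : R) (h : R -> R[i]).
Hypotheses (A0 : 0 < A) (lh : L2on (symitv A) h).

Let E y (k : int) : R -> R[i] := wave (- (y + k%:~R / (2 * A))).

Let A2 : 0 < 2 * A. Proof. by rewrite mulr_gt0. Qed.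

Let lE y k : L2on (symitv A) (E y k). Proof. exact: L2on_wave. Qed.

Let E_orth y k l :
  ip (symitv A) (E y k) (E y l) = (if k == l then 2 * A else 0)%:C.
Proof.
have := wave_orth (- y) A0 (- k) (- l).
by rewrite eqr_opp !mulrNz !mulNr -!opprD.
Qed.

Lemma bessel_ft (s : seq int) y : uniq s ->
  \sum_(k <- s) cabs (ft A h (y + k%:~R / (2 * A))) ^+ 2 <= 2 * A * sq2 (symitv A) h.
Proof.
move=> us; under eq_bigr do rewrite ft_ip.
exact: (bessel (measurable_symitv A) A2 (lE y) (E_orth y) us lh).
Qed.

(** Modulating by a wave turns the system with frequencies y + k/2A into the one
    with frequencies k/2A. *)
Let E_complete y f : L2on (symitv A) f -> (forall k, ip (symitv A) f (E y k) = 0) ->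
  sq2 (symitv A) f = 0.
Proof.
move=> lf f0.
have -> : sq2 (symitv A) f = sq2 (symitv A) (fun t => f t * wave y t).
  by apply: Rint_eq => t _; rewrite cabsM cabs_wave mulr1.
apply: trigonometric_complete => //; first exact: L2on_mul_wave.
move=> k; rewrite -[RHS](f0 (- k)); apply: cintegral_eq => t _.
rewrite /E waveN conjcK -mulrA; congr (_ * _).
by rewrite waveD mulrNz mulNr waveN.
Qed.

Lemma parseval_ft y (d : R) : 0 < d -> exists s : seq int, uniq s /\
  2 * A * sq2 (symitv A) h - d <
    \sum_(k <- s) cabs (ft A h (y + k%:~R / (2 * A))) ^+ 2.
Proof.
move=> d0; have mI := measurable_symitv A.
have [s_ [us hs]] := parseval_span mI (symitv_lty A) A2 (lE y) (E_orth y)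
  (@E_complete y) lh.
have c : 4 * Num.sqrt (2 * A) * 2^-1 ^+ j @[j --> \oo] --> 0.
  rewrite -[X in _ --> X](mulr0 (4 * Num.sqrt (2 * A))); apply: cvgMr.
  by apply: cvg_expr; rewrite ger0_norm ?invr_ge0// invf_lt1// ltr1n.
have q0 : 0 < Num.sqrt (d / (2 * A)) by rewrite sqrtr_gt0 divr_gt0.
have /cvgrPdist_lt/(_ _ q0)[N _ /(_ N (leqnn N))] := c.
rewrite sub0r normrN => hN.
exists (s_ N); split; first exact: us.
rewrite (eq_bigr (fun k => cabs (ip (symitv A) h (E y k)) ^+ 2)); last first.
  by move=> k _; rewrite ft_ip.
have := sq2_sub_span mI A2 (lE y) (E_orth y) (us N) lh.
rewrite -nrm2K => e1.
have lt1 : nrm2 (symitv A) (fun t => h t -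
    span (E y) (s_ N) (coef (symitv A) (E y) (2 * A) h) t) < Num.sqrt (d / (2 * A)).
  by apply: (le_lt_trans (hs N)); apply: le_lt_trans hN; exact: ler_norm.
have : nrm2 (symitv A) (fun t => h t -
    span (E y) (s_ N) (coef (symitv A) (E y) (2 * A) h) t) ^+ 2 < d / (2 * A).
  rewrite -[ltRHS]sqr_sqrtr; last by rewrite ltW// divr_gt0.
  by rewrite ltrXn2r ?nnegrE ?nrm2_ge0 ?sqrtr_ge0.
rewrite e1 ltr_pdivlMr// mulrBl mulrAC mulVf ?gt_eqF// mul1r [_ * (2 * A)]mulrC.
by rewrite /E; lra.
Qed.

End fourier_transform.

Section plancherel.
Context {R : realType}.
Local Notation mu := (@lebesgue_measure R).

Definition int_range (n : nat) : seq int :=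
  [seq Posz k - Posz n | k <- iota 0 n.*2].

Lemma uniq_int_range n : uniq (int_range n).
Proof. by rewrite map_inj_uniq ?iota_uniq// => i j /addIr []. Qed.

Lemma mem_int_range n (k : int) : (k \in int_range n) = (- Posz n <= k < Posz n).
Proof.
apply/mapP/idP => [[j]|/andP[k1 k2]].
  by rewrite mem_iota add0n => /andP[_ jn] ->; lia.
exists (absz (k + Posz n)); last by lia.
by rewrite mem_iota add0n; lia.
Qed.

Lemma int_range_exhausts (s : seq int) : exists n, {subset s <= int_range n}.
Proof.
elim: s => [|k s [n IH]]; first by exists 0%N.
exists (maxn n (absz k).+1) => j; rewrite in_cons => /orP[/eqP ->|/IH].
  by rewrite mem_int_range; lia.
by rewrite !mem_int_range; lia.
Qed.

Lemma int_range_mono n m : (n <= m)%N -> {subset int_range n <= int_range m}.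
Proof. by move=> nm k; rewrite !mem_int_range; lia. Qed.

Lemma ler_sum_subset (T : eqType) (F : T -> R) (s1 s2 : seq T) :
  uniq s1 -> uniq s2 -> {subset s1 <= s2} -> (forall k, 0 <= F k) ->
  \sum_(k <- s1) F k <= \sum_(k <- s2) F k.
Proof.
move=> u1 u2 s12 F0; rewrite [leRHS](bigID (mem s1)) /=.
have -> : \sum_(k <- s2 | k \in s1) F k = \sum_(k <- s1) F k.
  rewrite -big_filter; apply: perm_big; apply: uniq_perm; rewrite ?filter_uniq//.
  by move=> k; rewrite mem_filter; case: (boolP (k \in s1)) => // /s12 ->.
by rewrite lerDl sumr_ge0.
Qed.

Variables (A : R) (h : R -> R[i]).
Hypotheses (A0 : 0 < A) (lh : L2on (symitv A) h).

Let w : R := (2 * A)^-1.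
Let w0 : 0 < w. Proof. by rewrite invr_gt0 mulr_gt0. Qed.

Let H2 (x : R) : R := cabs (ft A h x) ^+ 2.

Let H2_ge0 x : 0 <= H2 x. Proof. exact: sqr_ge0. Qed.

Let cH2 : continuous H2.
Proof. by have [? ?] := continuous_ft lh; exact: continuous_cabs_sq. Qed.

Let S n (y : R) : R := \sum_(k <- int_range n) H2 (y + k%:~R * w).

Let S_ndecr y n m : (n <= m)%N -> S n y <= S m y.
Proof.
move=> nm; apply: ler_sum_subset; rewrite ?uniq_int_range//.
exact: int_range_mono.
Qed.

Let cvgS y : S n y @[n --> \oo] --> 2 * A * sq2 (symitv A) h.
Proof.
apply/cvgrPdist_lt => d d0.
have [s [us hs]] := parseval_ft A0 lh y d0.
have [N sN] := int_range_exhausts s.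
exists N => // n /= Nn.
have h1 := bessel_ft A0 lh y (uniq_int_range n).
have h2 : \sum_(k <- s) H2 (y + k%:~R / (2 * A)) <= S n y.
  apply: ler_sum_subset; rewrite ?uniq_int_range// => k /sN.
  exact: int_range_mono.
by rewrite ger0_norm ?subr_ge0//; move: hs h2; rewrite /H2; lra.
Qed.

Let cS n : continuous (S n).
Proof.
rewrite /S; elim: (int_range n) => [|k s IH].
  by under eq_fun do rewrite big_nil; exact: cst_continuous.
under eq_fun do rewrite big_cons.
move=> x; apply: cvgD; last exact: IH.
apply: (@cvg_comp _ _ _ (fun y : R => y + k%:~R * w) H2); last exact: cH2.
by apply: cvgD; [exact: cvg_id|exact: cvg_cst].
Qed.

Let int_pieces n :
  \int[mu]_(x in `[- (n%:R * w), n%:R * w]) H2 x = \int[mu]_(y in `[0, w]) S n y.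
Proof.
have e : n%:R * w = - (n%:R * w) + n.*2%:R * w.
  by rewrite -muln2 natrM; ring.
rewrite [X in `[_, X]%classic]e (Rintegral_itv_pieces _ _ (ltW w0) cH2).
rewrite (@Rint_eq _ _ (S n)
  (fun y => \sum_(k <- iota 0 n.*2) H2 (y + (- (n%:R * w) + k%:R * w)))); last first.
  move=> y _; rewrite /S /int_range big_map; apply: eq_bigr => k _.
  by congr (H2 (y + _)); rewrite rmorphB /= -!pmulrn; ring.
elim: (iota 0 n.*2) => [|k s IH].
  rewrite big_nil (@Rint_eq _ _ _ (cst 0)); last by move=> y _; rewrite big_nil.
  by rewrite Rintegral_cst// mul0r.
have cT (c : R) : continuous (fun y => H2 (y + c)).
  move=> x; apply: (@cvg_comp _ _ _ (fun y : R => y + c) H2); last exact: cH2.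
  by apply: cvgD; [exact: cvg_id|exact: cvg_cst].
rewrite big_cons IH -RintegralD//; first last.
- have cs : continuous (fun y => \sum_(k <- s) H2 (y + (- (n%:R * w) + k%:R * w))).
    elim: (s) => [|j s' IH'].
      by under eq_fun do rewrite big_nil; exact: cst_continuous.
    under eq_fun do rewrite big_cons.
    by move=> x; apply: cvgD; [exact: cT|exact: IH'].
  exact: (continuous_integrable 0 w cs).
- exact: (continuous_integrable 0 w (cT _)).
by apply: Rint_eq => y _; rewrite big_cons.
Qed.

(** Cutting the line into translates of [0, 1/2A] turns the integral of the
    squared transform into an average of Parseval sums. *)
Lemma plancherel :
  (\int[mu]_x (cabs (ft A h x) ^+ 2)%:E = (sq2 (symitv A) h)%:E)%E.
Proof.
pose F n : set (measurableTypeR R) := `[- (n%:R * w), n%:R * w]%classic.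
have mH2 (D : set (measurableTypeR R)) : measurable_fun D (fun x => (H2 x)%:E).
  by apply/measurable_EFinP/measurable_funTS; exact: continuous_measurable_fun.
have c1 : (\int[mu]_(x in F n) (H2 x)%:E)%E @[n --> \oo] -->
    (\int[mu]_(x in \bigcup_n F n) (H2 x)%:E)%E.
  apply: ge0_nondecreasing_set_cvg_integral.
  - move=> n m nm; apply/subsetPset => x; rewrite /F /= !in_itv /=.
    have : n%:R * w <= m%:R * w by rewrite ler_wpM2r ?(ltW w0)// ler_nat.
    by lra.
  - by move=> n; exact: measurable_itv.
  - by move=> n; exact: mH2.
  - by move=> n x _; rewrite lee_fin.
have FT : \bigcup_n F n = setT.
  apply/seteqP; split => // x _.
  have [n xn] : exists n, `|x| / w < n%:R.
    exists (Num.trunc (`|x| / w)).+1; rewrite truncnS_gt//.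
  exists n => //; rewrite /F /= in_itv /= -ler_norml.
  by rewrite -ler_pdivrMr// ltW.
rewrite FT in c1.
have c2 : (\int[mu]_(y in `[0%R, w]) (S n y)%:E)%E @[n --> \oo] -->
    (\int[mu]_(y in `[0%R, w]) (fun y => limn (fun n => (S n y)%:E)) y)%E.
  apply: (@cvg_monotone_convergence _ _ _ mu _ _ (fun n y => (S n y)%:E)) => //.
  - by move=> n; apply/measurable_EFinP/measurable_funTS; exact: continuous_measurable_fun.
  - by move=> n y _; rewrite lee_fin sumr_ge0.
  - by move=> y _ n m nm; rewrite lee_fin S_ndecr.
have e n : (\int[mu]_(x in F n) (H2 x)%:E = \int[mu]_(y in `[0%R, w]) (S n y)%:E)%E.
  by rewrite /F !integral_EFin_continuous// int_pieces.
have c3 : (\int[mu]_(x in F n) (H2 x)%:E)%E @[n --> \oo] -->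
    (\int[mu]_(y in `[0%R, w]) (fun y => limn (fun n => (S n y)%:E)) y)%E.
  by under eq_fun do rewrite e.
rewrite (cvg_unique _ c1 c3)//.
rewrite (eq_integral (cst (2 * A * sq2 (symitv A) h)%:E)); last first.
  move=> y _ /=; apply: cvg_lim => //; apply: cvg_EFin; first exact: nearW.
  exact: cvgS.
rewrite integral_cst//= lebesgue_measure_itv/= lte_fin w0 -EFinD subr0 -EFinM.
by congr (_%:E); rewrite /w; field; rewrite gt_eqF.
Qed.

Lemma L2on_ft : L2on setT (ft A h).
Proof.
have [c1 c2] := continuous_ft lh.
apply: L2on_of_finite => //; try exact: continuous_measurable_fun.
by rewrite plancherel ltry.
Qed.

Lemma sq2_ft : sq2 setT (ft A h) = sq2 (symitv A) h.
Proof. by rewrite /sq2 /Rintegral plancherel. Qed.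

End plancherel.

(** * Exchanging the order of integration *)

Section fubini.
Context {R : realType}.
Local Notation mu := (@lebesgue_measure R).
Local Notation TR := (measurableTypeR R).

Lemma Rintegral_exchange (k : TR * TR -> R) (P Q : TR -> R) :
  measurable_fun setT k ->
  mu.-integrable setT (EFin \o P) -> mu.-integrable setT (EFin \o Q) ->
  (forall x, 0 <= P x) ->
  (forall x y, `|k (x, y)| <= P x * Q y) ->
  \int[mu]_x \int[mu]_y k (x, y) = \int[mu]_y \int[mu]_x k (x, y).
Proof.
move=> mk iP iQ P0 kPQ.
have mk1 x : measurable_fun setT (fun y => k (x, y)).
  by apply: measurableT_comp => //; exact: measurable_pair1.
have mk2 y : measurable_fun setT (fun x => k (x, y)).
  by apply: measurableT_comp => //; exact: measurable_pair2.
have i1 x : mu.-integrable setT (fun y => (k (x, y))%:E).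
  apply: (@le_integrable _ _ _ mu setT measurableT _ (fun y => (P x)%:E * (Q y)%:E)%E).
  - exact/measurable_EFinP.
  - by move=> y _; rewrite -EFinM lee_fin (le_trans (kPQ x y))// ler_norm.
  - exact: integrableZl.
have i2 y : mu.-integrable setT (fun x => (k (x, y))%:E).
  apply: (@le_integrable _ _ _ mu setT measurableT _ (fun x => (Q y)%:E * (P x)%:E)%E).
  - exact/measurable_EFinP.
  - by move=> x _; rewrite -EFinM lee_fin (le_trans (kPQ x y))// mulrC ler_norm.
  - exact: integrableZl.
have mkE : measurable_fun setT (EFin \o k) by exact/measurable_EFinP.
have ik : (mu \x mu)%E.-integrable setT (EFin \o k).
  apply/integrable12ltyP => //.
  apply: (@le_lt_trans _ _ (\int[mu]_x ((P x)%:E * \int[mu]_y `|(Q y)%:E|))%E).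
    apply: ge0_le_integral => //.
    - by move=> x _; exact: integral_ge0.
    - apply: (@measurable_fun_fubini_tonelli_F _ _ _ _ _ mu (fun z => `|(k z)%:E|%E)) => //.
      exact: measurableT_comp.
    - apply: emeasurable_funM => //; exact: (measurable_int mu iP).
    - move=> x _; rewrite -ge0_integralZl//.
      + apply: ge0_le_integral => //.
        * by apply: measurableT_comp => //; exact/measurable_EFinP.
        * apply: measurable_funeM; apply: measurableT_comp => //.
          exact: (measurable_int mu iQ).
        * move=> y _; rewrite /= -EFinM lee_fin (le_trans (kPQ x y))//.
          by rewrite ler_wpM2l// ler_norm.
      + by apply: measurableT_comp => //; exact: (measurable_int mu iQ).
      + by rewrite lee_fin.
  have /integrableP[_ Qoo] := iQ.
  have Qfin : (\int[mu]_y `|(Q y)%:E|)%E \is a fin_num.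
    by rewrite ge0_fin_numE// integral_ge0.
  rewrite -(fineK Qfin).
  apply: integrable_lty => //; exact: integrableZr.
have := Fubini ik.
rewrite /Rintegral => H; congr fine.
under eq_integral do rewrite fineK ?(integrable_fin_num _ (i1 _))//.
under [RHS]eq_integral do rewrite fineK ?(integrable_fin_num _ (i2 _))//.
exact: H.
Qed.

Lemma cintegral_exchange (K : TR * TR -> R[i]) (P Q : TR -> R) :
  measurable_fun setT (fun z => complex.Re (K z)) ->
  measurable_fun setT (fun z => complex.Im (K z)) ->
  mu.-integrable setT (EFin \o P) -> mu.-integrable setT (EFin \o Q) ->
  (forall x, 0 <= P x) ->
  (forall x y, cabs (K (x, y)) <= P x * Q y) ->
  cintegral setT (fun x => cintegral setT (fun y => K (x, y))) =
  cintegral setT (fun y => cintegral setT (fun x => K (x, y))).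
Proof.
move=> m1 m2 iP iQ P0 KPQ; apply: eqC; rewrite ?Re_cintegral ?Im_cintegral.
- apply: (Rintegral_exchange (k := fun z => complex.Re (K z)) m1 iP iQ P0) => x y.
  exact: le_trans (Re_le_cabs _) (KPQ x y).
- apply: (Rintegral_exchange (k := fun z => complex.Im (K z)) m2 iP iQ P0) => x y.
  exact: le_trans (Im_le_cabs _) (KPQ x y).
Qed.

Lemma cintegral_mkcond (D : set TR) (f : R -> R[i]) :
  cintegral D f = cintegral setT (fun x => (\1_D x)%:C * f x).
Proof.
apply: eqC; rewrite ?Re_cintegral ?Im_cintegral Rintegral_mkcond;
  apply: Rint_eq => x _; rewrite patchE indicE ReImE /= mul0r ?subr0 ?addr0;
  by case: (_ \in _); rewrite ?mul1r ?mul0r.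
Qed.

Lemma integrable_cut (D : set TR) (f : R -> R[i]) : measurable D ->
  cintegrable D f ->
  mu.-integrable setT (EFin \o (fun x => cabs ((\1_D x)%:C * f x))).
Proof.
move=> mD iF; have /integrable_mkcond := cintegrable_cabs mD iF => /(_ mD).
apply: (eq_integrable measurableT) => x _.
rewrite patchE /= cabsM cabsC indicE; case: (_ \in _) => /=.
  by rewrite normr1 mul1r.
by rewrite normr0 mul0r.
Qed.

Lemma measurable_cut (D : set TR) (f : R -> R[i]) : measurable D ->
  cintegrable D f ->
  measurable_fun setT (fun x => complex.Re ((\1_D x)%:C * f x)) /\
  measurable_fun setT (fun x => complex.Im ((\1_D x)%:C * f x)).
Proof.
move=> mD iF; have [m1 m2] := cintegrable_meas iF.
move/(measurable_restrictT _ mD) : m1 => m1.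
move/(measurable_restrictT _ mD) : m2 => m2.
split; [move: m1|move: m2]; apply: eq_measurable_fun => x _;
  rewrite patchE ReImE /= mul0r ?subr0 ?addr0 indicE;
  by case: (_ \in _); rewrite ?mul1r ?mul0r.
Qed.

Lemma measurable_cmul d (T : measurableType d) (f g : T -> R[i]) :
  measurable_fun setT (fun z => complex.Re (f z)) ->
  measurable_fun setT (fun z => complex.Im (f z)) ->
  measurable_fun setT (fun z => complex.Re (g z)) ->
  measurable_fun setT (fun z => complex.Im (g z)) ->
  measurable_fun setT (fun z => complex.Re (f z * g z)) /\
  measurable_fun setT (fun z => complex.Im (f z * g z)).
Proof.
move=> f1 f2 g1 g2; split.
- under eq_fun do rewrite ReM.
  by apply: measurable_funB; exact: measurable_funM.
- under eq_fun do rewrite ImM.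
  by apply: measurable_funD; exact: measurable_funM.
Qed.

(** The multiplication formula of the Fourier transform, between two bounded
    intervals. *)
Lemma ft_exchange (A B : R) (p q : R -> R[i]) :
  L2on (symitv A) p -> L2on (symitv B) q ->
  cintegral (symitv A) (fun x => p x * ft B q x) =
  cintegral (symitv B) (fun y => q y * ft A p y).
Proof.
move=> lp lq.
have mA := measurable_symitv A; have mB := measurable_symitv B.
have ip' := L2on_cintegrable mA (symitv_lty A) lp.
have iq := L2on_cintegrable mB (symitv_lty B) lq.
pose p1 (x : TR) : R[i] := (\1_(symitv A) x)%:C * p x.
pose q1 (x : TR) : R[i] := (\1_(symitv B) x)%:C * q x.
pose K (z : TR * TR) : R[i] := p1 z.1 * q1 z.2 * wave z.1 z.2.
have [mp1 mp2] := measurable_cut mA ip'.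
have [mq1 mq2] := measurable_cut mB iq.
have [mw1 mw2] : measurable_fun setT (fun z : TR * TR => complex.Re (wave z.1 z.2)) /\
    measurable_fun setT (fun z : TR * TR => complex.Im (wave z.1 z.2)).
  have m : measurable_fun setT (fun z : TR * TR => 2 * pi * z.2 * z.1).
    by apply: measurable_funM => //; apply: measurable_funM.
  split.
  - apply: (measurableT_comp (f := @cos R)) => //.
    by apply: continuous_measurable_fun; exact: continuous_cos.
  - apply: (measurableT_comp (f := @sin R)) => //.
    by apply: continuous_measurable_fun; exact: continuous_sin.
have [mK1 mK2] : measurable_fun setT (fun z => complex.Re (K z)) /\
    measurable_fun setT (fun z => complex.Im (K z)).
  have [a1 a2] : measurable_fun setT (fun z : TR * TR => complex.Re (p1 z.1 * q1 z.2)) /\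
     measurable_fun setT (fun z : TR * TR => complex.Im (p1 z.1 * q1 z.2)).
    apply: measurable_cmul.
    - exact: (measurableT_comp mp1 measurable_fst).
    - exact: (measurableT_comp mp2 measurable_fst).
    - exact: (measurableT_comp mq1 measurable_snd).
    - exact: (measurableT_comp mq2 measurable_snd).
  exact: measurable_cmul.
have H := cintegral_exchange mK1 mK2 (integrable_cut mA ip') (integrable_cut mB iq).
transitivity (cintegral setT (fun x => cintegral setT (fun y => K (x, y)))).
  rewrite cintegral_mkcond; apply: cintegral_eq => x _.
  have iw := L2on_cintegrable mB (symitv_lty B) (L2on_mul_wave x lq).
  rewrite mulrA -/(p1 x) /ft -(cintegralZ (p1 x) mB iw).
  rewrite cintegral_mkcond; apply: cintegral_eq => y _.
  by rewrite /K /q1 mulrCA !mulrA.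
rewrite H.
- rewrite [RHS]cintegral_mkcond; apply: cintegral_eq => y _.
  have iw := L2on_cintegrable mA (symitv_lty A) (L2on_mul_wave y lp).
  rewrite [RHS]mulrA -/(q1 y) /ft -(cintegralZ (q1 y) mA iw).
  rewrite [RHS]cintegral_mkcond; apply: cintegral_eq => x _.
  have -> : K (x, y) = p1 x * q1 y * wave y x.
    by rewrite /K /wave; congr (_ * expi _); rewrite /=; ring.
  by rewrite /p1 /q1 -!mulrA; congr (_ * _); rewrite mulrCA; congr (_ * _); rewrite mulrCA.
- by move=> x; exact: cabs_ge0.
- by move=> x y; rewrite /K /= !cabsM cabs_wave mulr1.
Qed.

End fubini.

(** * The Paley-Wiener space and the Fourier transform of its elements *)

Section L2norm_bridge.
Context {R : realType}.
Local Notation mu := (@lebesgue_measure R).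
Implicit Types (f g : R -> R[i]).

Lemma L2normE f : L2norm f = sqrte (\int[mu]_x (cabs (f x) ^+ 2)%:E)%E.
Proof.
rewrite /L2norm unlock /= poweR12_sqrt; last first.
  by apply: integral_ge0 => x _ /=; rewrite lee_fin powR_ge0.
congr sqrte; apply: eq_integral => x _.
by rewrite ger0_norm ?cabs_ge0// powR_mulrn// cabs_ge0.
Qed.

Lemma L2norm_nrm2 f : L2on setT f -> L2norm f = (nrm2 setT f)%:E.
Proof. by move=> lf; rewrite L2normE sq2_ereal. Qed.

Lemma L2norm_sqr f : L2on setT f -> (L2norm f ^+ 2)%E = (sq2 setT f)%:E.
Proof. by move=> lf; rewrite L2norm_nrm2// -EFin_expe nrm2K. Qed.

Lemma inL2P f : inL2 f <-> L2on setT f.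
Proof.
split => [[m1 m2]|lf].
  rewrite L2normE => foo; apply: L2on_of_finite => //.
  have : (0 <= \int[mu]_x (cabs (f x) ^+ 2)%:E)%E.
    by apply: integral_ge0 => x _; rewrite lee_fin sqr_ge0.
  by move: foo; case: (\int[mu]_x _)%E => //= r _ _; rewrite ltry.
have nf := L2norm_nrm2 lf; case: lf => m1 m2 _.
by split => //; rewrite nf ltry.
Qed.

Lemma L2onS (D E : set (measurableTypeR R)) f : measurable D -> measurable E ->
  E `<=` D -> L2on D f -> L2on E f.
Proof.
move=> mD mE ED [m1 m2 i]; split.
- exact: measurable_funS m1.
- exact: measurable_funS m2.
- exact: integrableS i.
Qed.

Lemma sq2S (D E : set (measurableTypeR R)) f : measurable D -> measurable E ->
  E `<=` D -> L2on D f -> sq2 E f <= sq2 D f.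
Proof.
move=> mD mE ED lf; have lE := L2onS mD mE ED lf.
rewrite -lee_fin -!sq2_ereal//; apply: ge0_subset_integral => //.
- by case: lf => m1 m2 _; apply/measurable_EFinP; exact: measurable_cabs_sq.
- by move=> x _; rewrite lee_fin sqr_ge0.
Qed.

Lemma sq2_mkcond (D : set (measurableTypeR R)) f :
  (forall x, ~ D x -> f x = 0) -> sq2 setT f = sq2 D f.
Proof.
move=> f0; rewrite /sq2 [RHS]Rintegral_mkcond; apply: Rint_eq => x _.
rewrite patchE; case: ifPn => //; rewrite notin_setE => /f0 ->.
by rewrite cabs0 expr0n.
Qed.

Lemma ip_mkcond (D : set (measurableTypeR R)) f g :
  (forall x, ~ D x -> f x = 0) -> ip setT f g = ip D f g.
Proof.
move=> f0; rewrite /ip [RHS]cintegral_mkcond; apply: cintegral_eq => x _.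
rewrite indicE; case: (boolP (x \in D)); rewrite ?mul1r//.
by rewrite notin_setE => /f0 ->; rewrite !mul0r.
Qed.

Lemma L2on_cut (D : set (measurableTypeR R)) f : measurable D -> L2on D f ->
  L2on setT (fun x => (\1_D x)%:C * f x).
Proof.
move=> mD [/(measurable_restrictT _ mD) m1 /(measurable_restrictT _ mD) m2].
move=> /(integrable_mkcond _ mD) i; split.
- apply: eq_measurable_fun m1 => x _.
  rewrite patchE /= ReM /= mul0r subr0 indicE.
  by case: (_ \in _); rewrite ?mul1r ?mul0r.
- apply: eq_measurable_fun m2 => x _.
  rewrite patchE /= ImM /= mul0r addr0 indicE.
  by case: (_ \in _); rewrite ?mul1r ?mul0r.
- apply: (eq_integrable measurableT _ _ _ i) => x _.
  rewrite patchE /= cabsM cabsC indicE exprMn; case: (_ \in _) => /=.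
    by rewrite normr1 expr1n mul1r.
  by rewrite normr0 expr0n mul0r.
Qed.

Lemma sq2_ae_eq (f g : R -> R[i]) : L2on setT f -> L2on setT g ->
  {ae mu, forall x, f x = g x} -> sq2 setT f = sq2 setT g.
Proof.
move=> [f1 f2 _] [g1 g2 _] fg; rewrite /sq2 /Rintegral; congr fine.
apply: ge0_ae_eq_integral => //.
- by apply/measurable_EFinP; exact: measurable_cabs_sq.
- by apply/measurable_EFinP; exact: measurable_cabs_sq.
- by move=> x _; rewrite lee_fin sqr_ge0.
- by move=> x _; rewrite lee_fin sqr_ge0.
- by apply: ae_imp fg => x ->.
Qed.

(** The squared modulus of f is the derivative of its primitive, which is zero. *)
Lemma continuous_sq2_eq0 f :
  continuous (@complex.Re R \o f) -> continuous (@complex.Im R \o f) ->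
  (forall B, 0 < B -> sq2 (symitv B) f = 0) -> forall x, f x = 0.
Proof.
move=> c1 c2 f0 x; have ck := continuous_cabs_sq c1 c2.
pose B := `|x| + 1.
have B0 : 0 < B by rewrite ltr_wpDl.
have [Bx xB] : - B < x /\ x < B.
  by have := ler_normr `|x| x; have := ler_norm x; have := ler_norm (- x);
    rewrite normrN /B; split; lra.
have ik := continuous_integrable (- B) B ck.
have [_] := continuous_FTC1_closed xB ik Bx (ck x).
set F := (fun y => _); have F0 : \forall y \near x, (cst 0 : R -> R) y = F y.
  near=> y; apply/esym/eqP; rewrite eq_le; apply/andP; split; last first.
    by apply: Rintegral_ge0 => t _; exact: sqr_ge0.
  have yB : y <= B by near: y; exact: lt_le_nbhsl.
  rewrite -(f0 B B0) /sq2 /symitv /F.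
  rewrite (@Rintegral_itv_cat _ _ (- B) y B)//; last first.
    by near: y; exact: lt_le_nbhsr.
  by rewrite lerDl; apply: Rintegral_ge0 => t _; exact: sqr_ge0.
have -> : F^`()%classic x = 0.
  have dF := near_eq_is_derive F0 (is_derive_cst (0 : R) x (1 : R)).
  by rewrite derive1E (@derive_val _ _ _ _ _ _ _ dF).
by move=> /esym/eqP; rewrite sqrf_eq0 => /eqP/cabs_eq0.
Unshelve. all: by end_near.
Qed.

(** Monotone convergence along the intervals with integer endpoints. *)
Lemma sq2_symitv_cvg f : L2on setT f -> forall d, 0 < d ->
  exists M, forall B, M <= B -> sq2 setT f - d < sq2 (symitv B) f.
Proof.
move=> lf d d0.
pose F (n : nat) := symitv (n%:R : R).
have c1 : (\int[mu]_(x in F n) (cabs (f x) ^+ 2)%:E)%E @[n --> \oo] -->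
    (\int[mu]_(x in \bigcup_n F n) (cabs (f x) ^+ 2)%:E)%E.
  apply: ge0_nondecreasing_set_cvg_integral.
  - move=> n m nm; apply/subsetPset => x; rewrite /F /symitv /= !in_itv /=.
    have : n%:R <= m%:R :> R by rewrite ler_nat.
    by lra.
  - by move=> n; exact: measurable_symitv.
  - move=> n; case: lf => m1 m2 _; apply/measurable_EFinP/measurable_funTS.
    exact: measurable_cabs_sq.
  - by move=> n x _; rewrite lee_fin sqr_ge0.
have FT : \bigcup_n F n = setT.
  apply/seteqP; split => // x _.
  exists (Num.trunc `|x|).+1 => //; rewrite /F /symitv /= in_itv /= -ler_norml.
  by rewrite ltW// truncnS_gt.
rewrite FT sq2_ereal// in c1.
have /fine_cvg/cvgrPdist_lt/(_ _ d0)[N _ /(_ N (leqnn N))] := c1.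
rewrite /= => hN; exists N%:R => B NB.
have lN : L2on (F N) f by apply: (L2onS measurableT (measurable_symitv _) _ lf).
have lB : L2on (symitv B) f by apply: (L2onS measurableT (measurable_symitv _) _ lf).
move: hN; rewrite (sq2_ereal (measurable_symitv _) lN) => hN.
have : sq2 (F N) f <= sq2 (symitv B) f.
  apply: (sq2S (measurable_symitv _) (measurable_symitv _) _ lB) => x.
  by rewrite /F /symitv /= !in_itv /=; move: NB; lra.
by move: hN; rewrite ltr_norml => /andP[_]; rewrite /=; lra.
Qed.

End L2norm_bridge.

Section paley_wiener.
Context {R : realType}.
Local Notation mu := (@lebesgue_measure R).
Local Notation I := (symitv (2^-1 : R)).
Implicit Types (f g phi : R -> R[i]) (B : R).

Let half0 : 0 < 2^-1 :> R. Proof. by rewrite invr_gt0. Qed.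

Lemma fourier_truncE B f xi : L2on (symitv B) f ->
  fourier_trunc f B xi = conjc (ft B (fun x => conjc (f x)) xi).
Proof.
move=> lf; have mB := measurable_symitv B.
rewrite /ft -cintegral_conj//; last first.
  by apply: (L2on_cintegrable mB (symitv_lty B)); exact/L2on_mul_wave/L2onJ.
apply: cintegral_eq => x _; rewrite rmorphM /= conjcK; congr (_ * _).
by rewrite expiN.
Qed.

Lemma L2on_fourier_trunc B f : 0 < B -> L2on (symitv B) f ->
  L2on setT (fourier_trunc f B).
Proof.
move=> B0 lf.
have lJ := L2onJ measurableT (L2on_ft B0 (L2onJ (measurable_symitv B) lf)).
by apply: (L2on_eq measurableT _ lJ) => x _; rewrite fourier_truncE.
Qed.

Lemma sq2_fourier_trunc B f : 0 < B -> L2on (symitv B) f ->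
  sq2 setT (fourier_trunc f B) = sq2 (symitv B) f.
Proof.
move=> B0 lf.
transitivity (sq2 setT (ft B (fun x => conjc (f x)))).
  by apply: Rint_eq => x _; rewrite fourier_truncE// cabsJ.
rewrite sq2_ft//; last exact: L2onJ.
by apply: Rint_eq => x _; rewrite cabsJ.
Qed.

Lemma ip_fourier_trunc B f phi : L2on (symitv B) f -> L2on I phi ->
  ip I phi (fourier_trunc f B) = ip (symitv B) (ft 2^-1 phi) f.
Proof.
move=> lf lphi; have lJ := L2onJ (measurable_symitv B) lf.
transitivity (cintegral I (fun y => phi y * ft B (fun x => conjc (f x)) y)).
  by apply: cintegral_eq => y _; rewrite fourier_truncE// conjcK.
rewrite (ft_exchange lphi lJ); apply: cintegral_eq => y _.
by rewrite mulrC.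
Qed.

Lemma L2on_ft_itv phi B : L2on I phi -> L2on (symitv B) (ft 2^-1 phi).
Proof.
by move=> lphi; apply: (L2onS measurableT (measurable_symitv B) _ (L2on_ft half0 lphi)).
Qed.

(** Plancherel turns a distance on the frequency side into quantities on the
    time side. *)
Lemma sq2_sub_fourier_trunc B f phi : 0 < B -> L2on (symitv B) f ->
  L2on setT phi -> (forall x, ~ I x -> phi x = 0) ->
  sq2 setT (fun xi => phi xi - fourier_trunc f B xi) =
  sq2 I phi - 2 * complex.Re (ip (symitv B) (ft 2^-1 phi) f) + sq2 (symitv B) f.
Proof.
move=> B0 lf lphi phi0.
have lI : L2on I phi by apply: (L2onS measurableT (measurable_symitv _) _ lphi).
rewrite sq2B//; last exact: L2on_fourier_trunc.
by rewrite (sq2_mkcond phi0) (ip_mkcond _ phi0) ip_fourier_trunc// sq2_fourier_trunc.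
Qed.

Definition cut phi : R -> R[i] := fun x => (\1_I x)%:C * phi x.

Lemma cut_out phi x : ~ I x -> cut phi x = 0.
Proof. by move=> Ix; rewrite /cut indicE memNset// mul0r. Qed.

Lemma cut_in phi x : I x -> cut phi x = phi x.
Proof. by move=> Ix; rewrite /cut indicE mem_set// mul1r. Qed.

Lemma ft_cut phi x : ft 2^-1 (cut phi) x = ft 2^-1 phi x.
Proof. by apply: cintegral_eq => t It; rewrite cut_in. Qed.

(** Let g be the transform of phi. By Plancherel, the mass of f - g on `[-B, B] is
    at most the squared distance from phi to the Fourier integral of f over
    `[-B, B], which tends to zero; and f and g are continuous. *)
Lemma fourier_inversion f phi :
  continuous (@complex.Re R \o f) -> continuous (@complex.Im R \o f) ->
  inL2 f -> is_fourier_transform f phi ->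
  {ae mu, forall xi : R, xi \notin `[- 2^-1, 2^-1] -> phi xi = 0} ->
  forall x, f x = ft 2^-1 phi x.
Proof.
move=> cf1 cf2 /inL2P lf [/inL2P lphi limphi] phi0.
have mI := measurable_symitv (2^-1 : R).
have lphiI : L2on I phi by apply: (L2onS measurableT mI _ lphi).
have lc : L2on setT (cut phi) by exact: L2on_cut.
have lcI : L2on I (cut phi) by apply: (L2onS measurableT mI _ lc).
have ephi : {ae mu, forall x, phi x = cut phi x}.
  apply: ae_imp phi0 => x px; have [Ix|Ix] := pselect (I x).
    by rewrite cut_in.
  by rewrite cut_out// px//; apply/negP => h; apply: Ix; rewrite /symitv /=.
set g := ft 2^-1 phi.
have gE : g = ft 2^-1 (cut phi) by apply/funext => x; rewrite ft_cut.
have lfB B : L2on (symitv B) f.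
  by apply: (L2onS measurableT (measurable_symitv B) _ lf).
have lgB B : L2on (symitv B) g by exact: L2on_ft_itv.
have lhB B : 0 < B -> L2on setT (fourier_trunc f B).
  by move=> B0; exact: L2on_fourier_trunc.
have H B : 0 < B -> sq2 (symitv B) (fun x => f x - g x) <=
    sq2 setT (fun xi => phi xi - fourier_trunc f B xi).
  move=> B0.
  have -> : sq2 setT (fun xi => phi xi - fourier_trunc f B xi) =
      sq2 setT (fun xi => cut phi xi - fourier_trunc f B xi).
    apply: (sq2_ae_eq (L2onB measurableT lphi (lhB B B0))
                      (L2onB measurableT lc (lhB B B0))).
    by apply: ae_imp ephi => x ->.
  rewrite (sq2_sub_fourier_trunc B0 (lfB B) lc (@cut_out phi)) -gE.
  rewrite (sq2B (measurable_symitv B) (lfB B) (lgB B)).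
  rewrite (ipC (measurable_symitv B) (lgB B) (lfB B)) ReJ.
  have : sq2 (symitv B) g <= sq2 setT g.
    by apply: (sq2S measurableT (measurable_symitv B)) => //; exact: L2on_ft.
  rewrite gE sq2_ft//; lra.
have z B0 : 0 < B0 -> sq2 (symitv B0) (fun x => f x - g x) = 0.
  move=> B00; apply/eqP; rewrite eq_le sq2_ge0 andbT leNgt; apply/negP => p.
  have q : 0 < Num.sqrt (sq2 (symitv B0) (fun x => f x - g x)) by rewrite sqrtr_gt0.
  have /fine_cvg/cvgrPdist_lt/(_ _ q) := limphi.
  move=> near1; have [M [_ hM]] := near1.
  pose B := Num.max B0 (M + 1).
  have BB0 : B0 <= B by rewrite le_max lexx.
  have MB : M < B by rewrite lt_max ltrDl ltr01 orbT.
  have Bp : 0 < B by exact: lt_le_trans BB0.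
  have := hM B MB; rewrite sub0r normrN.
  rewrite [X in `|X|](_ : _ = nrm2 setT (fun xi => phi xi - fourier_trunc f B xi)); last first.
    by rewrite /= L2norm_nrm2//; apply: L2onB => //; exact: lhB.
  rewrite ger0_norm ?nrm2_ge0// /nrm2 ltr_sqrt//.
  rewrite ltNge => /negP; apply; apply: le_trans (H B Bp).
  apply: (sq2S (measurable_symitv B) (measurable_symitv B0)).
    by move=> x; rewrite /symitv /= !in_itv /=; move: BB0; lra.
  exact: L2onB.
have [cg1 cg2] := continuous_ft lphiI.
move=> x; apply/eqP; rewrite -subr_eq0; apply/eqP; move: x.
apply: (@continuous_sq2_eq0 _ (fun x => f x - g x)) => //.
- rewrite (_ : _ \o _ = (@complex.Re R \o f) \- (@complex.Re R \o g)).
    by move=> x; apply: cvgB; [exact: cf1|exact: cg1].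
  by apply/funext => x /=; rewrite !ReImE.
- rewrite (_ : _ \o _ = (@complex.Im R \o f) \- (@complex.Im R \o g)).
    by move=> x; apply: cvgB; [exact: cf2|exact: cg2].
  by apply/funext => x /=; rewrite !ReImE.
Qed.

(** By Plancherel, the squared distance from phi to the Fourier integral of its
    transform over `[-B, B] is the mass of the transform outside that interval. *)
Lemma ft_is_paley_wiener phi : L2on I phi ->
  inL2 (ft 2^-1 phi) /\
  exists phi', is_fourier_transform (ft 2^-1 phi) phi' /\
    {ae mu, forall xi : R, xi \notin `[- 2^-1, 2^-1] -> phi' xi = 0}.
Proof.
move=> lphi; have mI := measurable_symitv (2^-1 : R).
have lg := L2on_ft half0 lphi.
split; first exact/inL2P.
have lc : L2on setT (cut phi) by exact: L2on_cut.
have lcI : L2on I (cut phi) by apply: (L2onS measurableT mI _ lc).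
exists (cut phi); split; last first.
  have F : Filter (nbhs (almost_everywhere mu)) by apply: ae_filter_ringOfSetsType.
  apply: (@nearW _ _ _ F) => x h; apply: cut_out => Ix; move: h => /negP; apply.
  by move: Ix; rewrite /symitv.
split; first exact/inL2P.
set g := ft 2^-1 phi.
have gE : g = ft 2^-1 (cut phi) by apply/funext => x; rewrite ft_cut.
have E B : 0 < B -> L2norm (fun xi => cut phi xi - fourier_trunc g B xi) =
    (Num.sqrt (sq2 setT g - sq2 (symitv B) g))%:E.
  move=> B0; have lgB : L2on (symitv B) g by exact: L2on_ft_itv.
  rewrite L2norm_nrm2; last by apply: L2onB => //; exact: L2on_fourier_trunc.
  congr (_%:E); rewrite /nrm2; congr Num.sqrt.
  rewrite (sq2_sub_fourier_trunc B0 lgB lc (@cut_out phi)) -gE sq2E /=.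
  by rewrite gE sq2_ft//; ring.
apply: cvg_EFin.
  exists 0; split; first exact: real0.
  by move=> B B0; rewrite E.
apply/cvgrPdist_lt => d d0.
have d2 : 0 < d ^+ 2 by rewrite exprn_gt0.
have [M hM] := sq2_symitv_cvg lg d2.
exists (Num.max M 0); split; first exact: num_real.
move=> B; rewrite gt_max => /andP[MB B0].
rewrite /= E//= sub0r normrN ger0_norm ?sqrtr_ge0//.
rewrite -(ger0_norm (ltW d0)) -sqrtr_sqr ltr_sqrt//.
by have := hM _ (ltW MB); rewrite -/g; lra.
Qed.

End paley_wiener.

(** * Entire extension *)

Section entire_extension.
Context {R : realType}.
Local Notation mu := (@lebesgue_measure R).
Local Notation I := (symitv (2^-1 : R)).

Lemma expR_sub1_le (a : R) : `|expR a - 1| <= `|a| * expR `|a|.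
Proof.
have [a0|a0] := leP 0 a.
  have h : 1 <= expR a by rewrite -expR0 ler_expR.
  rewrite (ger0_norm a0) ger0_norm ?subr_ge0//.
  have h2 : (1 - a) * expR a <= 1.
    by have := expR_ge1Dx (- a); rewrite expRN -div1r ler_pdivlMr ?expR_gt0.
  by nra.
have h : expR a <= 1 by rewrite -expR0 ler_expR ltW.
rewrite (ltr0_norm a0) ler0_norm ?subr_le0// opprB.
have := expR_ge1Dx a.
have : 1 <= expR (- a) by rewrite -expR0 ler_expR oppr_ge0 ltW.
have : 0 < - a by rewrite oppr_gt0.
nra.
Qed.

Lemma expR_sub1_sub_le (a : R) : `|expR a - 1 - a| <= a ^+ 2 * expR `|a|.
Proof.
have h := expR_ge1Dx a.
rewrite ger0_norm; last by lra.
have h2 : (1 - a) * expR a <= 1.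
  by have := expR_ge1Dx (- a); rewrite expRN -div1r ler_pdivlMr ?expR_gt0.
have h3 : expR a - 1 - a <= a * (expR a - 1) by lra.
apply: (le_trans h3); apply: (le_trans (ler_norm _)); rewrite normrM.
have := expR_sub1_le a; have := normr_ge0 a => a0 h4.
rewrite -(real_normK (num_real a)) expr2 -mulrA.
exact: ler_wpM2l.
Qed.

Lemma cos_sub1_le (b : R) : `|cos b - 1| <= b ^+ 2.
Proof.
have e : b = b / 2 *+ 2 by rewrite mulr2n -splitr.
have -> : cos b - 1 = - (2 * sin (b / 2) ^+ 2).
  rewrite {1}e cos_mulr2n mulr2n.
  by have := cos2Dsin2 (b / 2); lra.
have s0 : 0 <= 2 * sin (b / 2) ^+ 2 by apply: mulr_ge0 => //; exact: sqr_ge0.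
rewrite normrN (ger0_norm s0).
have : `|sin (b / 2)| ^+ 2 <= `|b / 2| ^+ 2.
  by rewrite ler_pXn2r ?nnegrE// abs_sin_le.
by rewrite !real_normK ?num_real//; have := sqr_ge0 b; nra.
Qed.

Lemma sin_sub_le (b : R) : `|sin b - b| <= b ^+ 2.
Proof.
wlog b0 : b / 0 <= b.
  move=> H; have [/H//|/ltW b0] := leP 0 b.
  have := H (- b); rewrite oppr_ge0 sinN sqrrN -opprD normrN; exact.
rewrite ler0_norm ?subr_le0 ?sin_le_id// opprB.
pose f (x : R) := x ^+ 2 - x + sin x.
have df (x : R) : is_derive x 1 f (2 * x - 1 + cos x).
  rewrite /f; apply: is_derive_eq; rewrite /GRing.scale /=.
  by ring.
have := is_derive_ndecr df _ (lexx 0) b0 (lexx b).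
rewrite /f sin0 expr0n subr0 addr0 => H.
suff : 0 <= b ^+ 2 - b + sin b by lra.
apply: H => x /andP[x0 _].
have := cabs_expiB x 0; rewrite expi0 subr0 (ger0_norm (ltW x0)) => h.
have := le_trans (Re_le_cabs _) h; rewrite !ReImE /= ler_norml => /andP[].
by lra.
Qed.

Lemma ReCM (x : R) (z : R[i]) : complex.Re (x%:C * z) = x * complex.Re z.
Proof. by rewrite ReM /= mul0r subr0. Qed.

Lemma ImCM (x : R) (z : R[i]) : complex.Im (x%:C * z) = x * complex.Im z.
Proof. by rewrite ImM /= mul0r addr0. Qed.

(** The exponential of 2 i pi t z, in polar form. *)
Definition cwave (z : R[i]) (t : R) : R[i] :=
  (expR (- (2 * pi * t * complex.Im z)))%:C * wave (complex.Re z) t.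

Lemma cwave_real (x t : R) : cwave x%:C t = wave x t.
Proof. by rewrite /cwave /= mulr0 oppr0 expR0 mul1r. Qed.

Lemma cwaveD (z h : R[i]) t : cwave (z + h) t = cwave z t * cwave h t.
Proof.
rewrite /cwave ReD ImD waveD mulrDr opprD expRD rmorphM /=.
by rewrite mulrACA.
Qed.

Lemma cabs_cwave (z : R[i]) t :
  cabs (cwave z t) = expR (- (2 * pi * t * complex.Im z)).
Proof. by rewrite /cwave cabsM cabsC cabs_wave mulr1 ger0_norm ?expR_ge0. Qed.

Lemma abs_phase_le (z : R[i]) t : I t ->
  `|2 * pi * t * complex.Re z| <= pi * cabs z /\
  `|2 * pi * t * complex.Im z| <= pi * cabs z.
Proof.
rewrite /symitv /= in_itv /= -ler_norml => tI.
have c : `|2 * pi * t| <= pi.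
  rewrite !normrM (ger0_norm (pi_ge0 R)) ger0_norm// mulrAC -[leRHS]mul1r.
  by rewrite ler_wpM2r ?pi_ge0//; lra.
split; rewrite normrM ler_pM//; [exact: Re_le_cabs|exact: Im_le_cabs].
Qed.

Lemma cabs_cwave_le (z : R[i]) t : I t -> cabs (cwave z t) <= expR (pi * cabs z).
Proof.
move=> It; rewrite cabs_cwave ler_expR.
by apply: le_trans (ler_norm _) _; rewrite normrN; have [] := abs_phase_le z It.
Qed.

(** The bound is uniform in t, so that it survives the integration against phi. *)
Lemma cwave_taylor (h : R[i]) t : I t ->
  cabs (cwave h t - 1 - (2 * pi * t)%:C * 'i * h) <=
    4 * pi ^+ 2 * cabs h ^+ 2 * expR (pi * cabs h).
Proof.
move=> It; have [] := abs_phase_le h It.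
rewrite /cwave /wave.
have -> : (2 * pi * t)%:C * 'i * h =
    (- (2 * pi * t * complex.Im h)) +i* (2 * pi * t * complex.Re h).
  by case: h => a b; apply: eqC; rewrite !ReImE /=; ring.
rewrite -(normrN (2 * pi * t * complex.Im h)).
move: (- (2 * pi * t * complex.Im h)) (2 * pi * t * complex.Re h) => a b hb ha.
set M := pi * cabs h in ha hb *.
have -> : 4 * pi ^+ 2 * cabs h ^+ 2 * expR M = 4 * M ^+ 2 * expR M.
  by rewrite /M exprMn; ring.
have M0 : 0 <= M by rewrite mulr_ge0 ?pi_ge0 ?cabs_ge0.
have -> : (expR a)%:C * expi b - 1 - (a +i* b) =
    (expR a)%:C * ((cos b - 1) +i* (sin b - b)) + (expR a - 1 - a)%:C
    + (b * (expR a - 1)) *i.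
  by apply: eqC; rewrite /expi !ReImE /=; ring.
have ea : expR a <= expR M by rewrite ler_expR (le_trans (ler_norm a)).
have e0 := expR_gt0 a.
have eM := expR_gt0 M.
have a2 : a ^+ 2 <= M ^+ 2.
  by rewrite -(real_normK (num_real a)) lerXn2r ?nnegrE.
have b2 : b ^+ 2 <= M ^+ 2.
  by rewrite -(real_normK (num_real b)) lerXn2r ?nnegrE.
have eaM : expR `|a| <= expR M by rewrite ler_expR.
have k1 : cabs ((expR a)%:C * ((cos b - 1) +i* (sin b - b))) <= 2 * M ^+ 2 * expR M.
  rewrite cabsM cabsC ger0_norm ?(ltW e0)//.
  have : cabs ((cos b - 1) +i* (sin b - b)) <= 2 * M ^+ 2.
    apply: (le_trans (cabs_le_ReIm _)) => /=.
    by have := cos_sub1_le b; have := sin_sub_le b; lra.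
  by move=> k; rewrite mulrC; apply: (ler_pM (cabs_ge0 _) (ltW e0) k ea).
have k2 : cabs (expR a - 1 - a)%:C <= M ^+ 2 * expR M.
  rewrite cabsC; apply: (le_trans (expR_sub1_sub_le a)).
  exact: (ler_pM (sqr_ge0 _) (expR_ge0 _) a2 eaM).
have k3 : cabs (b * (expR a - 1)) *i <= M ^+ 2 * expR M.
  have -> : cabs (b * (expR a - 1)) *i = `|b| * `|expR a - 1|.
    by rewrite /= expr0n add0r sqrtr_sqr normrM.
  rewrite expr2 -mulrA; apply: ler_pM => //.
  apply: (le_trans (expR_sub1_le a)).
  exact: (ler_pM (normr_ge0 _) (expR_ge0 _) ha eaM).
apply: (le_trans (cabsD _ _)); apply: (le_trans (lerD (cabsD _ _) k3)).
by lra.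
Qed.

Lemma measurable_cwave (D : set (measurableTypeR R)) z :
  measurable_fun D (@complex.Re R \o cwave z) /\
  measurable_fun D (@complex.Im R \o cwave z).
Proof.
have [m1 m2] := measurable_wave D (complex.Re z).
have m0 : measurable_fun D (fun t : R => expR (- (2 * pi * t * complex.Im z))).
  apply: measurable_funTS; apply: measurableT_comp.
    by apply: continuous_measurable_fun; exact: continuous_expR.
  by apply: measurableT_comp => //; apply: measurable_funM => //; apply: measurable_funM.
split.
- rewrite (_ : _ \o _ = fun t => expR (- (2 * pi * t * complex.Im z)) *
      (@complex.Re R \o wave (complex.Re z)) t); first exact: measurable_funM.
  by apply/funext => t; rewrite /comp -ReCM.
- rewrite (_ : _ \o _ = fun t => expR (- (2 * pi * t * complex.Im z)) *
      (@complex.Im R \o wave (complex.Re z)) t); first exact: measurable_funM.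
  by apply/funext => t; rewrite /comp -ImCM.
Qed.

Variable phi : R -> R[i].
Hypothesis lphi : L2on I phi.

Let mI := measurable_symitv (2^-1 : R).

Definition ext (z : R[i]) : R[i] := cintegral I (fun t => phi t * cwave z t).

(** The derivative of ext, by differentiation under the integral sign. *)
Definition ext' (z : R[i]) : R[i] :=
  cintegral I (fun t => phi t * cwave z t * ((2 * pi * t)%:C * 'i)).

Lemma ext_real (x : R) : ext x%:C = ft 2^-1 phi x.
Proof. by apply: cintegral_eq => t _; rewrite cwave_real. Qed.

Let N1 : R := \int[mu]_(t in I) cabs (phi t).

Let iphi := L2on_cintegrable mI (symitv_lty _) lphi.

Let L2on_ext z : L2on I (fun t => phi t * cwave z t).
Proof.
have [m1 m2] := measurable_cwave I z.
by apply: (L2on_mul_bounded mI lphi m1 m2) => t; exact: cabs_cwave_le.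
Qed.

Let L2on_ext' z : L2on I (fun t => phi t * cwave z t * ((2 * pi * t)%:C * 'i)).
Proof.
apply: (@L2on_mul_bounded _ _ _ (fun t => (2 * pi * t)%:C * 'i) pi mI (L2on_ext z)).
- rewrite (_ : _ \o _ = cst 0); first exact: measurable_cst.
  by apply/funext => t; rewrite /comp ReCM /= mulr0.
- rewrite (_ : _ \o _ = fun t => 2 * pi * t); first exact: measurable_funM.
  by apply/funext => t; rewrite /comp ImCM /= mulr1.
- move=> t It; have [h _] := abs_phase_le (1 : R[i]) It.
  rewrite (cabsC 1) normr1 !mulr1 in h.
  have i1 : cabs ('i : R[i]) = 1 by rewrite /= expr0n expr1n add0r sqrtr1.
  by rewrite cabsM cabsC i1 mulr1.
Qed.

Let cabs_int_le (k : R -> R[i]) (M : R) : cintegrable I (fun t => phi t * k t) ->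
  (forall t, I t -> cabs (k t) <= M) ->
  cabs (cintegral I (fun t => phi t * k t)) <= M * N1.
Proof.
move=> ik kM; apply: (le_trans (cabs_cintegral_le mI ik)).
have ip := cintegrable_cabs mI iphi.
rewrite /N1 -RintegralZl//; apply: le_Rintegral => //.
- exact: cintegrable_cabs.
- by apply: (eq_integrable mI _ _ _ (integrableZl mI M ip)) => t _ /=; rewrite EFinM.
- by move=> t It; rewrite cabsM mulrC ler_wpM2r ?cabs_ge0 ?kM.
Qed.

Lemma ext_growth z : cabs (ext z) <= expR (pi * cabs z) * N1.
Proof.
apply: cabs_int_le => [|t]; last exact: cabs_cwave_le.
exact: (L2on_cintegrable mI (symitv_lty _)).
Qed.

Lemma ext_taylor z h : cabs h <= 1 ->
  cabs (ext (z + h) - ext z - ext' z * h) <=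
    expR (pi * cabs z) * (4 * pi ^+ 2 * expR pi) * N1 * cabs h ^+ 2.
Proof.
move=> h1; have i k := L2on_cintegrable mI (symitv_lty (2^-1 : R)) (L2on_ext k).
have i' := L2on_cintegrable mI (symitv_lty (2^-1 : R)) (L2on_ext' z).
pose k t := cwave z t * (cwave h t - 1 - (2 * pi * t)%:C * 'i * h).
have E t : phi t * cwave (z + h) t - phi t * cwave z t -
    h * (phi t * cwave z t * ((2 * pi * t)%:C * 'i)) = phi t * k t.
  by rewrite /k cwaveD; ring.
have iB := cintegrableD mI (i (z + h)) (cintegrableN mI (i z)).
have iZ := cintegrableZ h mI i'.
have ik : cintegrable I (fun t => phi t * k t).
  exact: (cintegrable_eq mI (fun t _ => E t) (cintegrableD mI iB (cintegrableN mI iZ))).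
have -> : ext (z + h) - ext z - ext' z * h = cintegral I (fun t => phi t * k t).
  rewrite /ext /ext' [_ * h]mulrC -(cintegralZ h mI i') -(cintegralN mI (i z)).
  rewrite -(cintegralN mI iZ) -(cintegralD mI (i (z + h)) (cintegrableN mI (i z))).
  rewrite -(cintegralD mI iB (cintegrableN mI iZ)).
  by apply: cintegral_eq => t _; exact: E.
rewrite [leRHS](_ : _ = expR (pi * cabs z) *
    (4 * pi ^+ 2 * cabs h ^+ 2 * expR pi) * N1); last by ring.
apply: cabs_int_le => // t It; rewrite /k cabsM ler_pM ?cabs_ge0 ?cabs_cwave_le//.
apply: (le_trans (cwave_taylor h It)); rewrite ler_wpM2l//.
  by apply: mulr_ge0; [apply: mulr_ge0 => //|]; exact: sqr_ge0.
by rewrite ler_expR -[leRHS]mulr1 ler_wpM2l ?pi_ge0.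
Qed.

Lemma N1_ge0 : 0 <= N1.
Proof. by apply: Rintegral_ge0 => t _; exact: cabs_ge0. Qed.

Lemma ext_exponential_type : exponential_type_le ext pi.
Proof.
move=> d d0; exists N1 => z; apply: (le_trans (ext_growth z)).
rewrite mulrC ler_wpM2l ?N1_ge0// ler_expR ler_wpM2r ?cabs_ge0//.
by rewrite lerDl ltW.
Qed.

Lemma ext_entire : entire ext.
Proof.
move=> z; apply/cvg_ex; exists (ext' z); apply/cvgrPdist_le => /= e e0.
have [er ee] : 0 < complex.Re e /\ e = (complex.Re e)%:C.
  by move: e0; rewrite ltcE /= => /andP[/eqP i0 r0]; split => //; apply: eqC.
pose K := expR (pi * cabs z) * (4 * pi ^+ 2 * expR pi) * N1 + 1.
have K0 : 0 < K.
  rewrite ltr_wpDl//; apply: mulr_ge0; last exact: N1_ge0.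
  apply: mulr_ge0; first exact: expR_ge0.
  apply: mulr_ge0; last exact: expR_ge0.
  by apply: mulr_ge0 => //; exact: sqr_ge0.
pose r := Num.min 1 (complex.Re e / K).
have r0 : 0 < r by rewrite lt_min ltr01 divr_gt0.
exists r%:C; first by rewrite /= ltcR.
move=> h /=; rewrite sub0r normrN normCE ltcR => hr h0.
have hp : 0 < cabs h.
  by rewrite lt_def cabs_ge0 andbT; apply: contra h0 => /eqP/cabs_eq0 ->.
have h1 : cabs h <= 1 by rewrite (le_trans (ltW hr))// ge_min lexx.
have he : cabs h <= complex.Re e / K by rewrite (le_trans (ltW hr))// ge_min lexx orbT.
rewrite ee normCE lecR.
have -> : ext' z - h^-1 *: (ext (h *: 1 + z) - ext z) =
    - (h^-1 * (ext (z + h) - ext z - ext' z * h)).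
  rewrite -[h *: 1]/(h * 1) mulr1 [h + z]addrC.
  rewrite -[h^-1 *: _]/(h^-1 * _).
  by move: (ext (z + h)) (ext z) (ext' z) => a b c; field.
rewrite cabsN cabsM ComplexField.Normc.normcV.
rewrite mulrC ler_pdivrMr//; apply: (le_trans (ext_taylor z h1)).
apply: (@le_trans _ _ (K * cabs h ^+ 2)).
  by rewrite ler_wpM2r ?sqr_ge0// lerDl.
rewrite expr2 mulrA ler_wpM2r ?cabs_ge0//.
by rewrite mulrC -ler_pdivlMr.
Qed.

End entire_extension.

Section entire_continuity.
Context {R : realType}.

Lemma entire_continuous (F : R[i] -> R[i]) : entire F ->
  continuous (@complex.Re R \o (fun x : R => F x%:C)) /\
  continuous (@complex.Im R \o (fun x : R => F x%:C)).
Proof.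
move=> eF.
have H (x : R) (d : R) : 0 < d ->
    \forall y \near x, cabs (F x%:C - F y%:C) <= d.
  move=> d0.
  have cF : {for x%:C, continuous (F : R[i]^o -> R[i]^o)}.
    by apply: differentiable_continuous; apply/derivable1_diffP; exact: eF.
  have d0' : 0 < d%:C :> R[i] by rewrite ltcR.
  move/cvgrPdist_le : cF => /(_ _ d0') [r /= r0 hr].
  have [rr re] : 0 < complex.Re r /\ r = (complex.Re r)%:C.
    by move: r0; rewrite ltcE /= => /andP[/eqP i0 r1]; split => //; apply: eqC.
  exists (complex.Re r) => //= y; rewrite /ball_ => xy.
  have xyC : `|x%:C - y%:C| < r.
    by rewrite re -rmorphB normCE cabsC ltcR.
  by rewrite -lecR -normCE; exact: (hr y%:C xyC).
split => x; apply/cvgrPdist_le => d d0; have := H x d d0; apply: filterS => y h /=.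
- by apply: le_trans h; have := Re_le_cabs (F x%:C - F y%:C); rewrite !ReImE.
- by apply: le_trans h; have := Im_le_cabs (F x%:C - F y%:C); rewrite !ReImE.
Qed.

Lemma PWpi_ft (f : R -> R[i]) : PWpi f ->
  exists phi, L2on (symitv 2^-1) phi /\ forall x, f x = ft 2^-1 phi x.
Proof.
move=> [f2 [phi [ft_phi phi0]] [F [eF _ fF]]].
have [c1 c2] := entire_continuous eF.
have fE : f = (fun x : R => F x%:C) by apply/funext.
exists phi; split; last by apply: fourier_inversion => //; rewrite fE.
have /inL2P lphi := ft_phi.1.
exact: (L2onS measurableT (measurable_symitv _) _ lphi).
Qed.

Lemma ft_PWpi (phi : R -> R[i]) : L2on (symitv 2^-1) phi -> PWpi (ft 2^-1 phi).
Proof.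
move=> lphi; have [h1 h2] := ft_is_paley_wiener lphi.
split => //; exists (ext phi); split.
- exact: ext_entire.
- exact: ext_exponential_type.
- by move=> x; rewrite ext_real.
Qed.

End entire_continuity.

(** * Finite square sums and Schur's test *)

Section finite_sums.
Context {R : realType}.

Lemma sum_CauchySchwarz (T : Type) (s : seq T) (w x y : T -> R) :
  (forall k, 0 <= w k) ->
  (\sum_(k <- s) w k * x k * y k) ^+ 2 <=
  (\sum_(k <- s) w k * x k ^+ 2) * (\sum_(k <- s) w k * y k ^+ 2).
Proof.
move=> w0; elim: s => [|k s IH]; first by rewrite !big_nil expr0n mul0r.
rewrite !big_cons.
have X0 : 0 <= \sum_(j <- s) w j * x j ^+ 2.
  by apply: sumr_ge0 => j _; apply: mulr_ge0 => //; exact: sqr_ge0.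
have Y0 : 0 <= \sum_(j <- s) w j * y j ^+ 2.
  by apply: sumr_ge0 => j _; apply: mulr_ge0 => //; exact: sqr_ge0.
move: (\sum_(j <- s) w j * x j * y j) (\sum_(j <- s) w j * x j ^+ 2)
  (\sum_(j <- s) w j * y j ^+ 2) IH X0 Y0 => S X Y SXY X0 Y0.
move: (w k) (x k) (y k) (w0 k) => {w0} w1 x1 y1 w0.
have N : 0 <= X * y1 ^+ 2 + Y * x1 ^+ 2.
  by apply: addr_ge0; apply: mulr_ge0 => //; exact: sqr_ge0.
have h : 2 * S * x1 * y1 <= X * y1 ^+ 2 + Y * x1 ^+ 2.
  apply: (le_trans (ler_norm _)); rewrite -(@ler_pXn2r _ 2)// ?nnegrE//.
  rewrite real_normK ?num_real//.
  have h1 := sqr_ge0 (X * y1 ^+ 2 - Y * x1 ^+ 2).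
  have h2 : 0 <= (X * Y - S ^+ 2) * (x1 * y1) ^+ 2.
    by apply: mulr_ge0; rewrite ?subr_ge0// sqr_ge0.
  rewrite -subr_ge0 (_ : _ - _ = (X * y1 ^+ 2 - Y * x1 ^+ 2) ^+ 2 +
    4 * ((X * Y - S ^+ 2) * (x1 * y1) ^+ 2)); last by ring.
  by lra.
have h2 : 0 <= w1 * (X * y1 ^+ 2 + Y * x1 ^+ 2 - 2 * S * x1 * y1).
  by apply: mulr_ge0; rewrite ?subr_ge0.
rewrite -subr_ge0 (_ : _ - _ = (X * Y - S ^+ 2) +
  w1 * (X * y1 ^+ 2 + Y * x1 ^+ 2 - 2 * S * x1 * y1)); last by ring.
by rewrite addr_ge0// subr_ge0.
Qed.

(** Minkowski's inequality for square sums. *)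
Lemma sum_sqD_le (T : Type) (s : seq T) (x y : T -> R[i]) (a b : R) :
  0 <= a -> 0 <= b ->
  \sum_(k <- s) cabs (x k) ^+ 2 <= a ^+ 2 ->
  \sum_(k <- s) cabs (y k) ^+ 2 <= b ^+ 2 ->
  \sum_(k <- s) cabs (x k + y k) ^+ 2 <= (a + b) ^+ 2.
Proof.
move=> a0 b0 xa yb.
set X := \sum_(k <- s) cabs (x k) ^+ 2 in xa; set Y := \sum_(k <- s) cabs (y k) ^+ 2 in yb.
set S := \sum_(k <- s) 1 * cabs (x k) * cabs (y k).
have S0 : 0 <= S by apply: sumr_ge0 => k _; rewrite !mulr_ge0 ?cabs_ge0.
have SXY : S ^+ 2 <= X * Y.
  have e (z : T -> R[i]) : \sum_(k <- s) 1 * cabs (z k) ^+ 2 = \sum_(k <- s) cabs (z k) ^+ 2.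
    by apply: eq_bigr => k _; rewrite mul1r.
  have := @sum_CauchySchwarz _ s (fun=> 1) (fun k => cabs (x k)) (fun k => cabs (y k))
    (fun=> ler01).
  by rewrite !e.
have Sab : S <= a * b.
  rewrite -(@ler_pXn2r _ 2)// ?nnegrE ?mulr_ge0// exprMn.
  by apply: (le_trans SXY); apply: ler_pM => //; apply: sumr_ge0 => k _; exact: sqr_ge0.
apply: (@le_trans _ _ (X + 2 * S + Y)).
  rewrite /X /S /Y mulr_sumr -!big_split /=; apply: ler_sum => k _.
  apply: (@le_trans _ _ ((cabs (x k) + cabs (y k)) ^+ 2)).
    by rewrite lerXn2r ?nnegrE ?addr_ge0 ?cabs_ge0 ?cabsD.
  by rewrite le_eqVlt; apply/orP; left; apply/eqP; ring.
by nra.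
Qed.

Definition inv_sq (k : int) : R := if k == 0 then 0 else (k%:~R ^+ 2)^-1.

Lemma inv_sq_ge0 k : 0 <= inv_sq k.
Proof. by rewrite /inv_sq; case: ifP => // _; rewrite invr_ge0 sqr_ge0. Qed.

Lemma inv_sqN k : inv_sq (- k) = inv_sq k.
Proof. by rewrite /inv_sq oppr_eq0 mulrNz sqrrN. Qed.

Lemma sum_inv_sq_le (s : seq int) : uniq s ->
  \sum_(k <- s) inv_sq k <= pi ^+ 2 / 3.
Proof.
move=> us.
have [n sn] : exists n, {subset [seq k <- s | k != 0] <= nonzero_ints n}.
  elim: (s) => [|k s' [n IH]]; first by exists 0%N.
  exists (maxn n (absz k)) => j; rewrite mem_filter in_cons => /andP[j0 /orP[/eqP jk|js]].
    subst j; rewrite mem_cat; case: k j0 => [[//|k]|k] _ /=; apply/orP; [left|right];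
      apply/mapP; exists k => //; rewrite mem_iota add0n /=; lia.
  have := IH j; rewrite mem_filter j0 js => /(_ isT).
  rewrite !mem_cat => /orP[/mapP[l]|/mapP[l]]; rewrite mem_iota add0n => ln ->;
    apply/orP; [left|right]; apply/mapP; exists l => //; rewrite mem_iota add0n; lia.
have -> : \sum_(k <- s) inv_sq k = \sum_(k <- [seq k <- s | k != 0]) inv_sq k.
  rewrite big_filter [LHS](bigID (fun k => k != 0)) /= [X in _ + X]big1 ?addr0//.
  by move=> k; rewrite negbK => /eqP ->; rewrite /inv_sq eqxx.
apply: (le_trans (ler_sum_subset _ (uniq_nonzero_ints n) sn inv_sq_ge0)).
  exact: filter_uniq.
rewrite (eq_big_seq (fun k => (k%:~R ^+ 2)^-1 : R)); last first.
  by move=> k /nonzero_ints_neq0 /negbTE k0; rewrite /inv_sq k0.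
by rewrite sum_inv_sq_nonzero_ints; have := @basel_sum_le R n; lra.
Qed.

(** Schur's test for a convolution kernel of finite mass. *)
Lemma schur_inv_sq (s F : seq int) (beta : int -> R) : uniq s -> uniq F ->
  \sum_(n <- F) (\sum_(m <- s) inv_sq (n - m) * beta m) ^+ 2 <=
  (pi ^+ 2 / 3) ^+ 2 * \sum_(m <- s) beta m ^+ 2.
Proof.
move=> us uF; set W := pi ^+ 2 / 3.
have W0 : 0 <= W by rewrite divr_ge0 ?sqr_ge0.
have shift (r : seq int) (n : int) : uniq r -> \sum_(m <- r) inv_sq (n - m) <= W.
  move=> ur; rewrite -(big_map (fun m => n - m) predT inv_sq).
  apply: sum_inv_sq_le; rewrite map_inj_uniq// => i j.
  by move=> /addrI /oppr_inj.
apply: (@le_trans _ _ (\sum_(n <- F) W * \sum_(m <- s) inv_sq (n - m) * beta m ^+ 2)).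
  apply: ler_sum => n _.
  have := @sum_CauchySchwarz _ s (fun m => inv_sq (n - m)) (fun=> 1) beta
    (fun m => inv_sq_ge0 _).
  under eq_bigr do rewrite mulr1.
  move=> h; apply: (le_trans h); apply: ler_wpM2r.
    apply: sumr_ge0 => m _; apply: mulr_ge0; first exact: inv_sq_ge0.
    exact: sqr_ge0.
  by under eq_bigr do rewrite expr1n mulr1; exact: shift.
rewrite -mulr_sumr expr2 -mulrA; apply: ler_wpM2l => //.
rewrite exchange_big /= mulr_sumr; apply: ler_sum => m _.
rewrite -mulr_suml; apply: ler_wpM2r; first exact: sqr_ge0.
under eq_bigr do rewrite -inv_sqN opprB.
exact: shift.
Qed.

End finite_sums.

(** * The cardinal sine *)

Section sinc.
Context {R : realType}.
Implicit Types (s t x L : R).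

Lemma sin_ratio_le s t : 0 < s -> s <= t -> t <= pi -> s * sin t <= t * sin s.
Proof.
move=> s0 st tpi; pose f (x : R) := x * sin s - s * sin x.
have df (x : R) : is_derive x 1 f (sin s - s * cos x).
  by rewrite /f; apply: is_derive_eq; rewrite /GRing.scale /=; ring.
have := is_derive_ndecr df _ (lexx s) st (lexx t).
rewrite /f subrr subr_ge0; apply => x /andP[sx xt].
have : s * cos s <= sin s.
  by apply: mul_cos_le_sin; rewrite (ltW s0) (le_trans st).
have : cos x <= cos s.
  rewrite ltW// ltr_cos// !in_itv /= ?(ltW s0) ?(le_trans st)//.
  by rewrite (le_trans (ltW xt)) ?tpi ?andbT ?(le_trans (ltW s0) (ltW sx)).
nra.
Qed.

Lemma sinc_piN x : sinc_pi (- x) = sinc_pi x.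
Proof.
rewrite /sinc_pi oppr_eq0; case: ifP => // _.
by rewrite mulrN sinN invrN mulrNN.
Qed.

Lemma sinc_pi_le1 x : 0 <= x -> sinc_pi x <= 1.
Proof.
move=> x0; rewrite /sinc_pi; case: eqVneq => // xn.
have xp : 0 < pi * x by rewrite mulr_gt0 ?pi_gt0// lt_def xn.
by rewrite ler_pdivrMr// mul1r sin_le_id// ltW.
Qed.

Lemma sinc_pi_anti x L : 0 <= x -> x <= L -> L <= 1 -> sinc_pi L <= sinc_pi x.
Proof.
move=> x0 xL L1; have [->|xn] := eqVneq x 0.
  by rewrite [X in _ <= X]/sinc_pi eqxx sinc_pi_le1// (le_trans x0).
have xp : 0 < x by rewrite lt_def xn.
have Lp : 0 < L by exact: lt_le_trans xL.
rewrite /sinc_pi (negbTE xn) (gt_eqF Lp).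
have p := pi_gt0 R.
rewrite ler_pdivrMr ?mulr_gt0// mulrAC ler_pdivlMr ?mulr_gt0//.
rewrite [leLHS]mulrC [leRHS]mulrC; apply: sin_ratio_le.
- by rewrite mulr_gt0.
- by rewrite ler_pM2l.
- by rewrite -[leRHS]mulr1 ler_pM2l.
Qed.

Lemma one_sub_sinc_le x L : `|x| <= L -> L <= 1 ->
  `|1 - sinc_pi x| <= 1 - sinc_pi L.
Proof.
move=> xL L1.
have -> : sinc_pi x = sinc_pi `|x|.
  by have [h|h] := leP 0 x; rewrite ?(ger0_norm h)// ltr0_norm// sinc_piN.
have h1 := sinc_pi_le1 (normr_ge0 x).
have h2 := sinc_pi_anti (normr_ge0 x) xL L1.
by rewrite ger0_norm; lra.
Qed.

Lemma abs_sin_pi_le x L : `|x| <= L -> L <= 2^-1 ->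
  `|sin (pi * x)| <= sin (pi * L).
Proof.
move=> xL L2; have p := pi_gt0 R.
have -> : `|sin (pi * x)| = sin (pi * `|x|).
  have h y : 0 <= y -> y <= 2^-1 -> 0 <= sin (pi * y) :> R.
    move=> y0 y2; apply: sin_ge0_pi; rewrite mulr_ge0 ?(ltW p)//=.
    rewrite -[leRHS]mulr1 ler_pM2l//; lra.
  have [x0|x0] := leP 0 x.
    by rewrite (ger0_norm x0) in xL *; rewrite ger0_norm// h// (le_trans xL).
  rewrite (ltr0_norm x0) in xL *.
  rewrite -normrN -sinN -mulrN ger0_norm// h ?(le_trans xL)//.
  by rewrite oppr_ge0 ltW.
move: xL; rewrite le_eqVlt => /predU1P[->//|xL].
have L0 : 0 < L by exact: le_lt_trans xL.
rewrite ltW// ltr_sin ?ltr_pM2l// in_itv /=.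
- apply/andP; split.
    by rewrite (@le_trans _ _ 0)// ?oppr_le0 ?divr_ge0 ?mulr_ge0 ?(ltW p).
  by rewrite ler_pM2l// ltW// (lt_le_trans xL).
- apply/andP; split.
    by rewrite (@le_trans _ _ 0)// ?oppr_le0 ?divr_ge0 ?mulr_ge0 ?(ltW p) ?(ltW L0).
  by rewrite ler_pM2l.
Qed.

End sinc.

(** * Perturbing the sampling points *)

Section perturbation.
Context {R : realType}.
Local Notation mu := (@lebesgue_measure R).
Local Notation I := (symitv (2^-1 : R)).

Let mI := measurable_symitv (2^-1 : R).
Let half0 : 0 < 2^-1 :> R. Proof. by rewrite invr_gt0. Qed.
Let two_half : 2 * 2^-1 = 1 :> R. Proof. by rewrite divff. Qed.

(** The Fourier basis of the frequency interval; the coefficients of phi in it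
    are the values of its transform at the integers. *)
Definition basis (k : int) : R -> R[i] := wave (- k%:~R).

Lemma L2on_basis k : L2on I (basis k).
Proof. exact: L2on_wave. Qed.

Lemma basis_orth k l : ip I (basis k) (basis l) = (if k == l then 1 else 0)%:C.
Proof.
have := wave_orth 0 half0 (- k) (- l); rewrite two_half !divr1 !add0r eqr_opp.
by rewrite !mulrNz.
Qed.

Lemma ip_basis phi (k : int) : ip I phi (basis k) = ft 2^-1 phi k%:~R.
Proof. by rewrite ft_ip. Qed.

Lemma coef_basis phi (k : int) : coef I basis 1 phi k = ft 2^-1 phi k%:~R.
Proof. by rewrite /coef invr1 mul1r ip_basis. Qed.

Lemma basis_complete f : L2on I f -> (forall k, ip I f (basis k) = 0) -> sq2 I f = 0.
Proof.
move=> lf f0; apply: trigonometric_complete => // k.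
by rewrite two_half divr1 -[RHS](f0 (- k)) /basis mulrNz opprK.
Qed.

Lemma sq2_wave y : sq2 I (wave y) = 1.
Proof.
rewrite /sq2 (@Rint_eq _ _ _ (cst 1)); last first.
  by move=> t _; rewrite cabs_wave expr1n.
by rewrite Rintegral_cst// mul1r; have := mu_symitv (ltW half0); rewrite two_half.
Qed.

(** A point value is an inner product with a wave, whose norm is one on an
    interval of length one. *)
Lemma cabs_ft_le phi x : L2on I phi -> cabs (ft 2^-1 phi x) <= nrm2 I phi.
Proof.
move=> lphi; rewrite ft_ip.
apply: (le_trans (CauchySchwarz_nrm2 mI lphi (L2on_wave _ _))).
by rewrite [nrm2 I (wave _)]/nrm2 sq2_wave sqrtr1 mulr1.
Qed.

Lemma ftB phi psi x : L2on I phi -> L2on I psi ->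
  ft 2^-1 (fun t => phi t - psi t) x = ft 2^-1 phi x - ft 2^-1 psi x.
Proof. by move=> l1 l2; rewrite !ft_ip ipBl//; exact: L2on_wave. Qed.

Lemma ft_sum (T : eqType) (s : seq T) (b : T -> R[i]) (F : T -> R -> R[i]) x :
  (forall i, i \in s -> L2on I (F i)) ->
  ft 2^-1 (fun t => \sum_(i <- s) b i * F i t) x = \sum_(i <- s) b i * ft 2^-1 (F i) x.
Proof.
move=> lF; rewrite ft_ip ip_sumul//; last first.
- exact: L2on_wave.
- by move=> i /lF li; exact: L2onZ.
rewrite big_seq [RHS]big_seq; apply: eq_bigr => i /lF li.
by rewrite ipZl// ?ft_ip//; exact: L2on_wave.
Qed.

Lemma ft_wave (x y : R) : ft 2^-1 (wave y) x = (sinc_pi (x + y))%:C.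
Proof.
rewrite ft_ip ip_wave opprK addrC cintegral_wave ?(ltW half0)// /sinc_pi.
have e : 2 * pi * 2^-1 = pi :> R by rewrite mulrAC two_half mul1r.
by rewrite two_half e.
Qed.

Lemma ft_span s b x :
  ft 2^-1 (span basis s b) x = \sum_(m <- s) b m * (sinc_pi (x - m%:~R))%:C.
Proof.
rewrite /span ft_sum; last by move=> i _; exact: L2on_basis.
by apply: eq_bigr => m _; rewrite ft_wave.
Qed.

Lemma sinD_pi_int (k : int) (x : R) :
  sin (pi * (k%:~R + x)) = cos (pi * k%:~R) * sin (pi * x).
Proof. by rewrite mulrDr sinD sin_pi_int mul0r add0r. Qed.

Lemma sinc_pi_int (k : int) : sinc_pi (k%:~R : R) = (k == 0)%:R.
Proof.
rewrite /sinc_pi intr_eq0; case: ifP => //= _.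
by rewrite sin_pi_int mul0r.
Qed.

(** The matrix of the Hilbert transform, twisted by signs. *)
Definition alt_inv (k : int) : R :=
  if k == 0 then 0 else cos (pi * k%:~R) / (pi * k%:~R).

(** The alternating reciprocals are, up to a constant factor, the Fourier
    coefficients of the function t on the frequency interval. *)
Lemma ip_sawtooth_wave (k : int) :
  ip I (fun t => (sawtooth 2^-1 (- 2^-1) t)%:C) (wave k%:~R) =
  'i * (alt_inv k / 2)%:C.
Proof.
have aA : - 2^-1 <= (- 2^-1 : R) <= 2^-1.
  by rewrite lexx /= lerNl (le_trans _ (ltW half0))// oppr_le0 ltW.
rewrite /alt_inv; have [->|k0] := eqVneq k 0.
  rewrite mul0r mulr0; apply: eqC; rewrite ?Re_cintegral ?Im_cintegral.
    rewrite (@Rint_eq _ _ _ (fun t => 1 * sawtooth 2^-1 (- 2^-1) t)); last first.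
      by move=> t _; rewrite !ReImE /wave mulr0 expi0 /=; ring.
    have dG (x : R) : is_derive x 1 (fun t : R => t ^+ 2 / 2) (1 * (x + (- - 2^-1 - 2^-1))).
      by apply: is_derive_eq; rewrite /GRing.scale /=; field.
    have dF (x : R) : is_derive x 1 (fun t : R => t) 1 by exact: is_derive_id.
    rewrite (Rintegral_sawtooth half0 aA dG dF); last exact: cst_continuous.
    by rewrite sqrrN /=; ring.
  rewrite (@Rint_eq _ _ _ (cst 0)); last first.
    by move=> t _; rewrite !ReImE /wave mulr0 expi0 /=; ring.
  by rewrite Rintegral_cst// mul0r.
have := ip_sawtooth half0 aA k0; rewrite two_half divr1 => -> /=.
have -> : pi * k%:~R / 2^-1 * (- 2^-1) = - (pi * k%:~R) :> R by field.
rewrite sinN cosN sin_pi_int oppr0 mul0r mulr0 mul1r.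
have kR : k%:~R != 0 :> R by rewrite intr_eq0.
apply: eqC; rewrite !ReImE /=; first by ring.
have p0 := pi_gt0 R; move: (cos _) => c; move: (pi : R) p0 => p p0.
by field; rewrite kR gt_eqF.
Qed.

Lemma alt_invN k : alt_inv (- k) = - alt_inv k.
Proof.
rewrite /alt_inv oppr_eq0; case: ifP => _; first by rewrite oppr0.
by rewrite mulrNz mulrN cosN invrN mulrN.
Qed.

(** What is left of the change of the cardinal sine from k to k + x once the
    diagonal part and the part in 1 / k, a multiple of alt_inv, are removed. *)
Definition sinc_rest (k : int) (x : R) : R :=
  (k == 0)%:R - sinc_pi (k%:~R + x)
  - ((k == 0)%:R * (1 - sinc_pi x) - sin (pi * x) * alt_inv k).

(** For k != 0 the remainder is, up to sign, sin (pi x) / pi times x / (k (k + x)),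
    and |k + x| >= |k| (1 - L) because |k| >= 1. *)
Lemma sinc_rest_le (k : int) (x L : R) : `|x| <= L -> L < 2^-1 ->
  `|sinc_rest k x| <= sin (pi * L) / pi * (L / (1 - L)) * inv_sq k.
Proof.
move=> xL L2; have p0 := pi_gt0 R.
have L0 : 0 <= L := le_trans (normr_ge0 _) xL.
have L1 : 0 < 1 - L by lra.
rewrite /sinc_rest /alt_inv /inv_sq; have [->|k0] := eqVneq k 0.
  by rewrite add0r !mulr0 subr0 mul1r subrr normr0.
have kR : k%:~R != 0 :> R by rewrite intr_eq0.
have k1 : 1 <= `|k%:~R| :> R.
  by rewrite -intr_norm ler1z; lia.
have kx : `|k%:~R| * (1 - L) <= `|k%:~R + x|.
  have := lerB_normD (k%:~R : R) x; nra.
have kx0 : 0 < `|k%:~R + x| by apply: lt_le_trans kx; rewrite mulr_gt0// (lt_le_trans _ k1).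
have kxn : k%:~R + x != 0 by rewrite -normr_gt0.
have xn : (k%:~R + x == 0) = false by apply/negbTE.
rewrite /sinc_pi xn sinD_pi_int mul0r !sub0r opprK.
have c2 : `|cos (pi * k%:~R)| = 1 :> R.
  apply/eqP; rewrite -(@eqrXn2 _ 2)// expr1n.
  by rewrite real_normK ?num_real// cos_pi_int_sq.
rewrite (_ : - _ + _ = cos (pi * k%:~R) * sin (pi * x) / pi *
    (x / (k%:~R * (k%:~R + x)))); last first.
  move: (cos _) (sin _) => c d; move: (pi : R) p0 => p p0.
  by field; rewrite kxn kR gt_eqF.
rewrite !normrM !normfV !normrM c2 mul1r (gtr0_norm p0).
have sL := abs_sin_pi_le xL (ltW L2).
have s0 := normr_ge0 (sin (pi * x)).
rewrite -!mulrA; apply: ler_pM => //.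
  by apply: mulr_ge0; first by rewrite invr_ge0 ltW.
rewrite ler_pM2l ?invr_gt0//; apply: ler_pM => //.
have kp : 0 < `|k%:~R| :> R by exact: lt_le_trans k1.
have k2 : 0 < k%:~R ^+ 2 :> R by rewrite lt_def sqrf_eq0 kR sqr_ge0.
have d1 := mulr_gt0 L1 k2; have d2 := mulr_gt0 kp kx0.
rewrite -invfM lef_pV2 ?posrE//.
rewrite -(real_normK (num_real (k%:~R : R))) expr2 mulrCA.
by rewrite ler_pM2l// mulrC.
Qed.

Section finite.
Variables (s F : seq int) (b : int -> R[i]) (eps : int -> R) (L : R).
Hypotheses (us : uniq s) (uF : uniq F).
Hypotheses (L0 : 0 <= L) (L2 : L < 2^-1) (epsL : forall k, `|eps k| <= L).

Let S : R := sumsq s b.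

Let S0 : 0 <= S. Proof. exact: sumsq_ge0. Qed.

Let hilbert n : R[i] := \sum_(m <- s) b m * (alt_inv (n - m))%:C.

(** Up to a factor 2i, the values hilbert n are Fourier coefficients of t times the trigonometric
    polynomial with coefficients b, and |t| <= 1/2: this is Hilbert's inequality
    with its sharp constant. *)
Let hilbert_le : \sum_(n <- F) cabs (hilbert n) ^+ 2 <= S.
Proof.
pose saw t : R[i] := (sawtooth 2^-1 (- 2^-1) t)%:C.
pose psi t := span basis s b t * saw t.
have aA : - 2^-1 <= (- 2^-1 : R) <= 2^-1.
  by rewrite lexx /= lerNl (le_trans _ (ltW half0))// oppr_le0 ltW.
have [ms1 ms2] := @measurable_csawtooth R 2^-1 (- 2^-1).
have sawI t : I t -> cabs (saw t) <= 2^-1.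
  move=> It; have tI : - 2^-1 <= t <= 2^-1 by move: It; rewrite /symitv /= in_itv.
  rewrite /saw cabsC /sawtooth indicE memNset.
    by rewrite mulr0 addr0 opprK subrr addr0 ler_norml.
  by rewrite /= in_itv /= => h; move: tI; rewrite leNgt h.
have lsp := L2on_span mI L2on_basis s b.
have lpsi : L2on I psi by apply: (L2on_mul_bounded mI lsp ms1 ms2 sawI).
have sqpsi : sq2 I psi <= 4^-1 * S.
  have <- : sq2 I (span basis s b) = S.
    by rewrite (sq2_span mI L2on_basis basis_orth)// mul1r.
  have [_ _ i1] := lpsi; have [_ _ i2] := lsp.
  rewrite /sq2 -RintegralZl//; apply: le_Rintegral => //.
    by apply: (eq_integrable mI _ _ _ (integrableZl mI 4^-1 i2)) => t _ /=; rewrite EFinM.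
  move=> t It; rewrite /psi cabsM exprMn mulrC ler_wpM2r ?sqr_ge0//.
  have := sawI t It; have := cabs_ge0 (saw t); nra.
have ipsi n : ip I psi (basis n) = - ('i / 2) * hilbert n.
  rewrite /hilbert mulr_sumr.
  transitivity (ip I (fun t => \sum_(m <- s) b m * (basis m t * saw t)) (basis n)).
    apply: ip_eq => // t _; rewrite /psi /span mulr_suml.
    by apply: eq_bigr => m _; rewrite mulrA.
  have lbs m : L2on I (fun t => basis m t * saw t).
    by apply: (L2on_mul_bounded mI (L2on_basis m) ms1 ms2 sawI).
  rewrite ip_sumul//; last 2 first.
  - by move=> m _; exact: L2onZ.
  - exact: L2on_basis.
  apply: eq_bigr => m _; rewrite ipZl//; last exact: L2on_basis.
  have -> : ip I (fun t => basis m t * saw t) (basis n) = ip I saw (wave (m - n)%:~R).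
    apply: cintegral_eq => t _; rewrite /basis -!waveN opprK mulrAC mulrC -waveD.
    by rewrite rmorphB opprB addrC.
  rewrite ip_sawtooth_wave -opprB alt_invN.
  move: (alt_inv _) => c.
  have -> : (- c / 2)%:C = - (c%:C / 2) :> R[i].
    by rewrite mulNr rmorphN rmorphM fmorphV rmorph_nat.
  by ring.
have H := bessel mI ltr01 L2on_basis basis_orth uF lpsi.
rewrite mul1r in H.
have -> : \sum_(n <- F) cabs (hilbert n) ^+ 2 =
    4 * \sum_(n <- F) cabs (ip I psi (basis n)) ^+ 2.
  rewrite mulr_sumr; apply: eq_bigr => n _; rewrite ipsi.
  rewrite mulNr cabsN -mulrA cabsM exprMn cabsM exprMn.
  have -> : cabs ('i : R[i]) = 1 by rewrite /= expr0n expr1n add0r sqrtr1.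
  have -> : cabs (2^-1 : R[i]) = 2^-1.
    by rewrite ComplexField.Normc.normcV -(rmorph_nat (real_complex R) 2) cabsC ger0_norm.
  by rewrite expr1n mul1r mulrA; field.
lra.
Qed.

Let kappa : R := sin (pi * L) / pi * (L / (1 - L)).

Let sinL0 : 0 <= sin (pi * L).
Proof. exact: le_trans (normr_ge0 _) (abs_sin_pi_le (epsL 0) (ltW L2)). Qed.

Let kappa0 : 0 <= kappa.
Proof.
have L1 : 0 <= 1 - L by move: L2; lra.
have p0 := pi_ge0 R.
by rewrite /kappa mulr_ge0// divr_ge0.
Qed.

(** The sum of the bounds for the norms of the diagonal part, the part in 1 / k
    and the remaining part of the change of the cardinal sine. *)
Definition perturbation_bound : R :=
  1 - sinc_pi L + pi / 3 * (L * sin (pi * L) / (1 - L)) + sin (pi * L).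

(** The diagonal part has entries at most 1 - sinc_pi L. The part in 1 / k is
    sin (pi eps n) times the twisted Hilbert matrix, of norm at most one. Schur's test bounds the
    remaining part. *)
Lemma perturbation_finite :
  \sum_(n <- F) cabs (ft 2^-1 (span basis s b) n%:~R -
                      ft 2^-1 (span basis s b) (n%:~R + eps n)) ^+ 2 <=
  perturbation_bound ^+ 2 * S.
Proof.
have L1 : L <= 1 by move: L2; lra.
have p0 := pi_gt0 R.
pose P n : R[i] := \sum_(m <- s) b m * ((m == n)%:R * (1 - sinc_pi (eps n)))%:C.
pose Q n : R[i] := \sum_(m <- s) b m * (sinc_rest (n - m) (eps n))%:C.
have E n : ft 2^-1 (span basis s b) n%:~R -
    ft 2^-1 (span basis s b) (n%:~R + eps n) =
    (P n + - (sin (pi * eps n))%:C * hilbert n) + Q n.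
  rewrite !ft_span /P /Q /hilbert mulr_sumr -sumrB -!big_split /=.
  apply: eq_bigr => m _; rewrite -mulrBr.
  have e1 : n%:~R - m%:~R = (n - m)%:~R :> R by rewrite rmorphB.
  have e2 : n%:~R + eps n - m%:~R = (n - m)%:~R + eps n by rewrite -e1; ring.
  rewrite e1 e2 sinc_pi_int [- _ * _]mulNr mulrCA -[- (b m * _)]mulrN -!mulrDr.
  congr (_ * _); rewrite /sinc_rest subr_eq0 [n == m]eq_sym.
  by apply: eqC; rewrite !ReImE /=; ring.
under eq_bigr do rewrite E.
have sS : 0 <= Num.sqrt S by exact: sqrtr_ge0.
have SS : Num.sqrt S ^+ 2 = S by rewrite sqr_sqrtr.
have s1 : 0 <= 1 - sinc_pi L.
  by apply: le_trans (one_sub_sinc_le (epsL 0) L1).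
have hP : \sum_(n <- F) cabs (P n) ^+ 2 <= ((1 - sinc_pi L) * Num.sqrt S) ^+ 2.
  have PE n : P n = if n \in s then b n * (1 - sinc_pi (eps n))%:C else 0.
    rewrite /P; case: ifPn => ns.
      rewrite (bigD1_seq n)//= eqxx mul1r big1 ?addr0// => m /negbTE ->.
      by rewrite mul0r mulr0.
    rewrite big_seq big1// => m ms; case: eqP => [mn|_]; last by rewrite mul0r mulr0.
    by rewrite -mn ms in ns.
  rewrite exprMn SS.
  apply: (@le_trans _ _ (\sum_(n <- F | n \in s) (1 - sinc_pi L) ^+ 2 * cabs (b n) ^+ 2)).
    rewrite [leRHS]big_mkcond /=; apply: ler_sum => n _; rewrite PE.
    case: ifP => _; last by rewrite cabs0 expr0n.
    rewrite cabsM exprMn mulrC ler_wpM2r ?sqr_ge0// cabsC.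
    by rewrite lerXn2r ?nnegrE// one_sub_sinc_le.
  rewrite -mulr_sumr ler_wpM2l ?sqr_ge0// -big_filter /S /sumsq.
  apply: ler_sum_subset; rewrite ?filter_uniq//.
    by move=> k; rewrite mem_filter => /andP[].
  by move=> k; exact: sqr_ge0.
have hH : \sum_(n <- F) cabs (- (sin (pi * eps n))%:C * hilbert n) ^+ 2 <=
    (sin (pi * L) * Num.sqrt S) ^+ 2.
  rewrite exprMn SS; apply: (@le_trans _ _
      (\sum_(n <- F) sin (pi * L) ^+ 2 * cabs (hilbert n) ^+ 2)); last first.
    by rewrite -mulr_sumr ler_wpM2l ?sqr_ge0.
  apply: ler_sum => n _; rewrite cabsM cabsN cabsC exprMn ler_wpM2r ?sqr_ge0//.
  by rewrite lerXn2r ?nnegrE// abs_sin_pi_le// ltW.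
have hQ : \sum_(n <- F) cabs (Q n) ^+ 2 <= (kappa * (pi ^+ 2 / 3) * Num.sqrt S) ^+ 2.
  rewrite exprMn SS exprMn -mulrA.
  apply: (@le_trans _ _ (kappa ^+ 2 *
      \sum_(n <- F) (\sum_(m <- s) inv_sq (n - m) * cabs (b m)) ^+ 2)); last first.
    by apply: ler_wpM2l; [exact: sqr_ge0|exact: schur_inv_sq].
  rewrite mulr_sumr; apply: ler_sum => n _; rewrite -exprMn.
  have k0 : 0 <= kappa * \sum_(m <- s) inv_sq (n - m) * cabs (b m).
    apply: mulr_ge0 => //; apply: sumr_ge0 => m _.
    by apply: mulr_ge0; [exact: inv_sq_ge0|exact: cabs_ge0].
  rewrite lerXn2r ?nnegrE ?cabs_ge0//.
  have cabs_sum (r : seq int) (G : int -> R[i]) :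
      cabs (\sum_(m <- r) G m) <= \sum_(m <- r) cabs (G m).
    elim: r => [|m r IH]; first by rewrite !big_nil cabs0.
    by rewrite !big_cons (le_trans (cabsD _ _))// lerD2l.
  apply: (le_trans (cabs_sum _ _)); rewrite mulr_sumr; apply: ler_sum => m _.
  rewrite cabsM cabsC mulrC mulrA ler_wpM2r ?cabs_ge0//.
  exact: sinc_rest_le.
have nPH := sum_sqD_le (mulr_ge0 s1 sS) (mulr_ge0 sinL0 sS) hP hH.
have kW0 : 0 <= kappa * (pi ^+ 2 / 3) * Num.sqrt S.
  apply: mulr_ge0 => //; apply: mulr_ge0 => //.
  by rewrite divr_ge0 ?sqr_ge0.
have := sum_sqD_le (addr_ge0 (mulr_ge0 s1 sS) (mulr_ge0 sinL0 sS)) kW0 nPH hQ.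
rewrite (_ : _ + _ = perturbation_bound * Num.sqrt S) ?exprMn ?SS//.
have d1 : 1 - L != 0 by apply/negP => /eqP h; move: L2; lra.
rewrite /perturbation_bound /kappa.
move: (sin _) (sinc_pi L) (Num.sqrt S) => a c d; move: (pi : R) p0 => p pp.
by field; rewrite d1 gt_eqF.
Qed.

End finite.

End perturbation.

(** * Frame bounds and the dual system *)

Section sampling.
Context {R : realType}.
Local Notation mu := (@lebesgue_measure R).
Local Notation I := (symitv (2^-1 : R)).
Local Notation pw := (ft 2^-1).

Let mI := measurable_symitv (2^-1 : R).
Let half0 : 0 < 2^-1 :> R. Proof. by rewrite invr_gt0. Qed.

Lemma sqr_le_of_geometric (X c K r : R) : 0 <= r < 1 ->
  (forall j, X <= (K * r ^+ j + c) ^+ 2) -> X <= c ^+ 2.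
Proof.
move=> /andP[r0 r1] H.
have h : K * r ^+ j + c @[j --> \oo] --> c.
  rewrite -[X in _ --> X]add0r; apply: cvgD; last exact: cvg_cst.
  rewrite -[X in _ --> X](mulr0 K); apply: cvgMr.
  by apply: cvg_expr; rewrite ger0_norm.
have h2 : (K * r ^+ j + c) ^+ 2 @[j --> \oo] --> c ^+ 2.
  by apply: (@cvg_comp _ _ _ _ (fun y : R => y ^+ 2) _ _ _ h); exact: exprn_continuous.
exact: (ler_cvg_to (cvg_cst X) h2 (nearW _ H)).
Qed.

(** At the integers, Bessel's inequality and Parseval's identity compare the
    values of a transform with its norm. *)
Lemma bessel_int phi s : uniq s -> L2on I phi ->
  \sum_(k <- s) cabs (pw phi k%:~R) ^+ 2 <= sq2 I phi.
Proof.
move=> us lphi; have := bessel mI ltr01 (@L2on_basis R) basis_orth us lphi.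
by rewrite mul1r; under eq_bigr do rewrite ip_basis.
Qed.

Lemma parseval_int_le phi (D : R) : L2on I phi -> 0 <= D ->
  (forall s, uniq s -> \sum_(k <- s) cabs (pw phi k%:~R) ^+ 2 <= D ^+ 2) ->
  nrm2 I phi <= D.
Proof.
move=> lphi D0 H; apply: nrm2_le => //.
rewrite leNgt; apply/negP => h; have d0 : 0 < sq2 I phi - D ^+ 2 by rewrite subr_gt0.
have [s [us]] := parseval_ft half0 lphi 0 d0.
rewrite divff// mul1r.
rewrite (eq_bigr (fun k => cabs (pw phi k%:~R) ^+ 2)); last first.
  by move=> k _; rewrite add0r divr1.
by have := H s us; lra.
Qed.

Lemma big_const_seq_size (T : Type) (s : seq T) :
  \sum_(k <- s) 1 = (size s)%:R :> R.
Proof. by rewrite big_const_seq count_predT iter_addr_0. Qed.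

Variables (L : R) (eps : int -> R).
Hypotheses (L2 : L < 2^-1) (epsL : forall k, `|eps k| <= L).
Local Notation delta := (perturbation_bound L).
Hypothesis delta1 : delta < 1.

Let L0 : 0 <= L. Proof. exact: le_trans (normr_ge0 _) (epsL 0). Qed.

Lemma perturbation_bound_ge0 : 0 <= delta.
Proof.
have L1 : L <= 1 by move: L2; lra.
have s1 := le_trans (normr_ge0 _) (one_sub_sinc_le (epsL 0) L1).
have s2 := le_trans (normr_ge0 _) (abs_sin_pi_le (epsL 0) (ltW L2)).
rewrite /perturbation_bound addr_ge0// addr_ge0//.
apply: mulr_ge0; first by rewrite divr_ge0 ?pi_ge0.
by rewrite divr_ge0 ?mulr_ge0// subr_ge0.
Qed.

Let d0 := perturbation_bound_ge0.
Let d1 : 0 < 1 - delta. Proof. by rewrite subr_gt0. Qed.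

Local Notation sample phi n := (pw phi (n%:~R + eps n)).

(** The estimate for trigonometric polynomials extends by density. *)
Lemma perturbation phi F : uniq F -> L2on I phi ->
  \sum_(n <- F) cabs (pw phi n%:~R - sample phi n) ^+ 2 <= (delta * nrm2 I phi) ^+ 2.
Proof.
move=> uF lphi.
have [s_ [us hs]] := parseval_span mI (symitv_lty _) ltr01 (@L2on_basis R) basis_orth
  (@basis_complete R) lphi.
apply: (@sqr_le_of_geometric _ _ (Num.sqrt (size F)%:R * (2 * 4)) 2^-1).
  by rewrite invr_ge0 ler0n invf_lt1// ltr1n.
move=> j; set p := span (basis (R := R)) (s_ j) (coef I (basis (R := R)) 1 phi).
have lp : L2on I p by exact: (L2on_span mI (@L2on_basis R)).
have hp : nrm2 I (fun t => phi t - p t) <= 4 * 2^-1 ^+ j.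
  by apply: le_trans (hs j) _; rewrite sqrtr1 mulr1.
have lq := L2onB mI lphi lp.
have e n : pw phi n%:~R - sample phi n =
    (pw (fun t => phi t - p t) n%:~R - sample (fun t => phi t - p t) n) +
    (pw p n%:~R - sample p n).
  by rewrite !ftB//; ring.
under eq_bigr do rewrite e.
apply: sum_sqD_le.
- by rewrite !mulr_ge0 ?sqrtr_ge0 ?exprn_ge0.
- by rewrite mulr_ge0 ?nrm2_ge0.
- rewrite -mulrA exprMn sqr_sqrtr ?ler0n//.
  rewrite -[X in X * _](big_const_seq_size F) mulr_suml.
  apply: ler_sum => n _; rewrite mul1r lerXn2r ?nnegrE ?cabs_ge0 ?mulr_ge0 ?exprn_ge0//.
  apply: (le_trans (cabsD _ _)); rewrite cabsN.
  have h1 := cabs_ft_le n%:~R lq; have h2 := cabs_ft_le (n%:~R + eps n) lq.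
  by lra.
- rewrite exprMn; apply: (le_trans (perturbation_finite _ (us j) uF L0 L2 epsL)).
  rewrite ler_wpM2l ?sqr_ge0// nrm2K /sumsq.
  by under eq_bigr do rewrite coef_basis; exact: bessel_int.
Qed.

Lemma sample_upper phi F : uniq F -> L2on I phi ->
  \sum_(n <- F) cabs (sample phi n) ^+ 2 <= ((1 + delta) * nrm2 I phi) ^+ 2.
Proof.
move=> uF lphi; rewrite mulrDl mul1r.
rewrite (eq_bigr (fun n : int => cabs (pw phi n%:~R + (sample phi n - pw phi n%:~R)) ^+ 2)); last first.
  by move=> n _; congr (cabs _ ^+ 2); ring.
apply: sum_sqD_le.
- exact: nrm2_ge0.
- by rewrite mulr_ge0 ?nrm2_ge0.
- by rewrite nrm2K; exact: bessel_int.
- by under eq_bigr do rewrite cabsB; exact: perturbation.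
Qed.

(** Since the perturbation is a contraction, the samples control the integer
    values, hence the norm. *)
Lemma sample_lower phi (D : R) : L2on I phi -> 0 <= D ->
  (forall F, uniq F -> \sum_(n <- F) cabs (sample phi n) ^+ 2 <= D ^+ 2) ->
  nrm2 I phi <= D / (1 - delta).
Proof.
move=> lphi D0 H.
have h : nrm2 I phi <= D + delta * nrm2 I phi.
  apply: parseval_int_le => //; first by rewrite addr_ge0 ?mulr_ge0 ?nrm2_ge0.
  move=> s us.
  rewrite (eq_bigr (fun n : int => cabs (sample phi n + (pw phi n%:~R - sample phi n)) ^+ 2)); last first.
    by move=> n _; congr (cabs _ ^+ 2); ring.
  apply: sum_sqD_le => //; first by rewrite mulr_ge0 ?nrm2_ge0.
  - exact: H.
  - exact: perturbation.
by rewrite ler_pdivlMr//; lra.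
Qed.

(** Riesz-Fischer realises the perturbation I - A of the sampling operator A as
    a contraction of L2. *)
Lemma perturbation_operator phi : exists psi, L2on I phi ->
  [/\ L2on I psi, forall k : int, pw psi k%:~R = pw phi k%:~R - sample phi k &
      nrm2 I psi <= delta * nrm2 I phi].
Proof.
have [lphi|n] := pselect (L2on I phi); last by exists phi.
have [s us|psi [s_ [lpsi _ ippsi _]]] := riesz_fischer mI (symitv_lty _) ltr01 (@L2on_basis R)
    basis_orth (b := fun k => pw phi k%:~R - sample phi k) (M := (delta * nrm2 I phi) ^+ 2).
  exact: perturbation.
have E (k : int) : pw psi k%:~R = pw phi k%:~R - sample phi k.
  by rewrite -ip_basis ippsi mul1r.
exists psi => _; split => //.
apply: parseval_int_le => //; first by rewrite mulr_ge0 ?nrm2_ge0.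
by move=> s us; under eq_bigr do rewrite E; exact: perturbation.
Qed.

(** The Neumann series of the inverse of A, applied to a basis vector. *)
Lemma dual_function n : exists psi, L2on I psi /\
  forall k, sample psi k = (k == n)%:R.
Proof.
have [T TP] := choice perturbation_operator.
pose f j := iter j T (basis n).
have f_ j : L2on I (f j) /\ nrm2 I (f j) <= delta ^+ j.
  elim: j => [|j [lf nf]].
    split; first exact: L2on_basis.
    by rewrite /f /= /nrm2 /basis sq2_wave sqrtr1.
  have [lT _ nT] := TP _ lf; split => //.
  by apply: (le_trans nT); rewrite exprS ler_wpM2l.
have lf j := (f_ j).1; have nf j := (f_ j).2.
have sf j (k : int) : pw (f j.+1) k%:~R = pw (f j) k%:~R - sample (f j) k.
  by have [_ + _] := TP _ (lf j); apply.
pose r := (1 + delta) / 2.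
have [r0 r1] : 0 < r /\ r < 1 by rewrite /r; move: d0 d1; split; lra.
have dr : delta <= r by rewrite /r; move: d1; lra.
have dj j : delta ^+ j <= r ^+ j by rewrite lerXn2r ?nnegrE// ltW.
pose p K t := \sum_(j <- iota 0 K) f j t.
have lp K : L2on I (p K) by apply: L2on_sum.
have pS K t : p K.+1 t = p K t + f K t.
  by rewrite /p -addn1 iotaD big_cat big_seq1 add0n.
have [||||psi [lpsi hpsi]] := @L2_complete _ I p 1 r mI (symitv_lty _).
- exact: ler01.
- by rewrite r0 r1.
- exact: lp.
- move=> K; rewrite mul1r; apply: le_trans (dj K).
  rewrite (_ : nrm2 I _ = nrm2 I (f K))//.
  by congr Num.sqrt; apply: sq2_eq => t _; rewrite pS addrAC subrr add0r.
have pwp K x : pw (p K) x = \sum_(j <- iota 0 K) pw (f j) x.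
  have := @ft_sum _ _ (iota 0 K) (fun=> 1) f x (fun j _ => lf j).
  under eq_bigr do rewrite mul1r; move=> <-.
  by apply: cintegral_eq => t _; congr (_ * _); apply: eq_bigr => j _; rewrite mul1r.
have sp K k : sample (p K) k = (k == n)%:R - pw (f K) k%:~R.
  rewrite pwp; elim: K => [|K IH].
    rewrite big_nil /f /= /basis ft_wave -rmorphB sinc_pi_int subr_eq0.
    by case: (k == n); rewrite subrr.
  rewrite -addn1 iotaD big_cat big_seq1 add0n IH addn1 sf -[LHS]/(_ + _).
  by ring.
exists psi; split => // k; apply/eqP; rewrite -subr_eq0; apply/eqP/cabs_eq0/eqP.
rewrite -sqrf_eq0 eq_le sqr_ge0 andbT -[X in _ <= X](expr0n _ 2).
apply: (@sqr_le_of_geometric _ _ (1 / (1 - r) + 1) r); first by rewrite (ltW r0).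
move=> K; rewrite addr0 lerXn2r ?nnegrE ?cabs_ge0//.
  by rewrite mulr_ge0 ?exprn_ge0 ?(ltW r0)// addr_ge0// divr_ge0// ltW// subr_gt0.
have -> : sample psi k - (k == n)%:R =
    sample (fun t => psi t - p K t) k - pw (f K) k%:~R.
  by rewrite ftB// sp; ring.
apply: (le_trans (cabsD _ _)); rewrite cabsN.
have -> : (1 / (1 - r) + 1) * r ^+ K = 1 / (1 - r) * r ^+ K + r ^+ K by ring.
apply: lerD.
  exact: le_trans (cabs_ft_le _ (L2onB mI lpsi (lp K))) (hpsi K).
apply: (le_trans (cabs_ft_le _ (lf K))); exact: le_trans (nf K) (dj K).
Qed.

Section reconstruction.
Variable Phi : int -> R -> R[i].
Hypothesis lPhi : forall n, L2on I (Phi n).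
Hypothesis sPhi : forall n k, sample (Phi n) k = (k == n)%:R.

Lemma sample_comb s (b : int -> R[i]) k : uniq s ->
  sample (fun t => \sum_(n <- s) b n * Phi n t) k = if k \in s then b k else 0.
Proof.
move=> us; rewrite ft_sum//; under eq_bigr do rewrite sPhi.
case: ifPn => ks.
  rewrite (bigD1_seq k)//= eqxx mulr1 big1 ?addr0// => m /negbTE.
  by rewrite eq_sym => ->; rewrite mulr0.
rewrite big_seq big1// => m ms; case: eqP => [mn|_]; last by rewrite mulr0.
by rewrite mn ms in ks.
Qed.

Let lcomb s (b : int -> R[i]) : L2on I (fun t => \sum_(n <- s) b n * Phi n t).
Proof. by apply: L2on_sum => // n _; exact: L2onZ. Qed.

(** Choosing the phases of the coefficients turns a bound on the combinations of
    the dual functions into absolute convergence. *)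
Lemma reconstruction_abs phi x F : L2on I phi -> uniq F ->
  \sum_(n <- F) cabs (sample phi n * pw (Phi n) x) <=
    (1 + delta) * nrm2 I phi / (1 - delta).
Proof.
move=> lphi uF.
pose b n : R[i] := (cabs (sample phi n) / cabs (pw (Phi n) x))%:C * conjc (pw (Phi n) x).
have bE n : b n * pw (Phi n) x = (cabs (sample phi n * pw (Phi n) x))%:C.
  rewrite /b -mulrA [conjc _ * _]mulrC mulcJ -rmorphM cabsM; congr (real_complex R _).
  have [->|z] := eqVneq (cabs (pw (Phi n) x)) 0; first by rewrite expr0n !mulr0.
  by rewrite expr2 mulrA divfK.
have bl n : cabs (b n) <= cabs (sample phi n).
  rewrite /b cabsM cabsC cabsJ normrM normfV !ger0_norm ?cabs_ge0//.
  have [->|z] := eqVneq (cabs (pw (Phi n) x)) 0; first by rewrite mulr0 cabs_ge0.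
  by rewrite divfK.
have D0 : 0 <= (1 + delta) * nrm2 I phi by apply: mulr_ge0; [exact: addr_ge0 | exact: nrm2_ge0].
have H := @sample_lower (fun t => \sum_(n <- F) b n * Phi n t) _ (lcomb F b) D0.
have -> : \sum_(n <- F) cabs (sample phi n * pw (Phi n) x) =
    complex.Re (pw (fun t => \sum_(n <- F) b n * Phi n t) x).
  rewrite ft_sum//; under [in RHS]eq_bigr do rewrite bE.
  by rewrite -(rmorph_sum (real_complex R)).
apply: (le_trans (ler_norm _)); apply: (le_trans (Re_le_cabs _)).
apply: (le_trans (cabs_ft_le _ (lcomb F b))); apply: H => G uG.
apply: (le_trans _ (sample_upper uG lphi)).
apply: ler_sum => k _; rewrite sample_comb//; case: ifP => _.
  by rewrite lerXn2r ?nnegrE ?cabs_ge0.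
by rewrite cabs0 expr0n sqr_ge0.
Qed.

(** What is left after subtracting a finite part of the expansion has the samples
    outside that part, and is therefore small. *)
Lemma reconstruction_lim phi x (e : R) : L2on I phi -> 0 < e ->
  exists s0 : seq int, forall s, uniq s -> {subset s0 <= s} ->
    cabs (pw phi x - \sum_(n <- s) sample phi n * pw (Phi n) x) <= e.
Proof.
move=> lphi e0.
pose a s : R := \sum_(n <- s) cabs (sample phi n) ^+ 2.
pose E := [set a s | s in [set s | uniq s]].
have supE : has_sup E.
  split; first by exists (a [::]), [::].
  by exists (((1 + delta) * nrm2 I phi) ^+ 2) => _ [s us <-]; exact: sample_upper.
have q0 : 0 < (e * (1 - delta)) ^+ 2 by rewrite exprn_gt0// mulr_gt0.
have [_ [s0 us0 <-] hs0] := sup_adherent q0 supE.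
exists s0 => s us s0s.
pose rest t := phi t - \sum_(n <- s) sample phi n * Phi n t.
have lrest : L2on I rest by apply: L2onB.
have <- : pw rest x = pw phi x - \sum_(n <- s) sample phi n * pw (Phi n) x.
  by rewrite /rest ftB// ft_sum.
apply: (le_trans (cabs_ft_le _ lrest)).
have ed : 0 <= e * (1 - delta) by rewrite mulr_ge0 ?(ltW e0) ?(ltW d1).
have := @sample_lower rest _ lrest ed.
rewrite mulfK ?gt_eqF//; apply => F uF.
have srest k : sample rest k = if k \in s then 0 else sample phi k.
  by rewrite /rest ftB// sample_comb//; case: ifP => _; rewrite ?subrr ?subr0.
apply: (@le_trans _ _ (a [seq k <- F | k \notin s])).
  rewrite /a big_filter [leRHS]big_mkcond; apply: ler_sum => k _.
  by rewrite srest; case: (k \in s) => //; rewrite cabs0 expr0n.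
have : a (s0 ++ [seq k <- F | k \notin s]) <= sup E.
  apply: ub_le_sup; first by case: supE.
  exists (s0 ++ [seq k <- F | k \notin s]) => //=.
  rewrite cat_uniq us0 filter_uniq// andbT /=.
  apply/hasPn => k; rewrite mem_filter => /andP[ks _].
  by apply: contra ks => /s0s.
have -> : a (s0 ++ [seq k <- F | k \notin s]) = a s0 + a [seq k <- F | k \notin s].
  by rewrite /a big_cat.
move: hs0; move: (sup E) (a _) ((e * (1 - delta)) ^+ 2) => S a0 q hs0; lra.
Qed.

End reconstruction.

End sampling.

(** * Sampling and reconstruction *)

Section esum_finite.
Context {R : realType}.

Lemma esum_le_finite (a : int -> R) (M : R) :
  (forall s, uniq s -> \sum_(n <- s) a n <= M) ->
  (\esum_(n in [set: int]) (a n)%:E <= M%:E)%E.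
Proof.
move=> H; apply: ge_ereal_sup => _ [X [finX _] <-].
by rewrite fsbig_finite// sumEFin lee_fin; apply: H; exact: fset_uniq.
Qed.

Lemma le_esum_finite (a : int -> R) s : uniq s ->
  ((\sum_(n <- s) a n)%:E <= \esum_(n in [set: int]) (a n)%:E)%E.
Proof.
move=> us; apply: esum_ge; exists [set` s]; first by split => //; exact: finite_seq.
by rewrite -fsbig_seq// sumEFin.
Qed.

End esum_finite.

Lemma abs_converges_toP (R : realType) (u : int -> R[i]) (v : R[i]) (M : R) :
  (forall s, uniq s -> \sum_(n <- s) cabs (u n) <= M) ->
  (forall e : R, 0 < e -> exists s0 : seq int, forall s, uniq s -> {subset s0 <= s} ->
     cabs (v - \sum_(n <- s) u n) <= e) ->
  abs_converges_to u v.
Proof.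
move=> uM uv; split; first exact: le_lt_trans (esum_le_finite uM) (ltry _).
have ? : Filter (@totally int) by have [] := @totally_filter int.
apply/(@cvgrPdist_le _ (R[i]^o)) => e e0.
have /andP[/eqP eim ere] : (complex.Im e == 0) && (0 < complex.Re e).
  by move: e0; case: (e) => a b; rewrite ltcE /= eq_sym.
have [s0 hs0] := uv _ ere.
exists [fset k in s0]%fset => //= A /fsubsetP sA.
have -> : partial_sum u A = \sum_(k <- enum_fset A) u k by rewrite /partial_sum big_seq_fsetE.
have -> : e = (complex.Re e)%:C by case: (e) eim => a b /= ->.
rewrite normCE lecR; apply: hs0; first exact: fset_uniq.
by move=> k ks; apply: sA; rewrite !inE.
Qed.

Theorem theorem1p1 (R : realType) (L : R)
  (L_lt : L < 2^-1)
  (L_cond : 1 - sinc_pi L + pi / 3 * (L * sin (pi * L) / (1 - L))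
              + sin (pi * L) < 1) :
  exists C : R, 0 < C /\
    forall eps : int -> R,
      ereal_sup [set `|eps k|%:E | k in [set: int]] = L%:E ->
      [/\ forall f1 f2 : R -> R[i], PWpi f1 -> PWpi f2 ->
            (forall n : int, f1 (n%:~R + eps n) = f2 (n%:~R + eps n)) ->
            forall x : R, f1 x = f2 x,
          forall f : R -> R[i], PWpi f ->
            (C^-1%:E * (\esum_(n in [set: int]) (cabs (f (n%:~R + eps n)) ^+ 2)%:E)
               <= L2norm f ^+ 2)%E /\
            (L2norm f ^+ 2
               <= C%:E * (\esum_(n in [set: int]) (cabs (f (n%:~R + eps n)) ^+ 2)%:E))%E &
          exists g : int -> R -> R[i],
            (forall n : int, PWpi (g n)) /\
            forall f : R -> R[i], PWpi f -> forall x : R,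
              abs_converges_to (fun n : int => f (n%:~R + eps n) * g n x) (f x)].
Proof.
have d1 : perturbation_bound L < 1 by [].
(* the samples of f have square sum between (1 - delta)^2 and (1 + delta)^2 times
   the squared norm of f, and (1 + delta)^2 <= 4 *)
pose C : R := 4 / (1 - perturbation_bound L) ^+ 2.
have dd : 0 < 1 - perturbation_bound L by rewrite subr_gt0.
have C0 : 0 < C by rewrite divr_gt0// exprn_gt0.
exists C; split => // eps supE.
have epsL k : `|eps k| <= L.
  by rewrite -lee_fin -supE; apply: ereal_sup_ubound; exists k.
have d0 := perturbation_bound_ge0 L_lt epsL.
have mI := measurable_symitv (2^-1 : R).
have half0 : 0 < 2^-1 :> R by rewrite invr_gt0.
split.
- move=> f1 f2 /PWpi_ft[phi1 [l1 E1]] /PWpi_ft[phi2 [l2 E2]] E12 x.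
  have l12 := L2onB mI l1 l2.
  apply/eqP; rewrite -subr_eq0; apply/eqP/cabs_eq0/eqP.
  rewrite E1 E2 -ftB// eq_le cabs_ge0 andbT.
  apply: (le_trans (cabs_ft_le x l12)).
  have := sample_lower L_lt epsL d1 l12 (lexx 0); rewrite mul0r; apply => F _.
  rewrite expr0n big1// => n _.
  by rewrite ftB// -E1 -E2 E12 subrr cabs0 expr0n.
- move=> f /PWpi_ft[phi [lphi E]].
  have -> : (L2norm f ^+ 2)%E = (nrm2 (symitv 2^-1) phi ^+ 2)%:E.
    have -> : f = ft 2^-1 phi by apply/funext.
    by rewrite L2norm_sqr ?sq2_ft ?nrm2K//; exact: L2on_ft.
  set S := esum _ _.
  have SM : (S <= (((1 + perturbation_bound L) * nrm2 (symitv 2^-1) phi) ^+ 2)%:E)%E.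
    apply: esum_le_finite => s us; under eq_bigr do rewrite E.
    exact: sample_upper.
  have S0 : (0 <= S)%E by apply: esum_ge0 => n _; rewrite lee_fin sqr_ge0.
  have Sfin : S \is a fin_num by rewrite ge0_fin_numE//; exact: le_lt_trans SM (ltry _).
  have finS0 : 0 <= fine S by exact: fine_ge0.
  have hl : nrm2 (symitv 2^-1) phi <= Num.sqrt (fine S) / (1 - perturbation_bound L).
    apply: (sample_lower L_lt epsL d1 lphi (sqrtr_ge0 _)) => F uF.
    rewrite sqr_sqrtr// -lee_fin fineK//.
    rewrite (eq_bigr (fun n : int => cabs (f (n%:~R + eps n)) ^+ 2)); last by move=> n _; rewrite E.
    exact: le_esum_finite.
  move: SM; rewrite -(fineK Sfin) -!EFinM !lee_fin => SM; split.
    rewrite ler_pdivrMl//; apply: (le_trans SM); rewrite exprMn ler_wpM2r ?sqr_ge0//.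
    apply: (@le_trans _ _ 4); first by move: d0 d1; move: (perturbation_bound L) => d ? ?; nra.
    rewrite /C ler_peMr// -exprVn exprn_ege1// invf_ge1//.
    by rewrite lerBlDr lerDl.
  have n0 := nrm2_ge0 (symitv 2^-1) phi.
  apply: (@le_trans _ _ ((Num.sqrt (fine S) / (1 - perturbation_bound L)) ^+ 2)).
    by rewrite lerXn2r ?nnegrE// (le_trans n0 hl).
  rewrite exprMn sqr_sqrtr// exprVn mulrC ler_wpM2r//.
  by rewrite /C ler_peMl ?ler1n// invr_ge0 sqr_ge0.
- have [Phi PhiP] := choice (dual_function L_lt epsL d1).
  have lPhi n := (PhiP n).1; have sPhi n := (PhiP n).2.
  exists (fun n => ft 2^-1 (Phi n)); split; first by move=> n; exact: ft_PWpi.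
  move=> f /PWpi_ft[phi [lphi E]] x; rewrite E.
  rewrite (_ : (fun n => _) = fun n : int => ft 2^-1 phi (n%:~R + eps n) * ft 2^-1 (Phi n) x); last first.
    by apply/funext => n; rewrite E.
  apply: abs_converges_toP.
    move=> s us; exact: (reconstruction_abs L_lt epsL d1 lPhi sPhi x lphi us).
  by move=> e e0; exact: (reconstruction_lim L_lt epsL d1 lPhi sPhi x lphi e0).
Qed.
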